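(* Let $t\ge0$ be a real number. There exists a field $L\subset\overline{\mathbb{Q}}$ satisfying $$t\le\mathcal{N}_h(L)\le\mathcal{N}_h(\mathcal{O}_L)\le 2t.$$ More precisely, let $K$ be any number field, let $(p_i)_i$ and $(d_i)_i$ be sequences of primes with $(p_i)_i$ strictly increasing, and let $p_i^{1/d_i}$ be $d_i$-th roots of $p_i$ such that the sequence $(p_i^{1/d_i})_i$ converges to $\exp(2t)$. Then the field $L$ generated over $K$ by all the $p_i^{1/d_i}$ satisfies $t\le\mathcal{N}_h(L)\le\mathcal{N}_h(\mathcal{O}_L)\le 2t$.
   Context: $h$ denotes the absolute logarithmic Weil height on $\overline{\mathbb{Q}}$: for $\alpha$ in a number field $F$, $h(\alpha)=\frac{1}{[F:\mathbb{Q}]}\sum_{v\in M_F}[F_v:\mathbb{Q}_v]\log\max\{1,|\alpha|_v\}$, where $M_F$ is the set of places of $F$ and $|\cdot|_v$ extends one of the standard absolute values on $\mathbb{Q}$. For $S\subset\overline{\mathbb{Q}}$, the Northcott number of $S$ with respect to $h$ is $\mathcal{N}_h(S)=\inf\{X\in[0,\infty) : \#\{\alpha\in S : h(\alpha)<X\}=\infty\}$, with $\inf\emptyset=\infty$. $\mathcal{O}_L$ is the ring of all algebraic integers in $L$. *)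

(* Defs.v *)
From mathcomp Require Export all_boot all_order all_algebra all_field.
From mathcomp Require Export complex.
From mathcomp Require Export all_classical all_reals all_analysis.
Export numFieldNormedType.Exports.

Set Implicit Arguments.
Unset Strict Implicit.
Unset Printing Implicit Defensive.

Import Order.TTheory GRing.Theory Num.Theory.
Local Open Scope classical_set_scope.
Local Open Scope ring_scope.

(* Number fields are [fieldExtType rat]; the algebraic closure of Q is [algC]. *)

Definition absolute_value (R : realType) (E : fieldType) (v : E -> R) : Prop :=
  [/\ forall x, 0 <= v x,
      forall x, v x = 0 <-> x = 0,
      {morph v : x y / x * y} &
      forall x y, v (x + y) <= v x + v y].

Definition padic_abs (R : realType) (p : nat) (q : rat) : R :=
  if q == 0 then 0
  else p%:R ^+ logn p `|denq q|%N / p%:R ^+ logn p `|numq q|%N.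

Definition standard_abs_rat (R : realType) (u : rat -> R) : Prop :=
  (forall q, u q = ratr `|q|) \/
  exists2 p : nat, prime p & forall q, u q = padic_abs R p q.

(* Each place of [F] contains exactly one absolute value extending a standard
    absolute value of Q; the place is represented by it. *)
Definition places (R : realType) (F : fieldExtType rat) : set (F -> R) :=
  [set v | absolute_value v /\ standard_abs_rat (fun q => v q%:A)].

Definition complete_abs (R : realType) (E : fieldType) (w : E -> R) : Prop :=
  forall u : nat -> E,
    (forall e : R, 0 < e -> exists N, forall m n,
       (N <= m)%N -> (N <= n)%N -> w (u m - u n) < e) ->
    exists l : E, forall e : R, 0 < e -> exists N, forall n,
      (N <= n)%N -> w (u n - l) < e.

Definition abs_closure (R : realType) (E : fieldType) (w : E -> R)
    (A : set E) : set E :=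
  [set y | forall e : R, 0 < e -> exists2 a, A a & w (y - a) < e].

Definition is_completion (R : realType) (F : fieldType) (v : F -> R)
    (E : fieldType) (w : E -> R) (j : {rmorphism F -> E}) : Prop :=
  [/\ absolute_value w, complete_abs w, forall x, w (j x) = v x &
      abs_closure w (range j) = setT].

Definition has_degree_over (E : fieldType) (A : set E) (n : nat) : Prop :=
  exists e : 'I_n -> E, forall y, exists! c : {ffun 'I_n -> E},
    (forall i, A (c i)) /\ y = \sum_i c i * e i.

(* [F_v : Q_v] = n, where Q_v is realized inside the completion F_v as the
    closure of Q.  The choice of the completion is immaterial, completions
    being unique up to isometric isomorphism over [F]. *)
Definition is_local_degree (R : realType) (F : fieldExtType rat) (v : F -> R)
    (n : nat) : Prop :=
  exists (E : fieldType) (w : E -> R) (j : {rmorphism F -> E}),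
    is_completion v w j /\
    has_degree_over (abs_closure w (range (fun q : rat => j q%:A))) n.

Definition local_degree (R : realType) (F : fieldExtType rat) (v : F -> R)
    : nat :=
  xget 0%N [set n | is_local_degree v n].

(* Only finitely many places contribute a nonzero term, so that the finitely
    supported sum is the sum over all the places. *)
Definition height_in (R : realType) (F : fieldExtType rat) (x : F) : R :=
  (\dim {:F})%:R^-1 *
  \sum_(v \in @places R F) (local_degree v)%:R * ln (Num.max 1 (v x)).

(* The height computed in some number field containing [a]; it does not
    depend on this field, and one exists by [num_field_exists]. *)
Definition weil_height (R : realType) (a : algC) : R :=
  xget 0 [set h | exists (F : fieldExtType rat) (j : {rmorphism F -> algC})
                         (x : F), j x = a /\ h = height_in R x].

Definition northcott_number (R : realType) (S : set algC) : \bar R :=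
  ereal_inf [set X%:E | X in
    [set X : R | 0 <= X /\
                 infinite_set [set a | S a /\ weil_height R a < X]]].

Definition subfield_set (L : set algC) : Prop :=
  [/\ L 1, forall x y, L x -> L y -> L (x - y) &
      forall x y, L x -> L y -> L (x / y)].

Definition generated_field (A : set algC) : set algC := smallest subfield_set A.

Definition integers_of (L : set algC) : set algC := L `&` [set x | x \in Aint].

Definition northcott_bounds (R : realType) (t : R) (L : set algC) : Prop :=
  [/\ (t%:E <= northcott_number R L)%E,
      (northcott_number R L <= northcott_number R (integers_of L))%E &
      (northcott_number R (integers_of L) <= (2 * t)%:E)%E].

(* Main.v *)
(* The height is a mean of [ln (max 1 (nu (g x)))] over the embeddings [g] of the
    field, where [nu] runs through fixed extensions to algC of the standard
    absolute values of Q; this identifies local degrees with numbers of embeddings.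

    Upper bound: the height of [r i] is [ln (p i) / d i], which tends to [2 t].

    Lower bound: adjoin the [r i] one after the other.  For large [i] the prime [p i]
    is unramified in the field [S] obtained before step [i], so that the terms of
    [a = \sum_(k < d i) c_k * r i ^+ k] have distinct [p i]-adic absolute values.
    When [a] is not in [S], this makes its conjugates over [S] [p i]-adically close
    to each other, and the product formula for the product of their differences gives
    [h(a) >= ln (p i) / (2 d i) - ln ((d i)!) / (d i (d i - 1))], which tends to [t].
    The elements below any fixed step lie in a number field, where Northcott's
    theorem applies.

    Existence: Chebyshev's estimate of the central binomial coefficient gives
    primes [p] and [d] with [ln p / d] arbitrarily close to [2 t]. *)
From HB Require Import structures.
Require Import Defs.
From mathcomp Require Import ring lra zify perm.

Set Implicit Arguments.
Unset Strict Implicit.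
Unset Printing Implicit Defensive.

Import Order.TTheory GRing.Theory Num.Theory.
Local Open Scope classical_set_scope.
Local Open Scope ring_scope.

(** * Absolute values and completions *)

(** The factor 2 between the two bounds is lost in the Vandermonde determinant: each of its d (d -
    1) / 2 differences is only known to gain one factor [p^(-1/d)], whereas the height of [a] enters
    d (d - 1) times. The term [ln d! / (d (d - 1))] is the archimedean cost. It vanishes in the
    limit because the [d i] tend to infinity, [ln (p i) / d i] being bounded while [p i] is not.

    Local degrees are defined through an unspecified completion, so completions, their universal
    property and the equivalence of norms are established for arbitrary absolute values. The same
    tools then replace ideals and their factorization: being unramified at p is expressed by value
    groups, and for every extension of the p-adic absolute value to algC at once, because the
    product formula runs through all the embeddings. *)

Section AbsoluteValue.
Variables (R : realType) (E : fieldType) (v : E -> R).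
Hypothesis hv : absolute_value v.

Lemma av_ge0 x : 0 <= v x. Proof. by case: hv. Qed.
Lemma av_eq0 x : (v x == 0) = (x == 0).
Proof. by case: hv => _ h _ _; apply/eqP/eqP => /h. Qed.
Lemma avM x y : v (x * y) = v x * v y. Proof. by case: hv => _ _ h _; rewrite h. Qed.
Lemma avD x y : v (x + y) <= v x + v y. Proof. by case: hv. Qed.
Lemma av0 : v 0 = 0. Proof. by apply/eqP; rewrite av_eq0. Qed.
Lemma av_gt0 x : (0 < v x) = (x != 0).
Proof. by rewrite lt_neqAle av_ge0 andbT eq_sym av_eq0. Qed.
Lemma av1 : v 1 = 1.
Proof.
have n0 : v 1 != 0 by rewrite av_eq0 oner_neq0.
by apply: (mulfI n0); rewrite -avM !mulr1.
Qed.
Lemma avX x n : v (x ^+ n) = v x ^+ n.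
Proof. by elim: n => [|n IH]; rewrite ?expr0 ?av1// !exprS avM IH. Qed.
Lemma avN x : v (- x) = v x.
Proof.
suff h : v (- 1) = 1 by rewrite -mulN1r avM h mul1r.
apply/eqP; rewrite -(@eqrXn2 _ 2%N) ?av_ge0 ?ler01 //.
by rewrite -avX sqrrN !expr1n av1.
Qed.
Lemma avBC x y : v (x - y) = v (y - x). Proof. by rewrite -avN opprB. Qed.
Lemma avV x : v x^-1 = (v x)^-1.
Proof.
have [->|x0] := eqVneq x 0; first by rewrite invr0 av0 invr0.
have vx : v x != 0 by rewrite av_eq0.
by apply: (mulfI vx); rewrite -avM !divff // av1.
Qed.
Lemma avB_le x y : v (x - y) <= v x + v y.
Proof. by rewrite -(avN y) avD. Qed.
Lemma av_dist x y : `|v x - v y| <= v (x - y).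
Proof.
rewrite ler_norml; have h1 := avD (x - y) y; have h2 := avD (y - x) x.
rewrite !subrK (avBC y) in h1 h2; lra.
Qed.
Lemma av_sum I (r : seq I) (P : pred I) (F : I -> E) :
  v (\sum_(i <- r | P i) F i) <= \sum_(i <- r | P i) v (F i).
Proof.
elim/big_rec2: _ => [|i a b _ h]; first by rewrite av0.
by apply: le_trans (avD _ _) _; rewrite lerD2l.
Qed.
Lemma av_prod I (r : seq I) (P : pred I) (F : I -> E) :
  v (\prod_(i <- r | P i) F i) = \prod_(i <- r | P i) v (F i).
Proof. by elim/big_rec2: _ => [|i a b _ h]; rewrite ?av1 // avM h. Qed.

End AbsoluteValue.

(** * Limits and Cauchy sequences for an absolute value *)

Section CompleteField.
Variables (R : realType).

Definition cauchy_for (E : fieldType) (v : E -> R) (u : nat -> E) : Prop :=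
  forall e : R, 0 < e -> exists N, forall m n,
    (N <= m)%N -> (N <= n)%N -> v (u m - u n) < e.

Definition tends_to (E : fieldType) (v : E -> R) (u : nat -> E) (l : E) : Prop :=
  forall e : R, 0 < e -> exists N, forall n, (N <= n)%N -> v (u n - l) < e.

Variables (E : fieldType) (v : E -> R).
Hypothesis hv : absolute_value v.

Lemma cauchyD u1 u2 : cauchy_for v u1 -> cauchy_for v u2 ->
  cauchy_for v (fun n => u1 n + u2 n).
Proof.
move=> h1 h2 e e0; have e2 : 0 < e / 2 by lra.
have [N1 k1] := h1 _ e2; have [N2 k2] := h2 _ e2.
exists (maxn N1 N2) => m n; rewrite !geq_max => /andP[a1 a2] /andP[b1 b2].
have -> : u1 m + u2 m - (u1 n + u2 n) = (u1 m - u1 n) + (u2 m - u2 n) by ring.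
apply: le_lt_trans (avD hv _ _) _.
have := k1 _ _ a1 b1; have := k2 _ _ a2 b2; lra.
Qed.

Lemma cauchy_bounded u : cauchy_for v u -> exists2 C, 0 < C & forall n, v (u n) <= C.
Proof.
move=> /(_ 1 ltr01)[N h].
exists (1 + \sum_(n < N.+1) v (u n)).
  by apply: ltr_pwDl => //; apply: sumr_ge0 => *; apply: av_ge0.
move=> n; have [nN|Nn] := leqP n N.
  rewrite (bigD1 (Ordinal (nN : (n < N.+1)%N))) //= [leLHS](_ : _ = 0 + (v (u n) + 0)).
    by rewrite lerD// lerD// sumr_ge0// => *; apply: av_ge0.
  by rewrite add0r addr0.
have := h n N (ltnW Nn) (leqnn N).
rewrite big_ord_recr /= => k.
have := avD hv (u n - u N) (u N); rewrite subrK.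
have : 0 <= \sum_(i < N) v (u i) by apply: sumr_ge0 => *; apply: av_ge0.
lra.
Qed.

Lemma cauchyM u1 u2 : cauchy_for v u1 -> cauchy_for v u2 ->
  cauchy_for v (fun n => u1 n * u2 n).
Proof.
move=> h1 h2 e e0.
have [C1 C10 b1] := cauchy_bounded h1; have [C2 C20 b2] := cauchy_bounded h2.
have e1 : 0 < e / (2 * C2) by rewrite divr_gt0 // mulr_gt0.
have e2 : 0 < e / (2 * C1) by rewrite divr_gt0 // mulr_gt0.
have [N1 k1] := h1 _ e1; have [N2 k2] := h2 _ e2.
exists (maxn N1 N2) => m n; rewrite !geq_max => /andP[a1 a2] /andP[c1 c2].
have -> : u1 m * u2 m - u1 n * u2 n = (u1 m - u1 n) * u2 m + u1 n * (u2 m - u2 n).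
  by ring.
apply: le_lt_trans (avD hv _ _) _; rewrite !(avM hv).
have -> : e = e / (2 * C2) * C2 + C1 * (e / (2 * C1)).
  by field; rewrite !gt_eqF.
apply: ltr_leD.
  apply: (@le_lt_trans _ _ (v (u1 m - u1 n) * C2)).
    by rewrite ler_wpM2l ?(av_ge0 hv).
  by rewrite ltr_pM2r // k1.
apply: ler_pM; rewrite ?(av_ge0 hv) //; apply: ltW; exact: k2.
Qed.

Lemma tends_toD u1 u2 l1 l2 : tends_to v u1 l1 -> tends_to v u2 l2 ->
  tends_to v (fun n => u1 n + u2 n) (l1 + l2).
Proof.
move=> h1 h2 e e0; have e2 : 0 < e / 2 by lra.
have [N1 k1] := h1 _ e2; have [N2 k2] := h2 _ e2.
exists (maxn N1 N2) => n; rewrite !geq_max => /andP[a1 a2].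
have -> : u1 n + u2 n - (l1 + l2) = (u1 n - l1) + (u2 n - l2) by ring.
apply: le_lt_trans (avD hv _ _) _.
have := k1 _ a1; have := k2 _ a2; lra.
Qed.

Lemma tends_toZ a u l : tends_to v u l -> tends_to v (fun n => a * u n) (a * l).
Proof.
move=> h e e0.
have a0 : 0 < v a + 1 by have := av_ge0 hv a; lra.
have [N k] := h _ (divr_gt0 e0 a0).
exists N => n /k; rewrite -mulrBr (avM hv) ltr_pdivlMr // => h1.
apply: le_lt_trans h1; rewrite mulrC ler_wpM2l ?(av_ge0 hv) //; lra.
Qed.

Lemma tends_to_unique u l1 l2 : tends_to v u l1 -> tends_to v u l2 -> l1 = l2.
Proof.
move=> h1 h2; apply/eqP; rewrite -subr_eq0 -(av_eq0 hv); apply/negPn/negP => n0.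
have e0 : 0 < v (l1 - l2) / 2 by rewrite divr_gt0 // lt_neqAle eq_sym n0 (av_ge0 hv).
have [N1 k1] := h1 _ e0; have [N2 k2] := h2 _ e0.
have := k1 _ (leq_maxl N1 N2); have := k2 _ (leq_maxr N1 N2).
have := avB_le hv (u (maxn N1 N2) - l2) (u (maxn N1 N2) - l1).
have -> : u (maxn N1 N2) - l2 - (u (maxn N1 N2) - l1) = l1 - l2 by ring.
lra.
Qed.

Lemma tends_to_cauchy u l : tends_to v u l -> cauchy_for v u.
Proof.
move=> h e e0; have e2 : 0 < e / 2 by lra.
have [N k] := h _ e2; exists N => m n mN nN.
have -> : u m - u n = (u m - l) - (u n - l) by ring.
apply: le_lt_trans (avB_le hv _ _) _.
have := k _ mN; have := k _ nN; lra.
Qed.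

Lemma tends_to_cst l : tends_to v (fun=> l) l.
Proof. by move=> e e0; exists 0%N => n _; rewrite subrr (av0 hv). Qed.

Lemma tends_toM u1 u2 l1 l2 : tends_to v u1 l1 -> tends_to v u2 l2 ->
  tends_to v (fun n => u1 n * u2 n) (l1 * l2).
Proof.
move=> h1 h2 e e0.
have [C1 C10 b1] := cauchy_bounded (tends_to_cauchy h1).
have l20 : 0 < v l2 + 1 by have := av_ge0 hv l2; lra.
have e1 : 0 < e / (2 * (v l2 + 1)) by rewrite divr_gt0 // mulr_gt0.
have e2 : 0 < e / (2 * C1) by rewrite divr_gt0 // mulr_gt0.
have [N1 k1] := h1 _ e1; have [N2 k2] := h2 _ e2.
exists (maxn N1 N2) => n; rewrite !geq_max => /andP[a1 a2].
have -> : u1 n * u2 n - l1 * l2 = (u1 n - l1) * l2 + u1 n * (u2 n - l2) by ring.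
apply: le_lt_trans (avD hv _ _) _; rewrite !(avM hv).
have -> : e = e / (2 * (v l2 + 1)) * (v l2 + 1) + C1 * (e / (2 * C1)).
  by field; rewrite !gt_eqF.
apply: ltr_leD.
  apply: (@le_lt_trans _ _ (v (u1 n - l1) * (v l2 + 1))).
    by rewrite ler_wpM2l ?(av_ge0 hv) // lerDl.
  by rewrite ltr_pM2r // k1.
apply: ler_pM; rewrite ?(av_ge0 hv) //; apply: ltW; exact: k2.
Qed.

Lemma tends_to_sum m (u : nat -> nat -> E) (l : nat -> E) :
  (forall k, (k < m)%N -> tends_to v (u k) (l k)) ->
  tends_to v (fun n => \sum_(k < m) u k n) (\sum_(k < m) l k).
Proof.
elim: m => [_|m IH h].
  rewrite big_ord0 (_ : (fun _ => _) = fun=> 0); first exact: tends_to_cst.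
  by apply/funext => n; rewrite big_ord0.
rewrite big_ord_recr /= (_ : (fun _ => _) = fun n => \sum_(k < m) u k n + u m n).
  by apply: tends_toD (h _ _) => //; apply: IH => k km; apply: h; apply: ltnW.
by apply/funext => n; rewrite big_ord_recr.
Qed.

Lemma abs_closureP (A : set E) l : abs_closure v A l ->
  exists2 u : nat -> E, forall n, A (u n) & tends_to v u l.
Proof.
move=> h.
have e0 n : 0 < n.+1%:R^-1 :> R by rewrite invr_gt0.
have h' n : exists a, A a /\ v (l - a) < n.+1%:R^-1.
  by have [a Aa la] := h _ (e0 n); exists a.
have [u hu] := choice h'.
exists u => [n|e e1]; first by have [] := hu n.
have [N hN] : exists N : nat, e^-1 < N%:R.
  exists (Num.truncn e^-1).+1; exact: truncnS_gt.
exists N => n Nn; rewrite (avBC hv); have [_ h1] := hu n; apply: lt_trans h1 _.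
rewrite invf_plt ?posrE //; apply: lt_le_trans hN _.
by rewrite ler_nat; apply: leq_trans Nn _.
Qed.

End CompleteField.

Section RealComplete.
Variable R : realType.

Lemma absolute_value_normr : absolute_value (Num.norm : R -> R).
Proof.
split=> [x|x|x y|x y]; rewrite ?normr_ge0 ?normrM ?ler_normD //.
by split=> [/normr0_eq0|->]; rewrite ?normr0.
Qed.

Lemma complete_normr : complete_abs (Num.norm : R -> R).
Proof.
move=> u hu.
have cu : cauchy (u n @[n --> \oo]).
  apply/cauchy_ballP => e e0.
  have [N hN] := hu _ e0.
  exists (u @` [set n | (N <= n)%N], u @` [set n | (N <= n)%N]) => /=.
    by split; exists N => // n /= Nn; exists n.
  by move=> [x y] /= [[m Nm <-] [n Nn <-]]; apply: hN.
have /cauchy_cvgP/cvg_ex[l hl] := cu.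
exists l => e e0.
have /cvgrPdist_lt/(_ _ e0)[N _ hN] := hl.
by exists N => n Nn; rewrite distrC; apply: hN.
Qed.

Lemma tends_to_le (a b : nat -> R) la lb : tends_to Num.norm a la ->
  tends_to Num.norm b lb -> (forall n, a n <= b n) -> la <= lb.
Proof.
move=> ha hb ab; rewrite leNgt; apply/negP => h.
have e0 : 0 < (la - lb) / 2 by lra.
have [N1 h1] := ha _ e0; have [N2 h2] := hb _ e0.
have := h1 _ (leq_maxl N1 N2); have := h2 _ (leq_maxr N1 N2).
have := ab (maxn N1 N2).
rewrite !ltr_norml => k /andP[_ k1] /andP[k2 _]; lra.
Qed.

End RealComplete.

(** * Construction of the completion as Cauchy sequences modulo null sequences *)

Section Completion.
Variables (R : realType) (E : fieldType) (v : E -> R).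

(** The guard [absolute_value v] makes this a subring for every function [v], so that the ring
    instances do not depend on a proof about [v]. *)
Definition cauchy_pred : {pred (nat -> E)} := fun u => `[< absolute_value v -> cauchy_for v u >].

Fact cauchy_pred_subring : subring_closed cauchy_pred.
Proof.
split=> [|u1 u2 /asboolP h1 /asboolP h2|u1 u2 /asboolP h1 /asboolP h2]; apply/asboolP => hv.
- by apply: (tends_to_cauchy hv (l := 1)); apply: tends_to_cst.
- apply: (cauchyD hv (h1 hv)) => e e0; have [N hN] := h2 hv e e0.
  exists N => m n Nm Nn; change (v (- u2 m - - u2 n) < e).
  by rewrite -(avN hv) opprD !opprK hN.
- exact: cauchyM (h1 hv) (h2 hv).
Qed.
HB.instance Definition _ := GRing.isSubringClosed.Build _ cauchy_pred cauchy_pred_subring.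

Definition cauchy_seqs := {u : nat -> E | u \in cauchy_pred}.
HB.instance Definition _ := SubChoice.on cauchy_seqs.
HB.instance Definition _ := [SubChoice_isSubComNzRing of cauchy_seqs by <:].

Definition to_cauchy_seqs u (hu : u \in cauchy_pred) : cauchy_seqs :=
  exist (fun u => u \in cauchy_pred) u hu.

Lemma cauchy_seqsP (hv : absolute_value v) (u : cauchy_seqs) : cauchy_for v (val u).
Proof. by have /asboolP := valP u; apply. Qed.

Definition null_seqs : {pred cauchy_seqs} :=
  fun u => `[< absolute_value v -> tends_to v (val u) 0 >].

Hypothesis hv : absolute_value v.

Fact null_seqs_ideal : idealr_closed null_seqs.
Proof.
split=> [||a x y /asboolP h1 /asboolP h2]; first by apply/asboolP => _; apply: tends_to_cst.
  apply/negP => /asboolP/(_ hv 1 ltr01)[N /(_ N (leqnn N))].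
  by rewrite subr0 /= (av1 hv) ltxx.
apply/asboolP => _; rewrite -[0](addr0 0); apply: (tends_toD hv _ (h2 hv)).
have [C C0 hC] := cauchy_bounded hv (cauchy_seqsP hv a).
move=> e e0; have [N hN] := h1 hv _ (divr_gt0 e0 C0).
exists N => n /hN; rewrite !subr0 /= (avM hv) ltr_pdivlMr // => h.
by apply: le_lt_trans h; rewrite mulrC ler_wpM2l ?(av_ge0 hv) //; exact: hC.
Qed.
HB.instance Definition _ := isIdealr.Build _ null_seqs null_seqs_ideal.

Definition completion := {ideal_quot null_seqs}.
HB.instance Definition _ := GRing.ComNzRing.on completion.
Local Notation pi := (\pi_completion)%qT.

Lemma pi_completion_eq0 u : (pi u == 0) = (u \in null_seqs).
Proof. by rewrite -(rmorph0 pi) -Quotient.idealrBE subr0. Qed.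

Lemma null_seqsP u : reflect (tends_to v (val u) 0) (u \in null_seqs).
Proof. by apply: (iffP (asboolP _)) => h //; apply: h. Qed.

(* Away from zero, the termwise inverse of a Cauchy sequence is Cauchy; the
    finitely many terms where it is not are irrelevant. *)
Lemma completion_inverse (x : completion) : x != 0 -> exists y, y * x = 1.
Proof.
rewrite -[x]reprK pi_completion_eq0; set u := repr x => nu.
have cu := cauchy_seqsP hv u.
have [d d0 [N hN]] : exists2 d, 0 < d & exists N, forall n, (N <= n)%N -> d <= v (val u n).
  apply: contrapT => h; move/null_seqsP: nu; apply => e e0.
  have e2 : 0 < e / 2 by lra.
  have [N hN] := cu _ e2.
  have [n Nn vn] : exists2 n, (N <= n)%N & v (val u n) < e / 2.
    apply: contrapT => h'; apply: h; exists (e / 2) => //; exists N => n Nn.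
    by rewrite leNgt; apply/negP => k; apply: h'; exists n.
  exists N => m Nm; rewrite subr0 -(subrK (val u n) (val u m)).
  apply: le_lt_trans (avD hv _ _) _; have := hN _ _ Nm Nn; lra.
have ci : (fun n => (val u n)^-1) \in cauchy_pred.
  apply/asboolP => _ e e0.
  have [N1 hN1] := cu _ (mulr_gt0 e0 (mulr_gt0 d0 d0)).
  exists (maxn N N1) => m n; rewrite !geq_max => /andP[a1 a2] /andP[b1 b2].
  have dm := hN _ a1; have dn := hN _ b1.
  have um : val u m != 0 by rewrite -(av_gt0 hv); apply: lt_le_trans dm.
  have un : val u n != 0 by rewrite -(av_gt0 hv); apply: lt_le_trans dn.
  have -> : (val u m)^-1 - (val u n)^-1 = (val u n - val u m) / (val u m * val u n).
    by field; rewrite um un.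
  rewrite (avM hv) (avV hv) (avM hv) ltr_pdivrMr; last first.
    by rewrite mulr_gt0 ?(av_gt0 hv).
  apply: lt_le_trans (hN1 _ _ b2 a2) _.
  by rewrite ler_wpM2l ?(ltW e0) // ler_pM // ltW.
exists (pi (to_cauchy_seqs ci)).
rewrite -rmorphM -(rmorph1 pi); apply/eqP; rewrite -subr_eq0 -rmorphB pi_completion_eq0.
apply/null_seqsP => e e0; exists N => n /hN dn.
have un : val u n != 0 by rewrite -(av_gt0 hv); apply: lt_le_trans dn.
change (v ((val u n)^-1 * val u n - 1 - 0) < e).
by rewrite mulVf // subrr subr0 (av0 hv).
Qed.

Definition completion_inv (x : completion) : completion :=
  if x == 0 then 0 else xget 0 [set y | y * x = 1].

Fact completion_mulVf x : x != 0 -> completion_inv x * x = 1.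
Proof.
move=> x0; rewrite /completion_inv (negPf x0); case: xgetP => // h.
by have [y hy] := completion_inverse x0; have := h y.
Qed.
Fact completion_inv0 : completion_inv 0 = 0.
Proof. by rewrite /completion_inv eqxx. Qed.
HB.instance Definition _ := GRing.ComNzRing_isField.Build completion
  completion_mulVf completion_inv0.

Lemma cst_cauchy x : (fun=> x) \in cauchy_pred.
Proof. by apply/asboolP => _; apply: tends_to_cauchy (tends_to_cst hv x). Qed.

Definition to_completion (x : E) : completion := pi (to_cauchy_seqs (cst_cauchy x)).

Fact to_completion_zmod : zmod_morphism to_completion.
Proof. by move=> x y; rewrite /to_completion -rmorphB; congr (pi _); apply: val_inj. Qed.
Fact to_completion_monoid : monoid_morphism to_completion.
Proof.
split; first by rewrite -(rmorph1 pi); congr (pi _); apply: val_inj.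
by move=> x y; rewrite /to_completion -rmorphM; congr (pi _); apply: val_inj.
Qed.
HB.instance Definition _ := GRing.isZmodMorphism.Build _ _ to_completion to_completion_zmod.
HB.instance Definition _ := GRing.isMonoidMorphism.Build _ _ to_completion to_completion_monoid.

Definition completion_abs (x : completion) : R :=
  xget 0 [set l | tends_to Num.norm (v \o val (repr x)) l].

(** The limit exists since [av_dist] turns Cauchy sequences of [E] into real ones; another
    representative differs by a null sequence, which does not change it. *)
Lemma completion_absP u : tends_to Num.norm (v \o val u) (completion_abs (pi u)).
Proof.
have h : tends_to Num.norm (v \o val (repr (pi u))) (completion_abs (pi u)).
  rewrite /completion_abs; case: xgetP => // h.
  have [|l hl] := @complete_normr R (v \o val (repr (pi u))); last by have := h l hl.
  move=> e e0; have [N hN] := cauchy_seqsP hv (repr (pi u)) e0.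
  by exists N => m n Nm Nn; apply: le_lt_trans (av_dist hv _ _) (hN _ _ Nm Nn).
have /null_seqsP k : repr (pi u) - u \in null_seqs.
  by rewrite -pi_completion_eq0 rmorphB /= reprK subrr.
move=> e e0; have e2 : 0 < e / 2 by lra.
have [N1 h1] := h _ e2; have [N2 h2] := k _ e2.
exists (maxn N1 N2) => n; rewrite geq_max => /andP[/h1 a1 /h2 /=]; rewrite subr0 => a2.
apply: le_lt_trans (ler_distD (v (val (repr (pi u)) n)) _ _) _.
rewrite [e]splitr ltrD //; apply: le_lt_trans (av_dist hv _ _) _.
by rewrite (avBC hv).
Qed.

Lemma completion_abs_lim u l :
  tends_to Num.norm (v \o val u) l -> completion_abs (pi u) = l.
Proof. by move=> h; apply: (tends_to_unique (@absolute_value_normr R)) h; apply: completion_absP. Qed.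

Lemma completion_abs_absolute : absolute_value completion_abs.
Proof.
have ge0 x : 0 <= completion_abs x.
  rewrite -[x]reprK; apply: (tends_to_le (tends_to_cst (@absolute_value_normr R) 0)
    (@completion_absP _)) => n /=; exact: av_ge0.
split=> // [x|x y|x y].
- split=> [|->]; last first.
    rewrite -(rmorph0 pi); apply: completion_abs_lim.
    by move=> e e0; exists 0%N => n _ /=; rewrite (av0 hv) subrr normr0.
  rewrite -[x]reprK => h; apply/eqP; rewrite pi_completion_eq0; apply/null_seqsP.
  move=> e e0; have [N hN] := @completion_absP (repr x) _ e0.
  by exists N => n /hN /=; rewrite h !subr0 ger0_norm ?(av_ge0 hv).
- rewrite -[x]reprK -[y]reprK -rmorphM; apply: completion_abs_lim.
  rewrite (_ : _ \o _ = fun n => v (val (repr x) n) * v (val (repr y) n)).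
    exact: (tends_toM (@absolute_value_normr R) (@completion_absP _) (@completion_absP _)).
  by apply/funext => n /=; rewrite (avM hv).
- rewrite -[x]reprK -[y]reprK -rmorphD; apply: (tends_to_le (@completion_absP _)
    (tends_toD (@absolute_value_normr R) (@completion_absP _) (@completion_absP _))) => n.
  exact: avD hv _ _.
Qed.

Lemma completion_absE x : completion_abs (to_completion x) = v x.
Proof.
apply: completion_abs_lim => e e0; exists 0%N => n _ /=.
by rewrite subrr normr0.
Qed.

Lemma completion_abs_le_near u c N :
  (forall n, (N <= n)%N -> v (val u n) <= c) -> completion_abs (pi u) <= c.
Proof.
move=> h; apply: (tends_to_le (a := fun n => v (val u (n + N)%N)) _
  (tends_to_cst (@absolute_value_normr R) c)) => [e e0|n]; last by rewrite h ?leq_addl.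
have [M hM] := @completion_absP u _ e0; exists M => n Mn.
by apply: (hM (n + N)%N); apply: leq_trans Mn (leq_addr _ _).
Qed.

Lemma completion_dense (x : completion) (e : R) : 0 < e ->
  exists a, completion_abs (x - to_completion a) < e.
Proof.
move=> e0; have e2 : 0 < e / 2 by lra.
have [N hN] := cauchy_seqsP hv (repr x) e2.
exists (val (repr x) N).
pose u := repr x - to_cauchy_seqs (cst_cauchy (val (repr x) N)).
have <- : pi u = x - to_completion (val (repr x) N) by rewrite rmorphB /= reprK.
apply: le_lt_trans (_ : e / 2 < e); last by lra.
apply: (@completion_abs_le_near u _ N) => n Nn; apply: ltW; exact: hN.
Qed.

Lemma completion_complete : complete_abs completion_abs.
Proof.
have hw := completion_abs_absolute.
move=> X hX.
have e0 n : 0 < n.+1%:R^-1 :> R by rewrite invr_gt0.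
(* Diagonal argument: [X n] is replaced by a constant [a n] at distance less than [1 / (n + 1)], and
   the class of the sequence [a] is the limit. *)
have [a ha] := choice (fun n => completion_dense (X n) (e0 n)).
have small (e : R) : 0 < e -> exists N, forall n, (N <= n)%N ->
    completion_abs (X n - to_completion (a n)) < e.
  move=> h; exists (Num.truncn e^-1) => n Nn; apply: lt_le_trans (ha n) _.
  rewrite invf_ple ?posrE //; apply: ltW; apply: lt_le_trans (truncnS_gt _) _.
  by rewrite ler_nat.
have ca : a \in cauchy_pred.
  apply/asboolP => _ e h; have e3 : 0 < e / 3 by lra.
  have [N1 h1] := hX _ e3; have [N2 h2] := small _ e3.
  exists (maxn N1 N2) => m n; rewrite !geq_max => /andP[a1 a2] /andP[b1 b2].
  rewrite -completion_absE rmorphB /=.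
  have -> : to_completion (a m) - to_completion (a n) =
    (X m - X n) - (X m - to_completion (a m)) + (X n - to_completion (a n)) by ring.
  apply: le_lt_trans (avD hw _ _) _.
  apply: lt_le_trans (_ : e / 3 + e / 3 + e / 3 <= e); last by lra.
  rewrite ltrD ?h2 //; apply: le_lt_trans (avB_le hw _ _) _.
  by rewrite ltrD ?h1 ?h2.
pose u : cauchy_seqs := to_cauchy_seqs ca.
exists (pi u) => e h; have e2 : 0 < e / 2 by rewrite divr_gt0.
have [N1 h1] := small _ e2; have [N2 h2] := cauchy_seqsP hv u e2.
exists (maxn N1 N2) => n; rewrite geq_max => /andP[a1 a2].
have -> : X n - pi u = (X n - to_completion (a n)) + (to_completion (a n) - pi u) by ring.
apply: le_lt_trans (avD hw _ _) _; rewrite [e]splitr ltr_leD ?h1 //.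
rewrite /to_completion -rmorphB; apply: (@completion_abs_le_near _ _ N2) => m Nm.
by apply: ltW; apply: h2.
Qed.

Lemma completionP : is_completion v completion_abs to_completion.
Proof.
split; [exact: completion_abs_absolute|exact: completion_complete|exact: completion_absE|].
apply/seteqP; split=> // x _ e e0; have [a ha] := completion_dense x e0.
by exists (to_completion a) => //; exists a.
Qed.

End Completion.

Lemma completion_exists (R : realType) (F : fieldType) (v : F -> R) :
  absolute_value v ->
  exists (E : fieldType) (w : E -> R) (j : {rmorphism F -> E}), is_completion v w j.
Proof. by move=> hv; exists (completion hv), (@completion_abs _ _ _ hv), (to_completion hv); apply: completionP. Qed.

Lemma rmorphism_of (A B : nzRingType) (f : A -> B) :
  zmod_morphism f -> monoid_morphism f -> exists g : {rmorphism A -> B}, forall x, g x = f x.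
Proof.
move=> fz fm.
pose g : {rmorphism A -> B} := HB.pack f (GRing.isZmodMorphism.Build _ _ f fz)
  (GRing.isMonoidMorphism.Build _ _ f fm).
by exists g.
Qed.

(** If [a / b = 1 + q] with [q > 0], Bernoulli's inequality makes [(a / b) ^+ N] exceed any constant
    [C]. *)
Lemma le_of_exp_le (R : realType) (a b C : R) : 0 <= a -> 0 <= b ->
  (forall N : nat, a ^+ N <= C * b ^+ N) -> a <= b.
Proof.
move=> a0 b0 h; rewrite leNgt; apply/negP => ba.
have C0 : 0 < C by have := h 0%N; rewrite !expr0 mulr1; lra.
have [b0'|b0'] := eqVneq b 0.
  by have := h 1%N; rewrite b0' mulr0 expr1; rewrite b0' in ba; lra.
have bp : 0 < b by rewrite lt_neqAle eq_sym b0'.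
set q := a / b - 1.
have q0 : 0 < q by rewrite /q subr_gt0 ltr_pdivlMr // mul1r.
have bern N : 1 + N%:R * q <= (1 + q) ^+ N.
  elim: N => [|N IH]; first by rewrite mul0r addr0 expr0.
  rewrite exprS; apply: le_trans (ler_wpM2l _ IH); last by lra.
  have : 0 <= N%:R * (q * q) by rewrite mulr_ge0 // mulr_ge0 // ltW.
  rewrite -natr1; nra.
pose N := (Num.truncn (C / q)).+1.
have hN : C / q < N%:R by apply: truncnS_gt.
have := h N; rewrite leNgt => /negP; apply.
rewrite -ltr_pdivlMr ?exprn_gt0 // -expr_div_n.
have -> : a / b = 1 + q by rewrite /q; ring.
apply: lt_le_trans (bern N); rewrite ltr_pdivrMr // in hN; lra.
Qed.

Section UniversalProperty.
Variables (R : realType) (F E0 E1 : fieldType).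
Variables (v : F -> R) (w0 : E0 -> R) (w1 : E1 -> R).
Variables (j0 : {rmorphism F -> E0}) (k : {rmorphism F -> E1}).
Hypothesis E0P : is_completion v w0 j0.
Hypothesis w1P : absolute_value w1.
Hypothesis w1c : complete_abs w1.
Hypothesis kv : forall x, w1 (k x) = v x.

(** Extension by continuity: [f y] is the limit of [k (u n)] for some [u] with [j0 (u n)] tending to
    [y]. It does not depend on [u] ([fE]), and the morphism laws follow by choosing [u] suitably. *)
Lemma completion_extension : exists Phi : {rmorphism E0 -> E1},
  (forall x, Phi (j0 x) = k x) /\ (forall y, w1 (Phi y) = w0 y).
Proof.
have [w0P _ jv dense] := E0P.
have approx y : exists u, tends_to w0 (j0 \o u) y.
  have : abs_closure w0 (range j0) y by rewrite dense.
  move=> /(abs_closureP w0P)[a ha ay].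
  have [u hu] := choice (fun n => let: ex_intro2 x _ h := ha n in ex_intro _ x h).
  by exists u; rewrite (_ : _ \o _ = a) //; apply/funext => n /=.
have ku_cvg u y : tends_to w0 (j0 \o u) y -> exists l, tends_to w1 (k \o u) l.
  move=> /(tends_to_cauchy w0P) cu; apply: w1c => e e0.
  have [N hN] := cu _ e0; exists N => m n Nm Nn /=.
  by rewrite -rmorphB kv -jv rmorphB /=; apply: hN.
have [U hU] := choice approx.
have [f hf] := choice (fun y => ku_cvg _ _ (hU y)).
have fE u y : tends_to w0 (j0 \o u) y -> tends_to w1 (k \o u) (f y).
  move=> uy; rewrite -[f y]addr0.
  have : tends_to w1 (k \o (fun n => u n - U y n)) 0.
    move=> e e0; have e2 : 0 < e / 2 by lra.
    have [N1 h1] := uy _ e2; have [N2 h2] := hU y _ e2.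
    exists (maxn N1 N2) => n; rewrite geq_max => /andP[/h1 a1 /h2 a2] /=.
    rewrite subr0 kv -jv rmorphB /=.
    have -> : j0 (u n) - j0 (U y n) = (j0 (u n) - y) - (j0 (U y n) - y) by ring.
    by apply: le_lt_trans (avB_le w0P _ _) _; rewrite [e]splitr ltrD.
  move=> /(tends_toD w1P (hf y)); congr tends_to; apply/funext => n /=.
  by rewrite rmorphB /= addrC subrK.
have fz : zmod_morphism f.
  move=> x y; apply: (tends_to_unique w1P (u := k \o (fun n => U x n - U y n))).
    apply: fE; rewrite (_ : _ \o _ = fun n => j0 (U x n) + (-1) * j0 (U y n)).
      by rewrite -[- y]mulN1r; apply: (tends_toD w0P (hU x) (tends_toZ w0P _ (hU y))).
    by apply/funext => n; rewrite /= rmorphB mulN1r.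
  rewrite (_ : _ \o _ = fun n => k (U x n) + (-1) * k (U y n)).
    by rewrite -[- f y]mulN1r; apply: (tends_toD w1P (hf x) (tends_toZ w1P _ (hf y))).
  by apply/funext => n; rewrite /= rmorphB mulN1r.
have fj x : f (j0 x) = k x.
  apply: (tends_to_unique w1P (u := fun=> k x)); last exact: tends_to_cst.
  by apply: (fE (fun=> x)); apply: (tends_to_cst w0P).
have fm : monoid_morphism f.
  split=> [|x y]; first by rewrite -(rmorph1 j0) fj rmorph1.
  apply: (tends_to_unique w1P (u := k \o (fun n => U x n * U y n))).
    apply: fE; rewrite (_ : _ \o _ = fun n => j0 (U x n) * j0 (U y n)).
      exact: (tends_toM w0P (hU x) (hU y)).
    by apply/funext => n; rewrite /= rmorphM.
  rewrite (_ : _ \o _ = fun n => k (U x n) * k (U y n)).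
    exact: (tends_toM w1P (hf x) (hf y)).
  by apply/funext => n; rewrite /= rmorphM.
have [Phi hPhi] := rmorphism_of fz fm.
exists Phi; split=> [x|y]; rewrite hPhi //.
apply: (tends_to_unique (@absolute_value_normr R) (u := fun n => v (U y n))).
  move=> e e0; have [N hN] := hf y e e0; exists N => n /hN h.
  by apply: le_lt_trans h; rewrite -kv; apply: av_dist.
move=> e e0; have [N hN] := hU y e e0; exists N => n /hN h.
by apply: le_lt_trans h; rewrite -jv; apply: av_dist.
Qed.

End UniversalProperty.

(** * Finite-dimensional spaces over a complete field *)

Section NormEquivalence.
Variables (R : realType) (A E : fieldType) (wA : A -> R) (w : E -> R).
Variable phi : {rmorphism A -> E}.
Hypothesis wAP : absolute_value wA.
Hypothesis wAc : complete_abs wA.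
Hypothesis wP : absolute_value w.
Hypothesis phiw : forall x, w (phi x) = wA x.

(** Families indexed by [nat] and cut at [m] avoid changes of ordinal type in the induction on
    [m]. *)
Definition free_upto (e : nat -> E) m := forall c : nat -> A,
  \sum_(k < m) phi (c k) * e k = 0 -> forall k, (k < m)%N -> c k = 0.

(** The first hypothesis bounds the coordinates by the vector, so the coordinates of a sequence of
    the span converging to [y] are Cauchy and converge in the complete field [A]. *)
Lemma span_closed (e : nat -> E) m (C : R) y :
  (forall c : nat -> A, \sum_(k < m) wA (c k) <= C * w (\sum_(k < m) phi (c k) * e k)) ->
  (forall eps : R, 0 < eps ->
     exists c : nat -> A, w (y - \sum_(k < m) phi (c k) * e k) < eps) ->
  exists c : nat -> A, y = \sum_(k < m) phi (c k) * e k.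
Proof.
move=> hC hy.
have [|T hT Ty] := @abs_closureP _ _ _ wP [set S | exists c : nat -> A, \sum_(k < m) phi (c k) * e k = S] y.
  by move=> eps /hy[c hc]; exists (\sum_(k < m) phi (c k) * e k) => //; exists c.
have [c hc] := choice hT.
have cc k : (k < m)%N -> exists l, tends_to wA (c ^~ k) l.
  move=> km; apply: wAc => eps eps0.
  have C1 : 0 < `|C| + 1 by rewrite ltr_wpDl.
  have [N hN] := tends_to_cauchy wP Ty (divr_gt0 eps0 C1).
  exists N => s t Ns Nt.
  have := hC (fun k => c s k - c t k).
  rewrite (eq_bigr (fun k : 'I_m => phi (c s k) * e k - phi (c t k) * e k)); last first.
    by move=> i _; rewrite rmorphB mulrBl.
  rewrite sumrB !hc => h.
  apply: le_lt_trans (_ : (`|C| + 1) * w (T s - T t) < _); last first.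
    by rewrite mulrC -ltr_pdivlMr // hN.
  apply: le_trans (_ : C * w (T s - T t) <= _); last first.
    by rewrite ler_wpM2r ?(av_ge0 wP) // (le_trans (ler_norm _)) // lerDl.
  apply: le_trans h; rewrite (bigD1 (Ordinal km)) //= lerDl sumr_ge0 // => *.
  exact: av_ge0.
have cc' k : exists l, (k < m)%N -> tends_to wA (c ^~ k) l.
  by have [km|] := boolP (k < m)%N; [have [l] := cc _ km; exists l|exists 0].
have [l hl] := choice cc'.
exists l; apply: (tends_to_unique wP Ty).
rewrite (_ : T = fun s => \sum_(k < m) phi (c s k) * e k); last by apply/funext.
apply: (tends_to_sum wP (u := fun k n => phi (c n k) * e k)
  (l := fun k => phi (l k) * e k)) => k km.
rewrite (_ : (fun n => _) = fun n => e k * phi (c n k)); last first.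
  by apply/funext => n; rewrite mulrC.
rewrite mulrC; apply: tends_toZ => // eps eps0.
have [N hN] := hl _ km _ eps0; exists N => n /hN.
by rewrite -phiw rmorphB.
Qed.

(* By induction the span of the first [m] vectors is complete, hence closed, so
    the next vector stays at a positive distance from it. *)
Lemma norm_equivalence e m : free_upto e m -> exists2 C, 0 < C &
  forall c : nat -> A, \sum_(k < m) wA (c k) <= C * w (\sum_(k < m) phi (c k) * e k).
Proof.
elim: m => [_|m IH hm].
  by exists 1 => // c; rewrite !big_ord0 (av0 wP) mulr0.
have [|C C0 hC] := IH.
  move=> c h k km; have := hm (fun i => if (i < m)%N then c i else 0).
  rewrite big_ord_recr /= ltnn rmorph0 mul0r addr0 => /(_ _ k (ltnW km)).
  rewrite km; apply; rewrite -[RHS]h; apply: eq_bigr => i _; by rewrite ltn_ord.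
have [d d0 hd] : exists2 d, 0 < d & forall c : nat -> A,
    d <= w (e m - \sum_(k < m) phi (c k) * e k).
  apply: contrapT => h.
  have [|c hc] := span_closed (y := e m) hC.
    move=> eps eps0; apply: contrapT => h'; apply: h; exists eps => // c.
    by rewrite leNgt; apply/negP => k; apply: h'; exists c.
  have := hm (fun i => if (i < m)%N then c i else -1).
  rewrite big_ord_recr /= ltnn rmorphN1 mulN1r => /(_ _ m (ltnSn m)).
  rewrite ltnn => k; have /eqP : -1 = 0 :> A.
    apply: k; rewrite [X in _ - X]hc; apply/eqP; rewrite subr_eq0; apply/eqP.
    by apply: eq_bigr => i _; rewrite ltn_ord.
  by rewrite oppr_eq0 oner_eq0.
exists (C * (1 + w (e m) / d) + d^-1).
  rewrite addr_gt0 ?invr_gt0 // mulr_gt0 //.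
  by rewrite ltr_pwDl // divr_ge0 ?(av_ge0 wP) // ltW.
move=> c; rewrite !big_ord_recr /=; set S := \sum_(k < m) phi (c k) * e k.
set y := S + phi (c m) * e m.
(* Divided by [c m], the vector [y] becomes [e m] minus an element of the span, whose absolute value
   is at least [d]. *)
have cm : wA (c m) <= w y / d.
  have [c0|c0] := eqVneq (c m) 0.
    by rewrite c0 (av0 wAP) divr_ge0 ?(av_ge0 wP) // ltW.
  have := hd (fun k => - (c k / c m)).
  rewrite ler_pdivlMr // => h.
  have -> : y = phi (c m) * (e m - \sum_(k < m) phi (- (c k / c m)) * e k).
    rewrite mulrBr mulr_sumr -sumrN /y /S [LHS]addrC; congr (_ + _).
    apply: eq_bigr => i _; rewrite mulrA -rmorphM mulrN mulrCA divff // mulr1.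
    by rewrite rmorphN mulNr opprK.
  by rewrite (avM wP) phiw ler_wpM2l // (av_ge0 wAP).
have Sy : w S <= w y * (1 + w (e m) / d).
  have -> : S = y - phi (c m) * e m by rewrite addrK.
  apply: le_trans (avB_le wP _ _) _; rewrite (avM wP) phiw mulrDr mulr1 lerD2l.
  by rewrite mulrCA mulrC ler_wpM2l ?(av_ge0 wP).
rewrite mulrDl lerD //.
  by apply: le_trans (hC c) _; rewrite -mulrA ler_wpM2l ?(ltW C0) // mulrC.
by rewrite mulrC.
Qed.

Definition is_minpoly (r : E) (g : {poly A}) := [/\ g \is monic,
  root (map_poly phi g) r & forall h, root (map_poly phi h) r -> g %| h].

Lemma minpoly_exists r (h : {poly A}) : h != 0 -> root (map_poly phi h) r ->
  exists g, is_minpoly r g.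
Proof.
move=> h0 hr.
pose P n := `[< exists2 g : {poly A}, g != 0 & root (map_poly phi g) r /\ size g = n >].
have exP : exists n, P n by exists (size h); apply/asboolP; exists h.
case: (ex_minnP exP) => n /asboolP[g g0 [gr gn]] nmin.
have lg : lead_coef g != 0 by rewrite lead_coef_eq0.
have lr : root (map_poly phi ((lead_coef g)^-1 *: g)) r.
  by rewrite map_polyZ rootZ // fmorph_eq0 invr_eq0.
exists ((lead_coef g)^-1 *: g); split=> //.
  by rewrite monicE lead_coefZ mulVf.
move=> q qr; rewrite dvdpZl ?invr_eq0 //.
apply/eqP; apply: contrapT => /eqP m0.
have mr : root (map_poly phi (q %% g)) r.
  move: qr; rewrite {1}(divp_eq q g) rmorphD rmorphM /= /root hornerD hornerM.
  by rewrite (eqP gr) mulr0 add0r.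
have := nmin (size (q %% g)); rewrite leqNgt => /(_ _)/negP; apply.
  by apply/asboolP; exists (q %% g).
by rewrite -gn ltn_modp.
Qed.

Lemma horner_map_wide (p : {poly A}) m r : (size p <= m)%N ->
  (map_poly phi p).[r] = \sum_(k < m) phi p`_k * r ^+ k.
Proof.
move=> pm; rewrite (@horner_coef_wide _ m) ?size_map_poly //.
by apply: eq_bigr => i _; rewrite coef_map.
Qed.

Lemma minpoly_free r g : is_minpoly r g -> free_upto (fun k => r ^+ k) (size g).-1.
Proof.
move=> [gm gr gdvd] c hc k km.
have g0 : (0 < size g)%N by rewrite size_poly_gt0 monic_neq0.
pose p := \poly_(i < (size g).-1) c i.
have pg : (size p < size g)%N.
  by apply: leq_ltn_trans (size_poly _ _) _; rewrite prednK.
have /gdvd gp : root (map_poly phi p) r.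
  rewrite /root (@horner_map_wide _ (size g).-1) ?size_poly //.
  rewrite -[X in _ == X]hc; apply/eqP; apply: eq_bigr => i _.
  by rewrite coef_poly ltn_ord.
have p0 : p = 0.
  apply/eqP; apply: contraLR gp => p0; apply/negP => /(dvdp_leq p0).
  by rewrite leqNgt pg.
have := coef_poly (size g).-1 c k; rewrite -/p p0 coef0 km.
by move=> <-.
Qed.

End NormEquivalence.

(* Conjugate elements over a complete field have the same absolute value: the
    norms [h -> |h(r)|] and [h -> |h(z)|] on [A[X]/(g)] are comparable, and the
    comparison constant disappears on applying it to high powers. *)
Lemma conjugate_abs_le (R : realType) (A E1 E2 : fieldType)
    (wA : A -> R) (w1 : E1 -> R) (w2 : E2 -> R)
    (phi1 : {rmorphism A -> E1}) (phi2 : {rmorphism A -> E2}) r z (g h : {poly A}) :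
  absolute_value wA -> complete_abs wA -> absolute_value w1 -> absolute_value w2 ->
  (forall x, w1 (phi1 x) = wA x) -> (forall x, w2 (phi2 x) = wA x) ->
  is_minpoly phi1 r g -> root (map_poly phi2 g) z ->
  w2 (map_poly phi2 h).[z] <= w1 (map_poly phi1 h).[r].
Proof.
move=> wAP wAc w1P w2P i1 i2 gP gz; have [gm gr gdvd] := gP.
have g0 : g != 0 by rewrite monic_neq0.
have [C C0 hC] := norm_equivalence wAP wAc w1P i1 (minpoly_free gP).
set m := (size g).-1 in hC.
pose C2 := \sum_(k < m) w2 z ^+ k.
apply: (@le_of_exp_le _ _ _ (C2 * C)); rewrite ?av_ge0 // => N.
(* Reduced modulo [g], the power [h ^+ N] is given by the same [m] coefficients at [r] and at [z];
   this is why [C] and [C2] do not depend on [N]. *)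
have modE (E : fieldType) (f : {rmorphism A -> E}) x : root (map_poly f g) x ->
    (map_poly f h).[x] ^+ N = \sum_(k < m) f (h ^+ N %% g)`_k * x ^+ k.
  move=> gx; rewrite -horner_map_wide; last first.
    by rewrite -ltnS /m prednK ?size_poly_gt0 // ltn_modp.
  rewrite -horner_exp -rmorphXn /= [in LHS](divp_eq (h ^+ N) g).
  by rewrite rmorphD rmorphM /= hornerD hornerM (eqP gx) mulr0 add0r.
rewrite -(avX w2P) -(avX w1P) (modE _ phi2 z gz) (modE _ phi1 r gr).
rewrite -mulrA; set c := fun k => (h ^+ N %% g)`_k.
apply: le_trans (_ : C2 * \sum_(k < m) wA (c k) <= _); last first.
  by rewrite ler_wpM2l ?(hC c) // sumr_ge0 // => *; rewrite exprn_ge0 ?av_ge0.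
apply: le_trans (av_sum w2P _ _ _) _.
rewrite /C2 mulr_suml; apply: ler_sum => i _; rewrite (avM w2P) (avX w2P) i2 mulrC.
rewrite ler_wpM2l ?exprn_ge0 ?av_ge0 // (bigD1 i) //= lerDl sumr_ge0 // => *.
exact: av_ge0.
Qed.

(** * Embeddings of number fields and local degrees *)

Local Notation QtoC := (map_poly (ratr : rat -> algC)).

Lemma map_in_alg_algC (F : fieldExtType rat) (j : {rmorphism F -> algC}) p :
  map_poly j (map_poly (in_alg F) p) = QtoC p.
Proof.
by rewrite -map_poly_comp; apply: eq_map_poly => a; rewrite /= alg_num_field fmorph_rat.
Qed.

(** The Galois group of the normal number field generated by the roots of the minimal polynomial
    permutes them transitively, and its elements extend to algC. *)
Lemma conjugate_automorphism (a b : algC) : root (minCpoly a) b ->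
  exists g : {rmorphism algC -> algC}, g a = b.
Proof.
move=> ab; have [rs Drs] := closed_field_poly_normal (minCpoly a).
rewrite (monicP (minCpoly_monic a)) scale1r in Drs.
have [Qs [QsC [s1 Ds1 s1gen]]] := num_field_exists rs.
have [p [Dp p_mon] p_min] := minCpolyP a.
pose pr := map_poly (in_alg Qs) p.
have Dpr : pr = \prod_(x <- s1) ('X - x%:P).
  apply: (map_poly_inj QsC); rewrite map_in_alg_algC -Dp Drs -Ds1 big_map.
  by rewrite rmorph_prod; apply: eq_bigr => x _; rewrite /= map_polyXsubC.
have pr_over : pr \is a polyOver 1%VS.
  by apply/polyOverP => i; rewrite coef_map memvZ ?memv_line.
have split : SplittingField.axiom Qs.
  by exists pr => //; exists s1; rewrite ?Dpr ?eqpxx.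
pose QsM := FieldExt_isSplittingField.Build rat Qs split.
pose Qn : splittingFieldType rat := HB.pack (FieldExt.sort Qs) QsM.
have inroot x : root (minCpoly a) x -> exists y : Qs, QsC y = x.
  rewrite Drs root_prod_XsubC -Ds1 => /mapP[y _ ->]; by exists y.
have [a1 Da] := inroot _ (root_minCpoly a).
have [b1 Db] := inroot _ ab.
have /(@normalField_root_minPoly _ Qn)/(_ (normalFieldf 1)) : (1 <= {:Qn})%VS by exact: subvf.
move=> /(_ a1 b1 (memvf _)) [|x _ xab].
  have : minPoly 1 (a1 : Qn) \is a polyOver 1%VS := minPolyOver 1 (a1 : Qn).
  move=> /polyOver1P[q Dq].
  have : p %| q.
    rewrite -p_min -Da /root -(map_in_alg_algC QsC) -Dq horner_map.
    by rewrite (minPolyxx 1%AS (a1 : Qn)) rmorph0.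
  move=> /dvdpP[c Dc]; rewrite Dq Dc.
  rewrite /root; apply/eqP; apply: (fmorph_inj QsC); rewrite -horner_map rmorph0.
  by rewrite map_in_alg_algC rmorphM /= hornerM -Dp Db (eqP ab) mulr0.
have [nu hnu] := extend_algC_subfield_aut QsC (x : {rmorphism Qn -> Qn}).
by exists nu; rewrite -Da -hnu -Db; congr (QsC _); exact: xab.
Qed.

(* The embeddings of [F] into [algC] are the [g i \o j]. *)
Definition embedding_system (F : fieldExtType rat) (j : {rmorphism F -> algC}) (n : nat)
    (theta : F) (f : {poly rat}) (g : 'I_n -> {rmorphism algC -> algC}) : Prop :=
  [/\ root (map_poly (in_alg F) f) theta,
      QtoC f = \prod_(i < n) ('X - (g i (j theta))%:P),
      injective (fun i => g i (j theta)) &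
      forall x : F, exists P : {poly rat}, x = (map_poly (in_alg F) P).[theta]].

(** A primitive element has a minimal polynomial of degree [\dim {:F}], and each of its roots is
    reached by an automorphism of algC. Unlike embeddings of [F], automorphisms can be composed with
    absolute values of the whole of algC. *)
Lemma number_field_embeddings (F : fieldExtType rat) (j : {rmorphism F -> algC}) :
  exists (theta : F) (f : {poly rat}) (g : 'I_(\dim {:F}) -> {rmorphism algC -> algC}),
  embedding_system j theta f g.
Proof.
pose bs := vbasis {:F}.
have [z [a Dz] [ps Dps]] := algC_PET (map j bs).
have [theta Dtheta] : exists theta, j theta = z.
  rewrite Dz; elim/big_ind: _ => [|x y [x1 <-] [y1 <-]|i _].
  - by exists 0; rewrite rmorph0.
  - by exists (x1 + y1); rewrite rmorphD.
  - have : (map j bs)`_i \in map j bs by apply: mem_nth.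
    by move=> /mapP[x _ ->]; exists (x *+ a i); rewrite rmorphMn.
have gen x : exists P : {poly rat}, x = (map_poly (in_alg F) P).[theta].
  rewrite (coord_vbasis (memvf x)) -/bs.
  elim/big_ind: _ => [|y1 y2 [P1 ->] [P2 ->]|i _].
  - by exists 0; rewrite rmorph0 horner0.
  - by exists (P1 + P2); rewrite rmorphD hornerD.
  - have : j bs`_i \in map j bs by rewrite map_f // mem_nth // size_tuple.
    rewrite Dps => /mapP[P _ DP]; exists ((coord bs i x) *: P).
    rewrite map_polyZ hornerZ /= mulr_algl; congr (_ *: _).
    by apply: (fmorph_inj j); rewrite DP -Dtheta -(map_in_alg_algC j) horner_map.
have /polyOver1P[f Df] := minPolyOver 1 theta.
have full : <<1; theta>>%VS = fullv.
  apply/eqP; rewrite eqEsubv subvf /=; apply/subvP => x _.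
  have [P ->] := gen x; apply: mempx_Fadjoin.
  by apply/polyOver1P; exists P.
have f_mon : f \is monic by rewrite -(map_monic (in_alg F)) -Df monic_minPoly.
have f_min q : root (map_poly (in_alg F) q) theta -> f %| q.
  move=> qr; rewrite -(dvdp_map (in_alg F)) -Df; apply: minPoly_dvdp => //.
  by apply/polyOver1P; exists q.
have sz_f : size f = (\dim {:F}).+1.
  by rewrite -(size_map_poly (in_alg F)) -Df size_minPoly -full dim_Fadjoin dimv1 muln1.
have f_sep : separable_poly (QtoC f).
  rewrite -(map_in_alg_algC j) separable_map -Df.
  apply: (@pcharf0_separable _ F 1%AS) => p.
  by rewrite (fmorph_pchar (in_alg F)) pchar_num.
have [rs Drs] := closed_field_poly_normal (QtoC f).
have lc : lead_coef (QtoC f) = 1 by apply/monicP; rewrite map_monic.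
rewrite lc scale1r in Drs.
have rs_uniq : uniq rs by rewrite -separable_prod_XsubC -Drs.
have sz_rs : size rs = \dim {:F}.
  by apply: succn_inj; rewrite -(size_prod_XsubC rs id) -Drs size_map_poly.
have Dmin : minCpoly (j theta) = QtoC f.
  have [p [-> p_mon] p_min] := minCpolyP (j theta).
  congr map_poly; apply/eqP; rewrite -eqp_monic // /eqp -p_min f_min /=.
    by rewrite -(map_in_alg_algC j) /root horner_map -Df minPolyxx rmorph0 eqxx.
  by rewrite /root -(fmorph_eq0 j) -horner_map map_in_alg_algC -/(root _ _) p_min.
have hg i : exists g : {rmorphism algC -> algC}, (i < size rs)%N -> g (j theta) = rs`_i.
  have [irs|] := boolP (i < size rs)%N; last by exists idfun.
  have [|g <-] := @conjugate_automorphism (j theta) rs`_i; last by exists g.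
  by rewrite Dmin Drs root_prod_XsubC mem_nth.
have [g hg'] := choice hg.
exists theta, f, (fun i : 'I_(\dim {:F}) => g i); split=> //.
  by rewrite -Df root_minPoly.
  rewrite Drs (big_nth 0) big_mkord sz_rs; apply: eq_bigr => i _.
  by rewrite hg' // sz_rs.
move=> i1 i2 /=; rewrite !hg' ?sz_rs // => /eqP.
by rewrite nth_uniq ?sz_rs // => /eqP/val_inj.
Qed.

Definition conjugates (a : algC) : seq algC :=
  sval (closed_field_poly_normal (minCpoly a)).

Lemma conjugatesE a : minCpoly a = \prod_(z <- conjugates a) ('X - z%:P).
Proof.
rewrite /conjugates; case: closed_field_poly_normal => rs /= Drs.
by move: Drs; rewrite (monicP (minCpoly_monic a)) scale1r.
Qed.

Lemma mem_conjugates a z : (z \in conjugates a) = root (minCpoly a) z.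
Proof. by rewrite conjugatesE root_prod_XsubC. Qed.

Lemma size_conjugates_gt0 a : (0 < size (conjugates a))%N.
Proof. by have := size_minCpoly a; rewrite conjugatesE size_prod_XsubC. Qed.

Section RationalCharpoly.
Variables (F : fieldExtType rat) (j : {rmorphism F -> algC}) (n : nat).
Variables (theta : F) (f : {poly rat}) (g : 'I_n -> {rmorphism algC -> algC}).
Hypothesis hg : embedding_system j theta f g.

Lemma aut_horner (s : {rmorphism algC -> algC}) P :
  s (j (map_poly (in_alg F) P).[theta]) = (QtoC P).[s (j theta)].
Proof.
rewrite -!horner_map map_in_alg_algC -map_poly_comp; congr _.[_].
by apply: eq_map_poly => a; rewrite /= fmorph_rat.
Qed.

Lemma size_embedding_poly : size f = n.+1.
Proof.
have [_ Df _ _] := hg.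
by rewrite -(size_map_poly (ratr : {rmorphism rat -> algC})) Df size_prod_XsubC [index_enum _]unlock -enumT size_enum_ord.
Qed.

Lemma embedding_poly_monic : f \is monic.
Proof.
have [_ Df _ _] := hg.
by rewrite -(map_monic (ratr : {rmorphism rat -> algC})) Df monic_prod_XsubC.
Qed.

(* Multiplication by [x] has the eigenvectors [(theta_i ^ k)_k]. *)
Lemma charpoly_rational (x : F) :
  exists P : {poly rat}, QtoC P = \prod_(i < n) ('X - (g i (j x))%:P).
Proof.
have [f_root _ g_inj gen] := hg.
have f_mon := embedding_poly_monic.
have red k : exists c : 'I_n -> rat, x * theta ^+ k = \sum_(l < n) c l *: theta ^+ l.
  have [P DP] := gen (x * theta ^+ k).
  exists (fun l => (P %% f)`_l); rewrite DP {1}(divp_eq P f).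
  rewrite rmorphD rmorphM /= hornerD hornerM (eqP f_root) mulr0 add0r.
  rewrite (@horner_coef_wide _ n) ?size_map_poly; last first.
    by rewrite -ltnS -size_embedding_poly ltn_modp monic_neq0.
  by apply: eq_bigr => i _; rewrite coef_map /= mulr_algl.
have [c hc] := choice red.
pose M : 'M[rat]_n := \matrix_(k, l) c k l.
pose z : 'rV[algC]_n := \row_i g i (j theta).
pose V := Vandermonde n z.
pose D := diag_mx (\row_i g i (j x)).
have MV : map_mx ratr M *m V = V *m D.
  apply/matrixP => k i; rewrite mul_mx_diag !mxE.
  transitivity (g i (j (x * theta ^+ k))); last first.
    by rewrite mulrC !(rmorphM, rmorphXn) /=.
  rewrite hc !rmorph_sum; apply: eq_bigr => l _; rewrite !mxE.
  by rewrite (rmorphZ_num j) (rmorphM (g i)) fmorph_rat !rmorphXn.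
have Vu : V \in unitmx.
  rewrite unitmxE det_Vandermonde unitfE.
  apply/prodf_neq0 => i1 _; apply/prodf_neq0 => i2 i12.
  rewrite !mxE subr_eq0; apply/eqP => /g_inj h; by rewrite h ltnn in i12.
exists (char_poly M); rewrite map_char_poly.
transitivity (char_poly D); last first.
  rewrite char_poly_trig ?diag_mx_is_trig //.
  by apply: eq_bigr => i _; rewrite !mxE eqxx mulr1n.
have DE : map_mx ratr M = V *m D *m invmx V by rewrite -MV mulmxK.
rewrite /char_poly /char_poly_mx DE.
have -> : 'X%:M - map_mx polyC (V *m D *m invmx V) =
  map_mx polyC V *m ('X%:M - map_mx polyC D) *m map_mx polyC (invmx V).
  rewrite mulmxBr mulmxBl -!map_mxM; congr (_ - _).
  by rewrite scalar_mxC -mulmxA -map_mxM mulmxV // map_mx1 mulmx1.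
rewrite !det_mulmx mulrAC -det_mulmx -map_mxM mulmxV // map_mx1 det1 mul1r //.
Qed.

(** All the roots of the characteristic polynomial are conjugates of [j x]. Hence the minimal
    polynomial divides it, and can be divided out repeatedly until a constant is left. *)
Lemma charpoly_minpoly_power (x : F) : exists k,
  \prod_(i < n) ('X - (g i (j x))%:P) = minCpoly (j x) ^+ k.
Proof.
have [P DP] := charpoly_rational x.
have [m [Dm m_mon] m_min] := minCpolyP (j x).
have : forall z, root (QtoC P) z -> root (minCpoly (j x)) z.
  move=> z; rewrite DP -(big_map (fun i => g i (j x)) xpredT (fun y => 'X - y%:P)).
  rewrite root_prod_XsubC => /mapP[i _ ->].
  by rewrite -(minCpoly_aut (g i)) root_minCpoly.
have : P \is monic by rewrite -(map_monic (ratr : {rmorphism rat -> algC})) DP monic_prod_XsubC.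
rewrite -DP; have [N] : exists N, (size P <= N)%N by exists (size P).
elim: N P {DP} => [|N IH] P PN P_mon Pr.
  by move: PN; rewrite size_poly_leq0 (negPf (monic_neq0 P_mon)).
have [P1|P1] := leqP (size P) 1.
  exists 0%N; rewrite expr0; move/monicP: P_mon.
  by rewrite (size1_polyC P1) lead_coefC => ->; rewrite rmorph1.
have [z Pz] : exists z, root (QtoC P) z.
  by apply: closed_rootP; rewrite size_map_poly gtn_eqF.
have [s sa] := conjugate_automorphism (Pr z Pz).
have mP : m %| P.
  rewrite -m_min /root -(fmorph_eq0 s) -horner_map sa -map_poly_comp.
  by rewrite (@eq_map_poly _ _ _ ratr) // => a; rewrite /= fmorph_rat.
have DPm : P = P %/ m * m by rewrite divpK.
have m0 := monic_neq0 m_mon.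
have Q_mon : P %/ m \is monic by rewrite -(monicMr _ m_mon) -DPm.
have [||z' Qz'|k hk] := IH (P %/ m); last first.
- by exists k.+1; rewrite exprSr -hk Dm -rmorphM /= -DPm.
- by apply: Pr; rewrite DPm rmorphM /= rootM Qz'.
- exact: Q_mon.
- rewrite -ltnS; apply: leq_trans PN.
  rewrite size_divp //; have := size_minCpoly (j x); rewrite Dm size_map_poly.
  case: (size m) => [|[|k]] // _; rewrite /=.
  by rewrite ltn_subrL //= ; apply: leq_trans P1.
Qed.

(** Every conjugate is reached by the same number [k] of embeddings, so the mean over the embeddings
    is the mean over the conjugates. *)
Lemma sum_over_embeddings (R : realType) (x : F) (phi : algC -> R) :
  (size (conjugates (j x)))%:R * \sum_(i < n) phi (g i (j x)) =
  n%:R * \sum_(z <- conjugates (j x)) phi z.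
Proof.
have [k hk] := charpoly_minpoly_power x.
pose cs := conjugates (j x).
have P : perm_eq [seq g i (j x) | i <- index_enum 'I_n] (flatten (nseq k cs)).
  apply: prod_XsubC_eq; rewrite big_map hk conjugatesE big_flatten.
  by rewrite big_nseq -Monoid.iteropE /=.
have kn : n = (k * size cs)%N.
  have := perm_size P; rewrite size_map [index_enum _]unlock -enumT size_enum_ord size_flatten => ->.
  by rewrite /shape map_nseq sumn_nseq mulnC.
have -> : \sum_(i < n) phi (g i (j x)) = \sum_(z <- flatten (nseq k cs)) phi z.
  by rewrite -(perm_big _ P) big_map.
have -> : n%:R = k%:R * (size cs)%:R :> R by rewrite -natrM -kn.
rewrite big_flatten big_nseq -/cs iter_addr addr0 -mulr_natr; ring.
Qed.

End RationalCharpoly.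

Lemma absolute_value_comp (R : realType) (E1 E2 : fieldType) (v : E2 -> R)
    (k : {rmorphism E1 -> E2}) : absolute_value v -> absolute_value (fun x => v (k x)).
Proof.
move=> hv; split=> [x|x|x y|x y]; first exact: av_ge0.
- split=> [/eqP|->]; last by rewrite rmorph0 (av0 hv).
  by rewrite (av_eq0 hv) fmorph_eq0 => /eqP.
- by rewrite rmorphM (avM hv).
- by rewrite rmorphD (avD hv).
Qed.

Lemma absolute_value_le_eq (R : realType) (E : fieldType) (v1 v2 : E -> R) :
  absolute_value v1 -> absolute_value v2 -> (forall x, v1 x <= v2 x) -> v1 = v2.
Proof.
move=> h1 h2 le12; apply/funext => x; apply/eqP; rewrite eq_le le12 /=.
have [->|x0] := eqVneq x 0; first by rewrite (av0 h1) (av0 h2).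
by have := le12 x^-1; rewrite (avV h1) (avV h2) lef_pV2 ?posrE ?av_gt0.
Qed.

Lemma horner_abs_bound (R : realType) (A E : fieldType) (wA : A -> R) (w : E -> R)
    (phi : {rmorphism A -> E}) (h : {poly A}) (x : E) (s : nat) (d : R) :
  absolute_value w -> (forall y, w (phi y) = wA y) -> (size h <= s)%N ->
  (forall k, wA h`_k <= d) -> w (map_poly phi h).[x] <= d * \sum_(k < s) w x ^+ k.
Proof.
move=> wP phiw hs hd; rewrite (horner_map_wide phi x hs) mulr_sumr.
apply: le_trans (av_sum wP _ _ _) _; apply: ler_sum => i _.
by rewrite (avM wP) (avX wP) phiw ler_wpM2r // exprn_ge0 ?av_ge0.
Qed.

Definition embeddings_of_place (R : realType) (nu : algC -> R) (F : fieldType)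
    (j : {rmorphism F -> algC}) (n : nat) (g : 'I_n -> {rmorphism algC -> algC})
    (v : F -> R) : {set 'I_n} :=
  [set i | `[< forall x, nu (g i (j x)) = v x >]].

Section LocalDegree.
Variables (R : realType) (nu : algC -> R).
Hypothesis nuP : absolute_value nu.
Variables (F : fieldExtType rat) (j : {rmorphism F -> algC}) (n : nat).
Variables (theta : F) (f : {poly rat}) (g : 'I_n -> {rmorphism algC -> algC}).
Hypothesis hg : embedding_system j theta f g.
Variable v : F -> R.
Hypothesis vP : absolute_value v.
Hypothesis v_nu : forall q : rat, v q%:A = nu (ratr q).

Local Notation embeddings_of_place := (embeddings_of_place nu j g v).

Section GivenCompletion.
Variables (E : fieldType) (w : E -> R) (jE : {rmorphism F -> E}).
Hypothesis EP : is_completion v w jE.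

Let rat_closure := abs_closure w (range (fun q : rat => jE q%:A)).

(** Let [A] be the completion of Q, mapped to [E] and to the completion [C] of algC. The minimal
    polynomial [gA] of [theta] over [A] divides [f], so over [C] it is the product of the
    [X - theta_i] for [i] in some [I]. As [E] is generated by [theta] over [A], its degree is the
    size of [I]; and [I] consists exactly of the embeddings that induce [v]. *)
Lemma local_degree_completion : [/\ exists i, i \in embeddings_of_place,
  has_degree_over rat_closure #|embeddings_of_place| &
  forall m, has_degree_over rat_closure m -> m = #|embeddings_of_place|].
Proof.
have [wP wc wv dense] := EP.
have [f_root Df g_inj gen] := hg.
have f_mon := embedding_poly_monic hg.
pose u (q : rat) := v q%:A.
have uP : absolute_value u by apply: (absolute_value_comp (in_alg F)).
have [A [wA [a aP]]] := completion_exists uP.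
have [wAP wAc wAa Adense] := aP.
pose k1 : {rmorphism rat -> E} := (jE \o in_alg F)%FUN.
have [phi1 [phi1a phi1w]] : exists Phi : {rmorphism A -> E},
    (forall x, Phi (a x) = jE x%:A) /\ (forall y, w (Phi y) = wA y).
  by apply: (@completion_extension _ _ _ _ u wA w a k1) => // x; rewrite /= wv.
have [C [wC [kap CP]]] := completion_exists nuP.
have [wCP wCc wCk _] := CP.
pose k2 : {rmorphism rat -> C} := (kap \o (ratr : rat -> algC))%FUN.
have [phi2 [phi2a phi2w]] : exists Phi : {rmorphism A -> C},
    (forall x, Phi (a x) = kap (ratr x)) /\ (forall y, wC (Phi y) = wA y).
  by apply: (@completion_extension _ _ _ _ u wA wC a k2) => // x; rewrite /= wCk -v_nu.
pose r := jE theta.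
have E1 P : (map_poly phi1 (map_poly a P)).[r] = jE (map_poly (in_alg F) P).[theta].
  rewrite -horner_map -!map_poly_comp; congr _.[_].
  by apply: eq_map_poly => q; rewrite /= phi1a.
have E2 P i : (map_poly phi2 (map_poly a P)).[kap (g i (j theta))] =
    kap (g i (j (map_poly (in_alg F) P).[theta])).
  rewrite aut_horner -(horner_map kap) -!map_poly_comp; congr _.[_].
  by apply: eq_map_poly => q; rewrite /= phi2a.
have f_root1 : root (map_poly phi1 (map_poly a f)) r by rewrite /root E1 (eqP f_root) rmorph0.
have f0 : map_poly a f != 0 by rewrite map_poly_eq0 monic_neq0.
have [gA gAP] := minpoly_exists f0 f_root1.
have [gA_mon gA_root gA_dvd] := gAP.
have free_r := minpoly_free gAP.
have gAf := gA_dvd _ f_root1.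
have Df2 : map_poly phi2 (map_poly a f) = \prod_(i < n) ('X - (kap (g i (j theta)))%:P).
  rewrite -map_poly_comp (eq_map_poly (phi2a : phi2 \o a =1 kap \o (ratr : rat -> algC))).
  rewrite (map_poly_comp kap) Df rmorph_prod; apply: eq_bigr => i _.
  by rewrite /= map_polyXsubC.
have := gAf; rewrite -(dvdp_map phi2) Df2 => /dvdp_prod_XsubC[m].
set I := mask m _ => gAI.
have {gAI}gAI : map_poly phi2 gA = \prod_(i <- I) ('X - (kap (g i (j theta)))%:P).
  by apply/eqP; rewrite -eqp_monic // ?map_monic // monic_prod_XsubC.
have I_uniq : uniq I by rewrite mask_uniq // index_enum_uniq.
have sz_I : size I = (size gA).-1.
  by rewrite -(size_map_poly phi2) gAI size_prod_XsubC.
have root_I i : root (map_poly phi2 gA) (kap (g i (j theta))) = (i \in I).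
  rewrite gAI -(big_map (fun i => kap (g i (j theta))) xpredT (fun y => 'X - y%:P)).
  rewrite root_prod_XsubC; apply: (mem_map (f := fun i => kap (g i (j theta)))).
  by move=> i1 i2 /fmorph_inj/g_inj.
(* Here [theta] and [theta_i] are roots of the same [gA] over a complete field: [conjugate_abs_le]
   gives one inequality, and passing to inverses gives equality. *)
have I_place i : i \in I -> forall x, nu (g i (j x)) = v x.
  rewrite -root_I => gi.
  suff -> : v = (fun x => nu (g i (j x))) by [].
  symmetry; apply: absolute_value_le_eq => //.
    exact: (absolute_value_comp (g i \o j)%FUN).
  move=> x; have [P ->] := gen x; rewrite -wv -E1 -wCk -E2.
  exact: (conjugate_abs_le _ wAP wAc wP wCP phi1w phi2w gAP gi).
(* Approximate [gA] by a rational polynomial [P]. Then [P(theta)] is small since [gA(theta) = 0],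
   [P(theta_i)] has the same absolute value since the embedding induces [v], and so [gA(theta_i)] is
   arbitrarily small. *)
have place_I i : (forall x, nu (g i (j x)) = v x) -> i \in I.
  move=> hi; rewrite -root_I /root -(av_eq0 wCP).
  set zi := kap (g i (j theta)).
  pose s := size gA; pose C1 := \sum_(k < s) w r ^+ k; pose C2 := \sum_(k < s) wC zi ^+ k.
  have C10 : 0 <= C1 by apply: sumr_ge0 => *; rewrite exprn_ge0 ?av_ge0.
  have C20 : 0 <= C2 by apply: sumr_ge0 => *; rewrite exprn_ge0 ?av_ge0.
  rewrite eq_le (av_ge0 wCP) andbT; apply/ler_addgt0Pl => eps eps0; rewrite addr0.
  pose d := eps / (C1 + C2 + 1).
  have d0 : 0 < d by rewrite divr_gt0 // ltr_wpDl // addr_ge0.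
  have [|q hq] := @choice _ _ (fun k q => wA (gA`_k - a q) < d).
    move=> k; have : abs_closure wA (range a) gA`_k by rewrite Adense.
    by move=> /(_ d d0)[_ [q _ <-]]; exists q.
  pose P := \poly_(k < s) q k.
  pose h := gA - map_poly a P.
  have hs : (size h <= s)%N.
    rewrite (leq_trans (size_polyD _ _)) // geq_max leqnn size_polyN size_map_poly.
    exact: size_poly.
  have hd k : wA h`_k <= d.
    have [sk|ks] := leqP s k; first by rewrite (nth_default _ (leq_trans hs sk)) (av0 wAP) ltW.
    by rewrite coefB coef_map coef_poly ks ltW.
  have b1 := horner_abs_bound r wP phi1w hs hd.
  have b2 := horner_abs_bound zi wCP phi2w hs hd.
  have -> : gA = h + map_poly a P by rewrite subrK.
  rewrite rmorphD hornerD; apply: le_trans (avD wCP _ _) _.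
  have b3 : wC (map_poly phi2 (map_poly a P)).[zi] <= d * C1.
    rewrite E2 wCk hi -wv -E1.
    have -> : map_poly a P = gA - h by rewrite /h opprB addrC subrK.
    by rewrite rmorphB /= hornerD (eqP gA_root) add0r hornerN (avN wP).
  apply: le_trans (lerD b2 b3) _.
  rewrite -mulrDr /d -mulrA ler_piMr ?(ltW eps0) // mulrC ler_pdivrMr; last first.
    by rewrite ltr_wpDl // addr_ge0.
  by rewrite mul1r addrC lerDl.
have card_I : #|embeddings_of_place| = size I.
  rewrite -(card_uniqP I_uniq); apply: eq_card => i.
  by rewrite inE; apply/asboolP/idP; [apply: place_I | apply: I_place].
(* As [A] is complete its image is closed: this is [span_closed] for the single vector 1. *)
have A_closure y : rat_closure y <-> exists b, y = phi1 b.
  split=> [hy|[b ->]].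
    have hC (c : nat -> A) : \sum_(k < 1) wA (c k) <= 1 * w (\sum_(k < 1) phi1 (c k) * 1).
      by rewrite !big_ord1 mul1r mulr1 phi1w.
    have [eps eps0|c hc] := span_closed (e := fun=> 1) wAP wAc wP phi1w (y := y) hC.
      have [_ [q _ <-] hyq] := hy eps eps0.
      by exists (fun=> a q); rewrite big_ord1 mulr1 phi1a.
    by exists (c 0%N); rewrite hc big_ord1 mulr1.
  move=> eps eps0; have : abs_closure wA (range a) b by rewrite Adense.
  move=> /(_ eps eps0)[_ [q _ <-] hq].
  exists (jE q%:A); first by exists q.
  by rewrite -phi1a -rmorphB phi1w.
(* The span of the powers of [r] is closed and contains the dense image of [F]. *)
have basis y : exists c : nat -> A, y = \sum_(k < size I) phi1 (c k) * r ^+ k.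
  rewrite sz_I.
  have [K K0 hK] := norm_equivalence wAP wAc wP phi1w free_r.
  apply: (span_closed wAP wAc wP phi1w hK) => eps eps0.
  have : abs_closure w (range jE) y by rewrite dense.
  move=> /(_ eps eps0)[_ [x _ <-] hx].
  have [P DP] := gen x.
  exists (fun k => (map_poly a P %% gA)`_k).
  rewrite -(horner_map_wide phi1 r); last first.
    by rewrite -ltnS prednK ?ltn_modp ?monic_neq0 // size_poly_gt0 monic_neq0.
  rewrite (_ : _.[r] = jE x) // DP -E1 [in RHS](divp_eq (map_poly a P) gA).
  by rewrite rmorphD rmorphM /= hornerD hornerM (eqP gA_root) mulr0 add0r.
have free_I (c : nat -> A) : \sum_(k < size I) phi1 (c k) * r ^+ k = 0 ->
    forall k, (k < size I)%N -> c k = 0 by rewrite sz_I; apply: free_r.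
rewrite card_I; split.
- have /hasP[i iI _] : has predT I.
    rewrite has_predT sz_I -subn1 subn_gt0.
    by rewrite -(size_map_poly phi1); apply: root_size_gt1 gA_root; rewrite map_poly_eq0 monic_neq0.
  by exists i; rewrite inE; apply/asboolP/I_place.
- exists (fun i => r ^+ i) => y; have [c hc] := basis y.
  exists [ffun i : 'I_(size I) => phi1 (c i)]; split.
    split=> [i|]; first by rewrite ffunE; apply/A_closure; exists (c i).
    by rewrite hc; apply: eq_bigr => i _; rewrite ffunE.
  move=> c' [hc'A hc'].
  have [b hb] := choice (fun i => (A_closure _).1 (hc'A i)).
  pose b' k := if insub k is Some i then b i else 0.
  have b'E (i : 'I_(size I)) : b' i = b i by rewrite /b' valK.
  apply/ffunP => i; rewrite ffunE hb; congr (phi1 _); apply/eqP; rewrite -subr_eq0 -b'E.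
  apply/eqP; apply: (free_I (fun k => c k - b' k)) => //.
  transitivity (\sum_(k < size I) phi1 (c k) * r ^+ k - \sum_(k < size I) c' k * r ^+ k).
    rewrite -sumrB; apply: eq_bigr => k _.
    by rewrite hb b'E rmorphB mulrBl.
  by rewrite -hc -hc' subrr.
(* Any other basis [e] is related to the powers of [r] by matrices [P] and [Q] over [A] that are
   inverse to each other, so the two sizes agree. *)
move=> m' [e he].
have [P hP] : exists P : 'M[A]_(m', size I), forall i, e i = \sum_k phi1 (P i k) * r ^+ k.
  have [c hc] := choice (fun i => basis (e i)).
  exists (\matrix_(i, k) c i k) => i; rewrite {1}hc; apply: eq_bigr => k _.
  by rewrite mxE.
have [Q hQ] : exists Q : 'M[A]_(size I, m'),
    forall k : 'I_(size I), r ^+ k = \sum_i phi1 (Q k i) * e i.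
  have [c hc] := choice (fun k : 'I_(size I) => he (r ^+ k)).
  have hc' k i : exists b, c k i = phi1 b.
    by apply/A_closure; have [[h _] _] := hc k.
  have [b hb] := choice (fun ki => hc' ki.1 ki.2).
  exists (\matrix_(k, i) b (k, i)) => k; have [[_ h] _] := hc k.
  by rewrite h; apply: eq_bigr => i _; rewrite mxE -(hb (k, i)).
apply/eqP; rewrite eqn_leq; apply/andP; split.
  apply: (@mulmx1_min _ _ _ P Q); apply/matrixP => i l.
  have [c [[_ _] cuniq]] := he (e i).
  have c1 : c = [ffun i' => phi1 ((P *m Q) i i')].
    apply: cuniq; split=> [i'|]; first by rewrite ffunE; apply/A_closure; eexists.
    rewrite hP; under eq_bigr do rewrite hQ mulr_sumr.
    rewrite exchange_big; apply: eq_bigr => i' _; rewrite ffunE mxE rmorph_sum mulr_suml.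
    by apply: eq_bigr => k _; rewrite rmorphM mulrA.
  have c2 : c = [ffun i' => phi1 ((1%:M : 'M[A]_m') i i')].
    apply: cuniq; split=> [i'|]; first by rewrite ffunE; apply/A_closure; eexists.
    rewrite (bigD1 i) //= ffunE mxE eqxx rmorph1 mul1r big1 ?addr0 // => i' ii'.
    by rewrite ffunE mxE eq_sym (negPf ii') rmorph0 mul0r.
  have := c2; rewrite c1 => /ffunP/(_ l); rewrite !ffunE; exact: fmorph_inj.
apply: (@mulmx1_min _ _ _ Q P); apply/matrixP => k l.
pose B := Q *m P - 1%:M.
pose b l' := if insub l' is Some l'' then B k l'' else 0.
have bE (i : 'I_(size I)) : b i = B k i by rewrite /b valK.
apply/eqP; rewrite -subr_eq0.
have := free_I b _ l (ltn_ord l); rewrite bE /B !mxE => -> //.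
transitivity (\sum_(l' < size I) phi1 ((Q *m P) k l') * r ^+ l' - r ^+ k).
  rewrite (bigD1 k) //= [in RHS](bigD1 k) //= bE /B !mxE eqxx rmorphB rmorph1.
  rewrite mulrBl mul1r addrAC; congr (_ + _ - _); apply: eq_bigr => l' l'k.
  by rewrite bE /B !mxE eq_sym (negPf l'k) subr0.
apply/eqP; rewrite subr_eq0; apply/eqP; rewrite [RHS]hQ.
under [RHS]eq_bigr do rewrite hP mulr_sumr.
rewrite exchange_big; apply: eq_bigr => i' _; rewrite mxE rmorph_sum mulr_suml.
by apply: eq_bigr => k' _; rewrite rmorphM mulrA.
Qed.

End GivenCompletion.

Lemma place_is_embedding : exists i, forall x, nu (g i (j x)) = v x.
Proof.
have [E [w [jE EP]]] := completion_exists vP.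
have [[i hi] _ _] := local_degree_completion EP.
by exists i; move: hi; rewrite inE => /asboolP.
Qed.

Lemma local_degreeE :
  local_degree v = #|embeddings_of_place|.
Proof.
rewrite /local_degree; case: xgetP => [m _ [E [w [jE [EP hm]]]]|h].
  by have [_ _] := local_degree_completion EP; apply.
have [E [w [jE EP]]] := completion_exists vP.
have [_ hd _] := local_degree_completion EP.
by have [] := h #|embeddings_of_place|; exists E, w, jE.
Qed.

End LocalDegree.

(** * Extension of the absolute values of Q to algC *)

Section ValuationRing.
Variables (K : fieldType) (p : nat).
Local Notation P := (p%:R : K).

(** The unit is only required of nonempty sets, because Zorn's lemma also asks for the union of the
    empty chain. *)
Definition ring_without_inv (A : set K) : Prop :=
  [/\ forall x, A x -> A 1, forall x y, A x -> A y -> A (x - y),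
      forall x y, A x -> A y -> A (x * y) & ~ A P^-1].

Lemma maximal_ring_without_inv (B0 : set K) : ring_without_inv B0 -> B0 1 ->
  exists A, [/\ ring_without_inv A, A 1 &
    forall B, ring_without_inv B -> A `<=` B -> B `<=` A].
Proof.
move=> B0r B01.
have [F FP Ftot|A [Ar Amax]] := @Zorn_bigcup K ring_without_inv.
  have sub2 X Y x y : F X -> F Y -> X x -> Y y -> exists Z, [/\ F Z, Z x & Z y].
    by move=> FX FY Xx Yy; have [h|h] := Ftot _ _ FX FY; [exists Y|exists X]; split=> //; apply: h.
  split.
  - by move=> x [X FX Xx]; exists X => //; have [h _ _ _] := FP X FX; apply: h Xx.
  - move=> x y [X FX Xx] [Y FY Yy]; have [Z [FZ Zx Zy]] := sub2 _ _ _ _ FX FY Xx Yy.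
    by exists Z => //; have [_ h _ _] := FP Z FZ; apply: h.
  - move=> x y [X FX Xx] [Y FY Yy]; have [Z [FZ Zx Zy]] := sub2 _ _ _ _ FX FY Xx Yy.
    by exists Z => //; have [_ _ h _] := FP Z FZ; apply: h.
  - by move=> [X FX Xx]; have [_ _ _ h] := FP X FX; apply: h.
have Bmax B : ring_without_inv B -> A `<=` B -> B `<=` A.
  move=> Br AB x Bx; apply: contrapT => nAx; apply: (Amax B) => //.
  by split=> // BA; apply: nAx; apply: BA.
exists A; split=> //; apply: contrapT => nA1.
suff : B0 `<=` A by move=> /(_ 1 B01).
by apply: Bmax => // x Ax; case: nA1; have [h _ _ _] := Ar; apply: h Ax.
Qed.

Variable A : set K.
Hypothesis Ar : ring_without_inv A.
Hypothesis A1 : A 1.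
Hypothesis Amax : forall B, ring_without_inv B -> A `<=` B -> B `<=` A.
Hypothesis P0 : P != 0.

Lemma ringB x y : A x -> A y -> A (x - y). Proof. by case: Ar => _ h _ _; apply: h. Qed.
Lemma ring0 : A 0. Proof. by rewrite -(subrr 1); apply: ringB. Qed.
Lemma ringN x : A x -> A (- x). Proof. by move=> Ax; rewrite -sub0r; apply: ringB ring0 _. Qed.
Lemma ringD x y : A x -> A y -> A (x + y).
Proof. by move=> Ax Ay; rewrite -(opprK y); apply: ringB => //; apply: ringN. Qed.
Lemma ringM x y : A x -> A y -> A (x * y). Proof. by case: Ar => _ _ h _; apply: h. Qed.
Lemma ring_nat n : A n%:R.
Proof. by elim: n => [|n IH]; [exact: ring0|rewrite -natr1; apply: ringD]. Qed.
Lemma ring_sum I (r : seq I) (Q : pred I) (F : I -> K) :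
  (forall i, Q i -> A (F i)) -> A (\sum_(i <- r | Q i) F i).
Proof. by move=> h; elim/big_ind: _ => //; [exact: ring0|exact: ringD]. Qed.

Lemma one_plus_neq0 a : A a -> 1 + P * a != 0.
Proof.
have [_ _ _ nA] := Ar => Aa; apply/eqP => h; apply: nA.
have -> : P^-1 = - a; last exact: ringN.
by apply: (mulfI P0); rewrite divff // mulrN; apply/eqP; rewrite -addr_eq0 h.
Qed.

(** The fractions with denominators in [1 + P A] form a ring that still lacks [P^-1], so maximality
    puts them in [A]. *)
Lemma one_plus_unit a : A a -> A (1 + P * a)^-1.
Proof.
move=> Aa; have [_ _ _ nA] := Ar.
pose B := [set x | exists b c, [/\ A b, A c & x = b / (1 + P * c)]].
suff : B `<=` A by apply; exists 1, a; rewrite mul1r.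
have den b c : (1 + P * b) * (1 + P * c) = 1 + P * (b + c + P * (b * c)) by ring.
have denA b c : A b -> A c -> A (b + c + P * (b * c)).
  by move=> Ab Ac; do ![apply: ringD|apply: ringM] => //; apply: ring_nat.
apply: Amax => [|x Ax]; last by exists x, 0; rewrite mulr0 addr0 divr1; split=> //; apply: ring0.
split=> [_ _|x y [b [c [Ab Ac ->]]] [b' [c' [Ab' Ac' ->]]]
        |x y [b [c [Ab Ac ->]]] [b' [c' [Ab' Ac' ->]]]|[b [c [Ab Ac h]]]].
- by exists 1, 0; rewrite mulr0 addr0 divr1; split=> //; apply: ring0.
- exists (b * (1 + P * c') - b' * (1 + P * c)), (c + c' + P * (c * c')).
  split; [|exact: denA|].
    by apply: ringB; apply: ringM => //; apply: ringD => //; apply: ringM => //; apply: ring_nat.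
  by rewrite -den -mulNr addf_div ?one_plus_neq0 // mulNr.
- exists (b * b'), (c + c' + P * (c * c')); split; [exact: ringM|exact: denA|].
  by rewrite -den mulf_div.
- apply: nA; have := one_plus_neq0 Ac => n0.
  have -> : P^-1 = b - c; last exact: ringB.
  have : 1 + P * c = P * b.
    by apply: (mulfI (invr_neq0 P0)); rewrite mulKf // h mulrAC -mulrA divff // mulr1.
  by move=> e; apply: (mulfI P0); rewrite divff // mulrBr -e addrK.
Qed.

Let inverse_rep (x : K) (n : nat) :=
  exists h : {poly K}, [/\ forall i, A h`_i, (size h <= n)%N & P * h.[x] = 1].

(** Otherwise the ring [A[x]] would lack [P^-1], and maximality would give [x] in [A]. *)
Lemma inverse_rep_exists x : ~ A x -> exists n, inverse_rep x n.
Proof.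
move=> nAx; have [_ _ _ nA] := Ar.
pose B := [set y | exists h : {poly K}, (forall i, A h`_i) /\ y = h.[x]].
have AB : A `<=` B.
  move=> a Aa; exists a%:P; rewrite hornerC; split=> // i.
  by rewrite coefC; case: ifP => // _; apply: ring0.
have Bx : B x.
  exists 'X; rewrite hornerX; split=> // i; rewrite coefX; exact: ring_nat.
suff [h [Ah e]] : B P^-1.
  by exists (size h), h; split=> //; rewrite -e divff.
apply: contrapT => nB; apply: nAx; apply: (@Amax B _ AB) => //; split=> //.
- by move=> *; apply: AB.
- move=> y z [h [Ah ->]] [k [Ak ->]]; exists (h - k); rewrite hornerD hornerN; split=> // i.
  by rewrite coefB; apply: ringB.
- move=> y z [h [Ah ->]] [k [Ak ->]]; exists (h * k); rewrite hornerM; split=> // i.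
  by rewrite coefM; apply: ring_sum => *; apply: ringM.
Qed.

(* If [1 = P h(x) = P k(1/x)] with [deg k <= deg h], the second relation lets one
    rewrite the leading term of the first one in lower degree. *)
Lemma inverse_rep_reduce x n m : x != 0 -> (m <= n)%N -> inverse_rep x n -> inverse_rep x^-1 m ->
  exists2 n', (n' < n)%N & inverse_rep x n'.
Proof.
move=> x0 mn [h [Ah hn hx]] [k [Ak km kx]]; have [_ _ _ nA] := Ar.
have n0 : (0 < n)%N.
  rewrite lt0n; apply/negP => /eqP n0; move: hn hx.
  by rewrite n0 size_poly_leq0 => /eqP ->; rewrite horner0 mulr0 => /eqP; rewrite eq_sym oner_eq0.
(* Since [1 - P k_0] is P times the sum of the [k_i x^(-i)] for [i > 0], multiplying by [u] and by
   [x^(n-1)] expresses [x^(n-1)] through lower powers of [x]; [l] is [h] after this substitution. *)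
pose u := (1 + P * (- k`_0))^-1.
have Au : A u by apply: one_plus_unit; apply: ringN.
pose l := \poly_(i < n.-1) (h`_i + h`_n.-1 * u * P * k`_(n.-1 - i)).
exists n.-1; first by rewrite prednK.
exists l; split.
- move=> i; rewrite coef_poly; case: ifP => _; last exact: ring0.
  by do ![apply: ringD|apply: ringM] => //; apply: ring_nat.
- exact: size_poly.
rewrite -[RHS]hx; congr (P * _).
rewrite (horner_coef_wide _ (size_poly _ _)) (horner_coef_wide _ hn).
have -> : \sum_(i < n) h`_i * x ^+ i = \sum_(i < n.-1) h`_i * x ^+ i + h`_n.-1 * x ^+ n.-1.
  by case: n n0 {mn hn l} => // n _; rewrite big_ord_recr.
under eq_bigr => i _ do rewrite coef_poly ltn_ord mulrDl.
rewrite big_split /=; congr (_ + _).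
have e : u * (P * \sum_(i < n.-1) k`_i.+1 * x^-1 ^+ i.+1) = 1.
  have : P * (\sum_(i < n.-1) k`_i.+1 * x^-1 ^+ i.+1) = 1 + P * (- k`_0).
    have : P * (\sum_(i < n.-1.+1) k`_i * x^-1 ^+ i) = 1.
      by rewrite -horner_coef_wide // prednK // (leq_trans km mn).
    rewrite big_ord_recl /= expr0 mulr1 mulrDr addrC => /eqP.
    by rewrite eq_sym -subr_eq => /eqP <-; rewrite mulrN.
  by move=> ->; rewrite mulVf // one_plus_neq0 //; apply: ringN.
rewrite -[h`_n.-1 in RHS]mulr1 -[X in _ = _ * X * _]e.
set N := n.-1; rewrite [X in u * (P * X)](reindex_inj rev_ord_inj) /=.
rewrite !mulr_sumr mulr_suml; apply: eq_bigr => i _.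
have iN : (i < N)%N by [].
have -> : (N - i.+1).+1 = (N - i)%N by rewrite -subSn.
have -> : x ^+ N = x ^+ (N - i) * x ^+ i by rewrite -exprD subnK // ltnW.
have -> : x^-1 ^+ (N - i) = (x ^+ (N - i))^-1 by rewrite exprVn.
by field; rewrite expf_neq0.
Qed.

(** If neither [x] nor its inverse is in [A], both have a relation of minimal size, and the longer
    of the two can be shortened by means of the other. *)
Lemma maximal_ring_total x : A x \/ A x^-1.
Proof.
apply: contrapT => /not_orP[nAx nAx'].
have x0 : x != 0 by apply/eqP => h; apply: nAx; rewrite h; apply: ring0.
have exP y : ~ A y -> exists n, `[< inverse_rep y n >].
  by move=> /inverse_rep_exists[n hn]; exists n; apply/asboolP.
case: (ex_minnP (exP _ nAx)) => n /asboolP hn nmin.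
case: (ex_minnP (exP _ nAx')) => m /asboolP hm mmin.
have [mn|/ltnW nm] := leqP m n.
  have [n' n'n hn'] := inverse_rep_reduce x0 mn hn hm.
  by have := nmin n' (asboolT hn'); rewrite leqNgt n'n.
have xi0 : x^-1 != 0 by rewrite invr_eq0.
have hn' : inverse_rep x^-1^-1 n by rewrite invrK.
have [m' m'm hm'] := inverse_rep_reduce xi0 nm hm hn'.
by have := mmin m' (asboolT hm'); rewrite leqNgt m'm.
Qed.

End ValuationRing.

Definition extends_padic (R : realType) (p : nat) (nu : algC -> R) : Prop :=
  [/\ absolute_value nu, forall x y, nu (x + y) <= Num.max (nu x) (nu y) &
      forall q : rat, nu (ratr q) = padic_abs R p q].

Section PadicAlgC.
Variables (R : realType) (p : nat).
Hypothesis p_prime : prime p.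
Local Notation P := (p%:R : algC).
Variable V : set algC.
Hypothesis V1 : V 1.
Hypothesis VB : forall x y, V x -> V y -> V (x - y).
Hypothesis VM : forall x y, V x -> V y -> V (x * y).
Hypothesis VnP : ~ V P^-1.
Hypothesis Vtot : forall x, V x \/ V x^-1.
Hypothesis Vunit1 : forall a, V a -> V (1 + P * a)^-1.

Let P0 : P != 0. Proof. by rewrite pnatr_eq0 -lt0n prime_gt0. Qed.
Let V0 : V 0. Proof. by rewrite -(subrr 1); apply: VB. Qed.
Let VD x y : V x -> V y -> V (x + y).
Proof. by move=> Vx Vy; rewrite -(opprK y); apply: VB => //; rewrite -sub0r; apply: VB. Qed.
Let Vnat n : V n%:R.
Proof. by elim: n => [|n IH]; [exact: V0|rewrite -natr1; apply: VD]. Qed.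
Let VX x n : V x -> V (x ^+ n).
Proof. by move=> Vx; elim: n => [|n IH]; rewrite ?expr0 // exprS; apply: VM. Qed.

Definition vunit (z : algC) : Prop := [/\ z != 0, V z & V z^-1].
Definition vmax (z : algC) : Prop := z = 0 \/ ~ V z^-1.

Lemma vunit1 : vunit 1. Proof. by split; rewrite ?oner_neq0 ?invr1. Qed.
Lemma vunitM x y : vunit x -> vunit y -> vunit (x * y).
Proof. by move=> [x0 Vx Vx'] [y0 Vy Vy']; split; rewrite ?mulf_neq0 ?invfM //; apply: VM. Qed.
Lemma vunitV x : vunit x -> vunit x^-1.
Proof. by move=> [x0 Vx Vx']; split; rewrite ?invr_eq0 ?invrK. Qed.
Lemma vunitX x n : vunit x -> vunit (x ^+ n).
Proof. by move=> ux; elim: n => [|n IH]; rewrite ?expr0 ?exprS; [exact: vunit1|exact: vunitM]. Qed.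

Lemma vmax_not_unit x : vmax x -> ~ vunit x.
Proof. by move=> [->|h] [//]; rewrite eqxx. Qed.

Lemma vmaxD x y : vmax x -> vmax y -> vmax (x + y).
Proof.
move=> hx hy; have [->|x0] := eqVneq x 0; first by rewrite add0r.
have [->|y0] := eqVneq y 0; first by rewrite addr0.
case: hx => [/eqP|nx]; first by rewrite (negPf x0).
case: hy => [/eqP|ny]; first by rewrite (negPf y0).
have [->|xy0] := eqVneq (x + y) 0; first by left.
right => h; have [k|k] := Vtot (x / y).
  apply: ny; have -> : y^-1 = (1 + x / y) * (x + y)^-1 by field; rewrite xy0.
  by apply: VM => //; apply: VD.
apply: nx; have -> : x^-1 = (1 + (x / y)^-1) * (x + y)^-1.
  by rewrite invf_div; field; rewrite ?xy0 ?x0.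
by apply: VM => //; apply: VD.
Qed.

Lemma vmax_sum I (r : seq I) (Q : pred I) (F : I -> algC) :
  (forall i, Q i -> vmax (F i)) -> vmax (\sum_(i <- r | Q i) F i).
Proof. by move=> h; elim/big_ind: _ => //; [left|exact: vmaxD]. Qed.

(** Bezout gives [a c = 1 + p b], and the right-hand side is invertible by [Vunit1]. *)
Lemma vunit_nat c : coprime c p -> vunit c%:R.
Proof.
case: c => [|c] h; first by move: h; rewrite /coprime gcd0n => /eqP h; move: p_prime; rewrite h.
have c0 : c.+1%:R != 0 :> algC by rewrite pnatr_eq0.
split=> //; case: (egcdnP p (ltn0Sn c)) => a b e _.
rewrite (eqP h) in e.
have -> : c.+1%:R^-1 = a%:R * (1 + P * b%:R)^-1 :> algC.
  have -> : 1 + P * b%:R = a%:R * c.+1%:R :> algC.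
    by rewrite -!natrM e natrD addrC mulnC.
  have a0 : a%:R != 0 :> algC.
    by rewrite pnatr_eq0; apply/eqP => a0; move: e; rewrite a0 mul0n addn1.
  by rewrite invfM mulrA divff // mul1r.
by apply: VM => //; apply: Vunit1.
Qed.

Lemma vunit_nat_part c : (0 < c)%N -> vunit (c%:R / P ^+ logn p c).
Proof.
move=> c0; have /dvdnP[m Dm] := pfactor_dvdnn p c.
have -> : c%:R / P ^+ logn p c = m%:R :> algC.
  by rewrite {1}Dm natrM natrX mulfK // expf_neq0.
apply: vunit_nat; rewrite coprime_sym prime_coprime //; apply/negP => /dvdnP[m' Dm'].
have : (p ^ (logn p c).+1 %| c)%N.
  by rewrite {2}Dm Dm' expnS -mulnA dvdn_mull.
by rewrite pfactor_dvdn // ltnn.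
Qed.

Lemma vunit_rat (q : rat) : q != 0 -> exists a : int, vunit (ratr q * P ^ a).
Proof.
move=> q0; have numP : (0 < `|numq q|)%N by rewrite absz_gt0 numq_eq0.
have denP : (0 < `|denq q|)%N by rewrite absz_gt0 denq_eq0.
have un := vunit_nat_part numP; have ud := vunit_nat_part denP.
have sgn (s : bool) z : vunit z -> vunit ((-1) ^+ s * z).
  case: s => -[z0 Vz Vz']; last by rewrite expr0 mul1r.
  rewrite expr1 mulN1r; split; rewrite ?oppr_eq0 // ?invrN.
    by rewrite -sub0r; apply: VB.
  by rewrite -sub0r; apply: VB.
exists ((logn p `|denq q|)%:Z - (logn p `|numq q|)%:Z).
have -> : ratr q = (-1) ^+ (numq q < 0)%R * `|numq q|%:R / `|denq q|%:R :> algC.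
  rewrite /ratr [numq q in LHS]intEsign rmorphM /= rmorph_sign; congr (_ * _ / _).
  by rewrite -{1}(gtz0_abs (denq_gt0 q)).
rewrite expfzDr // -invr_expz -!exprnP.
set ld := logn p `|denq q|; set ln := logn p `|numq q|.
have d0 : `|denq q|%:R != 0 :> algC by rewrite pnatr_eq0 -lt0n.
have -> : (-1) ^+ (numq q < 0)%R * `|numq q|%:R / `|denq q|%:R * (P ^+ ld * (P ^+ ln)^-1) =
    (-1) ^+ (numq q < 0)%R * ((`|numq q|%:R / P ^+ ln) * (`|denq q|%:R / P ^+ ld)^-1) :> algC.
  by field; rewrite d0 !expf_neq0.
by apply: sgn; apply: vunitM => //; apply: vunitV.
Qed.

Lemma vunit_expz (z : int) : vunit (P ^ z) -> z = 0.
Proof.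
have key (n : nat) : ~ V (P ^+ n.+1)^-1.
  move=> h; apply: VnP; have -> : P^-1 = (P ^+ n.+1)^-1 * P ^+ n.
    by rewrite exprS invfM -mulrA mulVf ?mulr1 // expf_neq0.
  by apply: VM => //; apply: VX; apply: Vnat.
case: z => [[|n]|n] // [_ Vz Vz']; first by case: (key n).
by case: (key n).
Qed.

(* [x] has valuation [a / b]. *)
Definition has_val (x : algC) (a : int) (b : nat) : Prop :=
  (0 < b)%N /\ vunit (x ^+ b * P ^ (- a)).

Lemma has_valM x y a b a' b' : has_val x a b -> has_val y a' b' ->
  has_val (x * y) (a * b' + a' * b) (b * b').
Proof.
move=> [b0 ux] [b'0 uy]; split; first by rewrite muln_gt0 b0.
have -> : (x * y) ^+ (b * b') * P ^ (- (a * b' + a' * b)) =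
   (x ^+ b * P ^ (- a)) ^+ b' * (y ^+ b' * P ^ (- a')) ^+ b.
  rewrite !exprMn -!exprM (mulnC b' b) opprD expfzDr // -!mulNr -!exprz_exp -!exprnP.
  by ring.
by apply: vunitM; apply: vunitX.
Qed.

Lemma has_val_unique x a b a' b' : has_val x a b -> has_val x a' b' -> a * b' = a' * b.
Proof.
move=> [b0 ux] [b'0 ux']; apply/eqP; rewrite -subr_eq0; apply/eqP; apply: vunit_expz.
have [xb0 _ _] := ux.
have x0 : x != 0.
  by move: xb0; rewrite mulf_eq0 negb_or expf_eq0 b0 => /andP[].
have -> : P ^ (a * b' - a' * b) = (x ^+ b' * P ^ (- a')) ^+ b * ((x ^+ b * P ^ (- a)) ^+ b')^-1.
  rewrite !exprMn -!exprM (mulnC b' b) expfzDr // -!mulNr.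
  have e (c : int) (d : nat) : (P ^ (- c)) ^+ d = (P ^ (c * d))^-1.
    by rewrite invr_expz -mulNr -exprz_exp exprnP.
  rewrite !e mulNr -invr_expz; field.
  by rewrite !expfz_neq0 // expf_neq0.
by apply: vunitM; [apply: vunitX|apply: vunitV; apply: vunitX].
Qed.

(** In a rational relation satisfied by [x], two terms must share the maximal valuation size. Their
    ratio is a unit, so a power of [x] is a rational number, hence a power of [p], up to a unit. *)
Lemma has_val_exists x : x != 0 -> exists a b, has_val x a b.
Proof.
move=> x0; have [q [_ q_mon] q_min] := minCpolyP x.
have qx : root (map_poly (ratr : rat -> algC) q) x by rewrite q_min.
pose T i := ratr q`_i * x ^+ i : algC.
pose N := [seq i <- iota 0 (size q) | q`_i != 0].
have Tneq0 i : i \in N -> T i != 0.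
  by rewrite mem_filter => /andP[qi _]; rewrite mulf_neq0 ?expf_neq0 // fmorph_eq0.
have [i iN imax] : exists2 i, i \in N & forall k, k \in N -> V (T k / T i).
  have : N != [::].
    apply/eqP => N0; have : (size q).-1 \in N.
      rewrite mem_filter -lead_coefE (monicP q_mon) oner_neq0 mem_iota /=.
      by rewrite prednK // size_poly_gt0 monic_neq0.
    by rewrite N0.
  elim: N Tneq0 => // i s IH hT _.
  have [->|s0] := eqVneq s [::].
    exists i => [|k]; rewrite ?mem_seq1 // => /eqP ->.
    by rewrite divff // hT // mem_head.
  have [|//|i' i's i'max] := IH; first by move=> k ks; rewrite hT // inE ks orbT.
  have [h|h] := Vtot (T i / T i').
    exists i'; first by rewrite inE i's orbT.
    by move=> k; rewrite inE => /orP[/eqP -> //|]; apply: i'max.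
  have Ti : T i != 0 by rewrite hT // mem_head.
  have Ti' : T i' != 0 by rewrite hT // inE i's orbT.
  exists i; first by rewrite mem_head.
  move=> k; rewrite inE => /orP[/eqP -> |/i'max hk]; first by rewrite divff.
  have -> : T k / T i = (T k / T i') * (T i / T i')^-1 by field; rewrite Ti Ti'.
  exact: VM.
(* Otherwise all the other terms divided by [T i] would lie in the maximal ideal, whereas their sum
   is -1. *)
have [k [kN ki uki]] : exists k, [/\ k \in N, k != i & vunit (T k / T i)].
  apply: contrapT => h.
  have : vmax (\sum_(k < size q | (k : nat) != i) T k / T i).
    apply: vmax_sum => k ki; have [qk|qk] := eqVneq q`_k 0.
      by left; rewrite /T qk rmorph0 !mul0r.
    have kN : (k : nat) \in N by rewrite mem_filter qk mem_iota /=.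
    right => h'; apply: h; exists (k : nat); split=> //; split=> //; last exact: imax kN.
    by rewrite mulf_neq0 ?invr_eq0 ?Tneq0.
  have isz : (i < size q)%N by move: iN; rewrite mem_filter mem_iota => /andP[].
  have -> : \sum_(k < size q | (k : nat) != i) T k / T i = -1.
    have := qx; rewrite /root (horner_coef_wide _ (leqnn _)) ?size_map_poly.
    under eq_bigr do rewrite coef_map /=.
    rewrite (bigD1 (Ordinal isz)) //= -/(T i) => /eqP/(congr1 (fun y => y / T i)).
    rewrite mul0r mulrDl divff ?Tneq0 // mulr_suml => /eqP.
    by rewrite addrC addr_eq0 => /eqP.
  move=> h1; apply: (vmax_not_unit h1); split; rewrite ?oppr_eq0 ?oner_neq0 // ?invrN ?invr1.
    by rewrite -sub0r; apply: VB.
  by rewrite -sub0r; apply: VB.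
have key k1 i1 : k1 \in N -> i1 \in N -> (i1 < k1)%N -> vunit (T k1 / T i1) ->
    exists a b, has_val x a b.
  move=> k1N i1N lt u.
  have [q1 q2] : q`_k1 != 0 /\ q`_i1 != 0.
    by move: k1N i1N; rewrite !mem_filter => /andP[? _] /andP[? _].
  have [a ua] := vunit_rat (mulf_neq0 q2 (invr_neq0 q1)).
  exists (- a), (k1 - i1)%N; split; first by rewrite subn_gt0.
  rewrite opprK.
  have -> : x ^+ (k1 - i1) * P ^ a = (T k1 / T i1) * (ratr (q`_i1 / q`_k1) * P ^ a).
    rewrite /T -(subnK (ltnW lt)) exprD addnK rmorphM fmorphV /=.
    by rewrite (subnK (ltnW lt)); field; rewrite !fmorph_eq0 q1 q2 expf_neq0.
  exact: vunitM.
have [lt|lt|e] := ltngtP i k; first exact: key lt uki; last by rewrite e eqxx in ki.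
apply: key lt _ => //; have := vunitV uki; congr vunit.
by rewrite invf_div.
Qed.

(** The default value 0 of [xget] is the value at [x = 0]. *)
Definition padic_ext (x : algC) : R :=
  xget 0 [set r | exists a b, [/\ x != 0, has_val x a b & r = expR (- (a%:~R / b%:R * ln p%:R))]].

Lemma padic_extE x a b : x != 0 -> has_val x a b ->
  padic_ext x = expR (- (a%:~R / b%:R * ln p%:R)).
Proof.
move=> x0 hx; rewrite /padic_ext; case: xgetP => [_ _ [a' [b' [_ hx' ->]]]|h].
  have e := has_val_unique hx hx'; have [b0 _] := hx; have [b'0 _] := hx'.
  suff -> : a%:~R / b%:R = a'%:~R / b'%:R :> R by [].
  apply/eqP; rewrite eqr_div ?pnatr_eq0 -?lt0n //.
  by have := congr1 (intmul (1 : R)) e; rewrite !intrM => ->.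
by have [] := h (expR (- (a%:~R / b%:R * ln p%:R))); exists a, b.
Qed.

Lemma padic_ext0 : padic_ext 0 = 0.
Proof. by rewrite /padic_ext; case: xgetP => // y _ [a [b []]]; rewrite eqxx. Qed.

Lemma padic_ext_gt0 x : x != 0 -> 0 < padic_ext x.
Proof. by move=> x0; have [a [b h]] := has_val_exists x0; rewrite (padic_extE x0 h) expR_gt0. Qed.

Lemma padic_extM x y : padic_ext (x * y) = padic_ext x * padic_ext y.
Proof.
have [->|x0] := eqVneq x 0; first by rewrite mul0r padic_ext0 mul0r.
have [->|y0] := eqVneq y 0; first by rewrite mulr0 padic_ext0 mulr0.
have [a [b hx]] := has_val_exists x0; have [a' [b' hy]] := has_val_exists y0.
rewrite (padic_extE x0 hx) (padic_extE y0 hy) (padic_extE (mulf_neq0 x0 y0) (has_valM hx hy)).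
rewrite -expRD; congr expR; rewrite intrD !intrM natrM.
have [b0 _] := hx; have [b'0 _] := hy.
by rewrite -!pmulrn; field; rewrite !pnatr_eq0 -!lt0n b0 b'0.
Qed.

Lemma padic_ext_unit x : vunit x -> padic_ext x = 1.
Proof.
move=> ux; have [x0 _ _] := ux.
rewrite (@padic_extE x 0 1 x0) ?mul0r ?oppr0 ?expR0 //.
by split=> //; rewrite oppr0 expr0z mulr1.
Qed.

Lemma padic_ext_prime : padic_ext P = p%:R^-1.
Proof.
rewrite (@padic_extE P 1 1 P0).
  by rewrite divr1 mul1r expRN lnK // posrE ltr0n prime_gt0.
by split=> //; rewrite -invr_expz expr1z expr1 divff //; apply: vunit1.
Qed.

(** A value at most 1 only puts the power [x ^+ b] in [V]. If [x] is not already there its inverse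
    is, and [x] is [x ^+ b] times a power of that inverse. *)
Lemma padic_ext_le1 x : padic_ext x <= 1 <-> V x.
Proof.
have [->|x0] := eqVneq x 0; first by rewrite padic_ext0 ler01.
have [a [b hx]] := has_val_exists x0; rewrite (padic_extE x0 hx).
have [b0 [_ u1 u2]] := hx.
have lnp : 0 < ln p%:R :> R by rewrite ln_gt0 // ltr1n prime_gt1.
have b0R : 0 < b%:R^-1 :> R by rewrite invr_gt0 ltr0n.
have -> : (expR (- (a%:~R / b%:R * ln p%:R)) <= 1 :> R) = (0 <= a).
  rewrite -[X in _ <= X]expR0 ler_expR oppr_le0 pmulr_lge0 // pmulr_lge0 //.
  by rewrite ler0z.
split=> [a0|Vx].
  have Vxb : V (x ^+ b).
    have -> : x ^+ b = (x ^+ b * P ^ (- a)) * P ^ a.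
      by rewrite -mulrA -expfzDr // addNr expr0z mulr1.
    by apply: VM => //; case: a a0 {hx u1 u2} => // n _; apply: VX; apply: Vnat.
  have [//|Vxi] := Vtot x.
  have -> : x = x ^+ b * x^-1 ^+ b.-1.
    by rewrite -{1}(prednK b0) exprS -mulrA -exprMn divff // expr1n mulr1.
  by apply: VM => //; apply: VX.
rewrite leNgt; apply/negP => a0.
have Vi : V ((x ^+ b * P ^ (- a))^-1 * x ^+ b) by apply: VM => //; apply: VX.
move: Vi; rewrite invfM mulrAC mulVf ?expf_neq0 // mul1r invr_expz opprK.
case: a a0 {hx u1 u2} => // n _ h.
apply: VnP; have -> : P^-1 = P ^ (Negz n) * P ^+ n; last by apply: VM => //; apply: VX; apply: Vnat.
by rewrite NegzE -invr_expz -exprnP exprS invfM -mulrA mulVf ?mulr1 // expf_neq0.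
Qed.

Lemma padic_ext_ultra x y : padic_ext (x + y) <= Num.max (padic_ext x) (padic_ext y).
Proof.
wlog le : x y / padic_ext x <= padic_ext y.
  move=> h; have [le|/ltW le] := leP (padic_ext x) (padic_ext y); first by rewrite -(max_r le) h.
  by rewrite -(max_l le) addrC; have := h y x le; rewrite maxC.
rewrite le_max; apply/orP; right.
have [y0|y0] := eqVneq y 0.
  move: le; rewrite y0 padic_ext0 addr0 => h; exact: h.
have Vxy : V (x / y).
  by apply/padic_ext_le1; rewrite -(ler_pM2r (padic_ext_gt0 y0)) -padic_extM divfK // mul1r.
have -> : x + y = (1 + x / y) * y by rewrite mulrDl mul1r divfK // addrC.
rewrite padic_extM ler_piMl ?(ltW (padic_ext_gt0 y0)) //.
by apply/padic_ext_le1; apply: VD.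
Qed.

Lemma padic_ext_rat (q : rat) : padic_ext (ratr q) = padic_abs R p q.
Proof.
rewrite /padic_abs; have [->|q0] := eqVneq q 0; first by rewrite rmorph0 padic_ext0.
have nat_val c : (0 < c)%N -> padic_ext c%:R = (p%:R ^+ logn p c)^-1.
  move=> c0; have -> : c%:R = (c%:R / P ^+ logn p c) * P ^+ logn p c by rewrite divfK // expf_neq0.
  rewrite padic_extM (padic_ext_unit (vunit_nat_part c0)) mul1r -exprVn -padic_ext_prime.
  by elim: (logn p c) => [|n IH]; rewrite ?expr0 ?(padic_ext_unit vunit1) // !exprS padic_extM IH.
have numP : (0 < `|numq q|)%N by rewrite absz_gt0 numq_eq0.
have denP : (0 < `|denq q|)%N by rewrite absz_gt0 denq_eq0.
have extV z : padic_ext z^-1 = (padic_ext z)^-1.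
  have [->|z0] := eqVneq z 0; first by rewrite invr0 padic_ext0 invr0.
  have ez := lt0r_neq0 (padic_ext_gt0 z0).
  apply: (mulfI ez); rewrite -padic_extM !divff //.
  exact: padic_ext_unit vunit1.
have extN : padic_ext (-1) = 1.
  apply: padic_ext_unit; split; rewrite ?oppr_eq0 ?oner_neq0 // ?invrN ?invr1.
    by rewrite -sub0r; apply: VB.
  by rewrite -sub0r; apply: VB.
rewrite /ratr padic_extM extV.
rewrite -{1}(gtz0_abs (denq_gt0 q)) nat_val // invrK mulrC; congr (_ * _).
rewrite {1}[numq q]intEsign rmorphM /= rmorph_sign padic_extM nat_val //.
by case: (numq q < 0)%R; rewrite ?expr1 ?expr0 ?extN ?(padic_ext_unit vunit1) mul1r.
Qed.

Lemma padic_extP : extends_padic p padic_ext.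
Proof.
split; [|exact: padic_ext_ultra|exact: padic_ext_rat].
have ge0 x : 0 <= padic_ext x.
  by have [->|/padic_ext_gt0/ltW//] := eqVneq x 0; rewrite padic_ext0.
split=> // [x|x y|x y].
- split=> [h|->]; last exact: padic_ext0.
  by apply/eqP; apply: contraT => /padic_ext_gt0; rewrite h ltxx.
- exact: padic_extM.
- apply: le_trans (padic_ext_ultra x y) _.
  by rewrite ge_max lerDl lerDr !ge0.
Qed.

End PadicAlgC.

(** The integers witness that some ring with 1 lacks [1 / p]; a maximal one, given by Zorn's lemma,
    is the valuation ring. *)
Lemma padic_extension_exists (R : realType) (p : nat) : prime p ->
  exists nu : algC -> R, extends_padic p nu.
Proof.
move=> p_prime.
have P0 : p%:R != 0 :> algC by rewrite pnatr_eq0 -lt0n prime_gt0.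
have [||V [Vr V1 Vmax]] := @maximal_ring_without_inv algC p (range (fun z : int => z%:~R)).
- split=> [x _|_ _ [x _ <-] [y _ <-]|_ _ [x _ <-] [y _ <-]|[x _ h]].
  + by exists 1; rewrite ?rmorph1.
  + by exists (x - y) => //; rewrite rmorphB.
  + by exists (x * y) => //; rewrite rmorphM.
  + have : (p%:Z * x)%:~R = 1%:~R :> algC by rewrite intrM h /= -pmulrn divff.
    move=> /intr_inj/(congr1 absz); rewrite abszM /= => /eqP.
    by rewrite muln_eq1 => /andP[/eqP p1 _]; move: p_prime; rewrite p1.
- by exists 1; rewrite ?rmorph1.
have [_ VB VM VnP] := Vr.
exists (@padic_ext R p V).
apply: padic_extP => //.
- by move=> x; apply: (@maximal_ring_total _ p).
- by move=> a; apply: (@one_plus_unit _ p).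
Qed.

(** * The archimedean absolute value of algC, with values in [R] *)

Section ArchimedeanAlgC.
Variable R : realType.

(** The norm of algC takes its values in algC; a nonnegative one is carried to [R] by the cut that
    it makes in Q. *)
Definition real_of_algC (y : algC) : R := sup [set r | exists2 q : rat, ratr q <= y & r = ratr q].

Lemma real_of_algC_sup (y : algC) : 0 <= y ->
  has_sup [set r : R | exists2 q : rat, ratr q <= y & r = ratr q].
Proof.
move=> y0; split; first by exists (ratr 0), 0; rewrite ?rmorph0.
have := archi_boundP y0; set n := Num.Def.archi_bound y => yn.
exists n%:R => _ [q qy ->]; rewrite -(ratr_nat R n) ler_rat -(ler_rat algC) ratr_nat.
by apply: le_trans qy (ltW yn).
Qed.

Lemma real_of_algC_ge (y : algC) (q : rat) : 0 <= y -> (ratr q : algC) <= y ->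
  (ratr q : R) <= real_of_algC y.
Proof.
by move=> y0 qy; apply: sup_upper_bound; [exact: real_of_algC_sup|exists q].
Qed.

Lemma real_of_algC_le (y : algC) (q : rat) : 0 <= y -> y <= (ratr q : algC) -> real_of_algC y <= (ratr q : R).
Proof.
move=> y0 yq; apply: ge_sup; first by have [] := real_of_algC_sup y0.
by move=> _ [q' q'y ->]; rewrite ler_rat -(ler_rat algC); apply: le_trans yq.
Qed.

Lemma real_of_algC_lt (y : algC) (q : rat) : 0 <= y -> real_of_algC y < (ratr q : R) -> y <= (ratr q : algC).
Proof.
move=> y0 h; have [//|/ltW qy] := real_leP (ger0_real y0) (Creal_Crat (Crat_rat q)).
by have := real_of_algC_ge y0 qy; rewrite leNgt h.
Qed.

Lemma real_of_algC_gt (y : algC) (q : rat) : 0 <= y -> (ratr q : R) < real_of_algC y -> (ratr q : algC) <= y.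
Proof.
move=> y0 h; have [/ltW yq|//] := real_ltP (ger0_real y0) (Creal_Crat (Crat_rat q)).
by have := real_of_algC_le y0 yq; rewrite leNgt h.
Qed.

Lemma real_of_algC_rat (q : rat) : 0 <= q -> real_of_algC (ratr q) = ratr q.

Proof.
move=> q0; have q0' : 0 <= (ratr q : algC) by rewrite ler0q.
by apply/eqP; rewrite eq_le real_of_algC_le ?real_of_algC_ge.
Qed.

Lemma real_of_algC0 : real_of_algC 0 = 0.
Proof. by have := @real_of_algC_rat 0 (lexx 0); rewrite !rmorph0. Qed.

Lemma real_of_algC_ge0 (y : algC) : 0 <= y -> 0 <= real_of_algC y.
Proof. by move=> y0; have := @real_of_algC_ge y 0 y0; rewrite !rmorph0; apply. Qed.

Lemma real_of_algC_mono (y z : algC) : 0 <= y -> y <= z -> real_of_algC y <= real_of_algC z.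
Proof.
move=> y0 yz; have z0 := le_trans y0 yz.
apply: ge_sup; first by have [] := real_of_algC_sup y0.
by move=> _ [q qy ->]; apply: real_of_algC_ge => //; apply: le_trans yz.
Qed.

Lemma real_of_algC_gt0 (y : algC) : 0 < y -> 0 < real_of_algC y.
Proof.
move=> y0; have yi : 0 <= y^-1 by rewrite invr_ge0 ltW.
have := archi_boundP yi; set n := Num.Def.archi_bound _ => yn.
have n0 : 0 < n%:R :> algC by apply: le_lt_trans yn.
apply: lt_le_trans (_ : ratr n%:R^-1 <= _).
  by rewrite ltr0q invr_gt0; rewrite !ltr0n in n0 *.
apply: real_of_algC_ge; first exact: ltW.
by rewrite fmorphV /= ratr_nat -[leRHS]invrK lef_pV2 ?posrE ?invr_gt0 // ltW.
Qed.

Lemma real_of_algCD (y z : algC) : 0 <= y -> 0 <= z ->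
  real_of_algC (y + z) <= real_of_algC y + real_of_algC z.
Proof.
move=> y0 z0; rewrite leNgt; apply/negP => h.
set a := real_of_algC y in h; set b := real_of_algC z in h; set c := real_of_algC _ in h.
have e0 : 0 < (c - (a + b)) / 2 by rewrite divr_gt0 // subr_gt0.
have a_lt : a < a + (c - (a + b)) / 2 by rewrite ltrDl.
have [q1] := rat_in_itvoo a_lt.
rewrite in_itv /= => /andP[a1 a2].
have b_lt : b < b + (c - (a + b)) / 2 by rewrite ltrDl.
have [q2] := rat_in_itvoo b_lt.
rewrite in_itv /= => /andP[b1 b2].
have : c <= ratr (q1 + q2).
  apply: real_of_algC_le; first exact: addr_ge0.
  by rewrite rmorphD lerD //; apply: real_of_algC_lt.
rewrite rmorphD /=; lra.
Qed.

Lemma real_of_algCM (y z : algC) : 0 <= y -> 0 <= z ->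
  real_of_algC (y * z) = real_of_algC y * real_of_algC z.
Proof.
move=> y0 z0; have yz0 := mulr_ge0 y0 z0.
have [->|yn] := eqVneq y 0.
  by rewrite mul0r real_of_algC0 mul0r.
have [->|zn] := eqVneq z 0.
  by rewrite mulr0 real_of_algC0 mulr0.
have a0 : 0 < real_of_algC y by rewrite real_of_algC_gt0 // lt_neqAle eq_sym yn.
have b0 : 0 < real_of_algC z by rewrite real_of_algC_gt0 // lt_neqAle eq_sym zn.
have c0 := real_of_algC_ge0 yz0.
have ha q := @real_of_algC_lt _ q y0; have hb q := @real_of_algC_lt _ q z0.
have hc q := @real_of_algC_le _ q yz0.
have ha' q := @real_of_algC_gt _ q y0; have hb' q := @real_of_algC_gt _ q z0.
have hc' q := @real_of_algC_ge _ q yz0.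
set a := real_of_algC y in a0 ha ha' *; set b := real_of_algC z in b0 hb hb' *.
set c := real_of_algC _ in c0 hc hc' *.
apply/eqP; rewrite eq_le; apply/andP; split; rewrite leNgt; apply/negP => h.
(* If [c > a b], there are rationals [q1 > a] and [q2 > b] with [q1 q2 < c]. They bound [y] and [z]
   from above, so their product bounds [c]. The other case is symmetric. *)
- have d0 : 0 < (c - a * b) / (2 * b) by rewrite divr_gt0 ?subr_gt0 ?mulr_gt0.
  have a_lt : a < a + (c - a * b) / (2 * b) by rewrite ltrDl.
  have [q1] := rat_in_itvoo a_lt.
  rewrite in_itv /= => /andP[a1 a2].
  have q10 : 0 < ratr q1 :> R := lt_trans a0 a1.
  have q1b : ratr q1 * b < c.
    have : ratr q1 * b < (a + (c - a * b) / (2 * b)) * b by rewrite ltr_pM2r.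
    have -> : (a + (c - a * b) / (2 * b)) * b = (a * b + c) / 2 by field; rewrite gt_eqF.
    lra.
  have b_lt : b < c / ratr q1 by rewrite ltr_pdivlMr // mulrC.
  have [q2] := rat_in_itvoo b_lt.
  rewrite in_itv /= => /andP[b1]; rewrite ltr_pdivlMr // => b2.
  have : c <= ratr (q1 * q2).
    apply: hc; rewrite rmorphM ler_pM //; [exact: ha|exact: hb].
  by rewrite rmorphM /= leNgt mulrC b2.
- have cb_lt : c / b < a by rewrite ltr_pdivrMr.
  have [q1] := rat_in_itvoo cb_lt.
  rewrite in_itv /= => /andP[a1 a2].
  have q10 : 0 < ratr q1 :> R by apply: le_lt_trans a1; rewrite divr_ge0 // ltW.
  have it6 : c / ratr q1 < b by rewrite ltr_pdivrMr // mulrC -ltr_pdivrMr.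
  have [q2] := rat_in_itvoo it6.
  rewrite in_itv /= => /andP[b1 b2].
  have q20 : 0 < ratr q2 :> R by apply: le_lt_trans b1; rewrite divr_ge0 // ltW.
  have : ratr (q1 * q2) <= c.
    apply: hc'; rewrite rmorphM ler_pM //; [| |exact: ha'|exact: hb'].
      by rewrite ler0q -(ler0q R) ltW.
    by rewrite ler0q -(ler0q R) ltW.
  by rewrite rmorphM /= leNgt mulrC -ltr_pdivrMr // b1.
Qed.

Definition arch_abs (x : algC) : R := real_of_algC `|x|.

Lemma arch_abs_absolute : absolute_value arch_abs.
Proof.
split=> [x|x|x y|x y]; rewrite /arch_abs.
- exact: real_of_algC_ge0.
- split=> [|->]; last by rewrite normr0 real_of_algC0.
  move=> h; apply/eqP; apply: contraT; rewrite -normr_gt0 => /real_of_algC_gt0.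
  by rewrite h ltxx.
- by rewrite normrM real_of_algCM.
- apply: le_trans (real_of_algC_mono _ (ler_normD x y)) (real_of_algCD _ _) => //.
Qed.

Lemma arch_abs_rat (q : rat) : arch_abs (ratr q) = ratr `|q|.
Proof. by rewrite /arch_abs -ratr_norm real_of_algC_rat. Qed.

End ArchimedeanAlgC.

(** * The height in terms of conjugates, and Northcott's theorem *)

Section Ultrametric.
Variables (R : realType) (p : nat) (nu : algC -> R).
Hypothesis p_prime : prime p.
Hypothesis nuP : extends_padic p nu.

Let nu_abs : absolute_value nu. Proof. by case: nuP. Qed.

Lemma ultra_sum_le I (r : seq I) (Q : pred I) (F : I -> algC) (M : R) :
  0 <= M -> (forall i, Q i -> nu (F i) <= M) -> nu (\sum_(i <- r | Q i) F i) <= M.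
Proof.
have [_ ultra _] := nuP => M0 h; elim/big_ind: _ => //; first by rewrite (av0 nu_abs).
by move=> x y hx hy; apply: le_trans (ultra x y) _; rewrite ge_max hx hy.
Qed.

Lemma ultraB x y : nu (x - y) <= Num.max (nu x) (nu y).
Proof. by have [_ ultra _] := nuP; rewrite -(avN nu_abs y); apply: ultra. Qed.

(** The maximum is weakened to a product to match the hypothesis of [ln_vandermonde_ultra_le] with
    [beta = 1]. *)
Lemma ultra_sub_le x y : nu (x - y) <= Num.max 1 (nu x) * Num.max 1 (nu y).
Proof.
have mx : 1 <= Num.max 1 (nu x) by rewrite le_max lexx.
have my : 1 <= Num.max 1 (nu y) by rewrite le_max lexx.
apply: le_trans (ultraB x y) _; rewrite ge_max; apply/andP; split.
  apply: le_trans (_ : Num.max 1 (nu x) <= _); first by rewrite le_max lexx orbT.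
  by rewrite ler_peMr // (le_trans ler01).
apply: le_trans (_ : Num.max 1 (nu y) <= _); first by rewrite le_max lexx orbT.
by rewrite ler_peMl // (le_trans ler01).
Qed.

Lemma ultra_add_eq x y : nu x < nu y -> nu (x + y) = nu y.
Proof.
have [_ ultra _] := nuP => lt; apply/eqP; rewrite eq_le.
rewrite (le_trans (ultra x y)) ?ge_max ?(ltW lt) ?lexx //=.
have := ultraB (x + y) x; rewrite addrAC subrr add0r le_max => /orP[//|].
by rewrite leNgt lt.
Qed.

Lemma padic_abs_nat_le1 (n : nat) : nu n%:R <= 1.
Proof.
have [_ _ ext] := nuP; rewrite -(ratr_nat algC n) ext /padic_abs.
case: eqP => // _; rewrite -[n%:R]/((n%:Z)%:~R) numq_int denq_int absz1 logn1 expr0 div1r.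
rewrite invf_le1 ?exprn_gt0 ?ltr0n ?prime_gt0 // exprn_ege1 // ler1n prime_gt0 //.
Qed.

Lemma nu_prime : nu p%:R = p%:R^-1.
Proof.
have [_ _ ext] := nuP; rewrite -(ratr_nat algC p) ext /padic_abs.
have -> : (p%:R == 0 :> rat) = false by rewrite pnatr_eq0 gtn_eqF ?prime_gt0.
rewrite -[p%:R : rat]/((p%:Z)%:~R) numq_int denq_int absz1 logn1 expr0 div1r.
by rewrite /= (logn_prime _ p_prime) eqxx expr1.
Qed.

Lemma nu_other_prime q : prime q -> q != p -> nu q%:R = 1.
Proof.
move=> q_prime qp; have [_ _ ext] := nuP; rewrite -(ratr_nat algC q) ext /padic_abs.
have -> : (q%:R == 0 :> rat) = false by rewrite pnatr_eq0 gtn_eqF ?prime_gt0.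
rewrite -[q%:R : rat]/((q%:Z)%:~R) numq_int denq_int absz1 logn1 expr0 div1r.
by rewrite /= (logn_prime _ q_prime) eq_sym (negPf qp) expr0 invr1.
Qed.

Lemma padic_rat_le1 (q : rat) : (`|denq q| < p)%N -> nu (ratr q) <= 1.
Proof.
move=> dp; have [_ _ ext] := nuP; rewrite ext /padic_abs; case: eqP => // _.
have -> : logn p `|denq q| = 0%N.
  apply/eqP; rewrite -leqn0 leqNgt logn_gt0 mem_primes p_prime /= absz_gt0 denq_neq0 /=.
  by apply/negP => /dvdn_leq; rewrite absz_gt0 denq_neq0 leqNgt dp => /(_ isT).
rewrite expr0 div1r invf_le1 ?exprn_gt0 ?ltr0n ?prime_gt0 // exprn_ege1 // ler1n prime_gt0 //.
Qed.

(** If [nu z > 1], the leading term would strictly dominate the others. *)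
Lemma monic_root_le1 (h : {poly algC}) z : h \is monic -> (forall k, nu h`_k <= 1) ->
  root h z -> nu z <= 1.
Proof.
move=> h_mon hk hz; rewrite leNgt; apply/negP => z1.
have z0 : 0 < nu z := lt_trans ltr01 z1.
have sz : (0 < size h)%N by rewrite size_poly_gt0 monic_neq0.
have [s1|s1] := leqP (size h) 1.
  move: hz; rewrite (size1_polyC s1) /root hornerC.
  have := monicP h_mon; rewrite lead_coefE; case: (size h) s1 sz => // -[] //= _ _ ->.
  by rewrite oner_eq0.
have e : z ^+ (size h).-1 = - \sum_(k < (size h).-1) h`_k * z ^+ k.
  move: hz; rewrite /root horner_coef.
  case E : (size h) sz => [//|m] _; rewrite big_ord_recr /=.
  have -> : h`_m = 1 by have := monicP h_mon; rewrite lead_coefE E.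
  by rewrite mul1r addrC addr_eq0 => /eqP.
have := congr1 nu e; rewrite (avN nu_abs) (avX nu_abs) => e'.
have : nu z ^+ (size h).-1 <= nu z ^+ (size h).-2.
  rewrite e'; apply: ultra_sum_le; first by rewrite exprn_ge0 // ltW.
  move=> k _; rewrite (avM nu_abs) (avX nu_abs).
  apply: le_trans (_ : nu z ^+ k <= _); first by rewrite ler_piMl // exprn_ge0 // ltW.
  rewrite ler_weXn2l ?(ltW z1) // -ltnS prednK ?ltn_ord //.
  by rewrite -subn1 subn_gt0.
case: (size h) s1 => [|[|m]] //= _; rewrite exprS leNgt => /negP; apply.
by rewrite ltr_pMl // exprn_gt0.
Qed.

End Ultrametric.

(** Exceptions can only occur at primes dividing a denominator of the minimal polynomial, and the
    sum of the denominators is at least each of them. The bound is uniform in the extension [nu]. *)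
Lemma padic_integral_almost (R : realType) (a : algC) : exists B : nat,
  forall (p : nat) (nu : algC -> R), prime p -> (B < p)%N -> extends_padic p nu ->
  forall z, z \in conjugates a -> nu z <= 1.
Proof.
have [q [Dq q_mon] _] := minCpolyP a.
exists (\sum_(k < size q) `|denq q`_k|)%N => p nu p_prime Bp nuP z.
rewrite mem_conjugates; apply: (monic_root_le1 nuP (minCpoly_monic a)) => k.
rewrite Dq coef_map /=; apply: (padic_rat_le1 p_prime nuP).
have [kq|qk] := ltnP k (size q); last by rewrite nth_default // prime_gt1.
by apply: leq_ltn_trans Bp; rewrite (bigD1 (Ordinal kq)) //= leq_addr.
Qed.

Lemma padic_unit_almost (R : realType) (a : algC) : a != 0 -> exists B : nat,
  forall (p : nat) (nu : algC -> R), prime p -> (B < p)%N -> extends_padic p nu -> nu a = 1.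
Proof.
move=> a0; have [B1 h1] := padic_integral_almost R a.
have [B2 h2] := padic_integral_almost R a^-1.
exists (maxn B1 B2) => p nu p_prime; rewrite gtn_max => /andP[b1 b2] nuP.
have [nu_abs _ _] := nuP.
have m b : b \in conjugates b by rewrite mem_conjugates root_minCpoly.
apply/eqP; rewrite eq_le (h1 p nu) //=.
by have := h2 p nu p_prime b2 nuP _ (m _); rewrite (avV nu_abs) invf_le1 // (av_gt0 nu_abs).
Qed.

Definition abs_family (R : realType) (nu : nat -> algC -> R) : Prop :=
  [/\ absolute_value (nu 0%N), forall q : rat, nu 0%N (ratr q) = ratr `|q| &
      forall p, prime p -> extends_padic p (nu p)].

Lemma abs_family_exists (R : realType) : exists nu : nat -> algC -> R, abs_family nu.
Proof.
have h p : exists nu : algC -> R, prime p -> extends_padic p nu.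
  have [/(padic_extension_exists R)[nu]|] := boolP (prime p); first by exists nu.
  by exists (fun=> 0).
have [nu hnu] := choice h.
exists (fun u => if u is 0 then @arch_abs R else nu u).
split; [exact: arch_abs_absolute|exact: arch_abs_rat|].
by move=> [|p] // /hnu.
Qed.

(* Index 0 stands for the archimedean absolute value. *)
Definition abs_indices (B : nat) : seq nat := [seq u <- iota 0 B.+1 | (u == 0%N) || prime u].

Lemma mem_abs_indices B u : (u \in abs_indices B) = ((u == 0%N) || prime u) && (u <= B)%N.
Proof. by rewrite mem_filter mem_iota add0n ltnS leq0n. Qed.

Definition log_plus (R : realType) (x : R) : R := ln (Num.max 1 x).

Section HeightFormula.
Variables (R : realType) (nu : nat -> algC -> R).
Hypothesis nuP : abs_family nu.

Lemma abs_family_abs u : (u == 0%N) || prime u -> absolute_value (nu u).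
Proof. by have [h _ hp] := nuP => /orP[/eqP -> //|/hp[]]. Qed.

(** The larger index [u'], if not 0, is a prime: it has value [1 / u'] at its own index and at least
    1 at any other. *)
Lemma abs_family_neq u u' : (u == 0%N) || prime u -> (u' == 0%N) || prime u' ->
  (forall q : rat, nu u (ratr q) = nu u' (ratr q)) -> u = u'.
Proof.
wlog uu' : u u' / (u <= u')%N.
  move=> h hu hu' e; have [le|/ltnW le] := leqP u u'; first exact: h.
  by symmetry; apply: h => // q; rewrite e.
have [_ nu0 nup] := nuP.
have [u'0|u'0] := eqVneq u' 0%N.
  by move: uu'; rewrite u'0 leqn0 => /eqP ->.
move=> hu /= hu' /(_ u'%:R).
have u'1 : 1 < u'%:R :> R by rewrite ltr1n prime_gt1.
rewrite ratr_nat (nu_prime hu' (nup _ hu')) => e.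
apply/eqP; apply: contraT => nuu'.
have [u0|u0] := eqVneq u 0%N.
  move: e; rewrite u0 -(ratr_nat algC) nu0 normr_nat ratr_nat => e.
  have : u'%:R^-1 < 1 :> R by rewrite invf_lt1 // (lt_trans ltr01).
  by rewrite -e => /(lt_trans u'1); rewrite ltxx.
rewrite (negPf u0) /= in hu.
move: e; rewrite (nu_other_prime (nup _ hu) hu') ?(eq_sym u') // => e.
have : u'%:R^-1 < 1 :> R by rewrite invf_lt1 // (lt_trans ltr01).
by rewrite -e ltxx.
Qed.

Lemma standard_abs_ratP (u : rat -> R) : standard_abs_rat u <->
  exists2 k, (k == 0%N) || prime k & forall q, u q = nu k (ratr q).
Proof.
have [_ nu0 nup] := nuP; split=> [[h|[p p_prime h]]|[k hk h]].
- by exists 0%N => // q; rewrite h nu0.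
- by exists p => [|q]; rewrite ?p_prime ?orbT // h; have [_ _ ->] := nup _ p_prime.
move/orP: hk => [/eqP k0|k_prime]; [left|right; exists k => //] => q; rewrite h ?k0 //.
by have [_ _ ->] := nup _ k_prime.
Qed.

(** Double counting: a place of local degree [m] that lies above the index [u] is [w u i] for
    exactly [m] embeddings [i], and for no other index. *)
Lemma height_inE (F : fieldExtType rat) (j : {rmorphism F -> algC}) (theta : F) (f : {poly rat})
    (g : 'I_(\dim {:F}) -> {rmorphism algC -> algC}) (x : F) (B : nat) :
  embedding_system j theta f g ->
  (forall p i, prime p -> (B < p)%N -> nu p (g i (j x)) <= 1) ->
  height_in R x = (\dim {:F})%:R^-1 *
    \sum_(u <- abs_indices B) \sum_i log_plus (nu u (g i (j x))).
Proof.
move=> hg hB; rewrite /height_in; congr (_ * _).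
set n := \dim _ in g hg hB *.
pose w u i : F -> R := fun y => nu u (g i (j y)).
have w_abs u i : (u == 0%N) || prime u -> absolute_value (w u i).
  by move=> hu; apply: (absolute_value_comp (g i \o j)%FUN); apply: abs_family_abs.
have w_rat u i (q : rat) : w u i q%:A = nu u (ratr q).
  by rewrite /w alg_num_field !fmorph_rat.
have w_places u i : (u == 0%N) || prime u -> @places R F (w u i).
  move=> hu; split; first exact: w_abs.
  by apply/standard_abs_ratP; exists u.
have places_w v : @places R F v -> exists u i, ((u == 0%N) || prime u) /\ v = w u i.
  move=> [v_abs /standard_abs_ratP[u hu vu]].
  have [i hi] := place_is_embedding (abs_family_abs hu) hg v_abs vu.
  by exists u, i; split=> //; apply/funext => y; rewrite -hi.
(* The places above the indices up to [B], without repetition; at any other place [x] contributes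
   [ln 1]. *)
pose W := undup [seq w u i | u <- abs_indices B, i <- enum 'I_n].
have memW v : reflect (exists u i, u \in abs_indices B /\ v = w u i) (v \in W).
  rewrite mem_undup; apply: (iffP allpairsP) => [[[u i] [hu _ ->]]|[u [i [hu ->]]]].
    by exists u, i.
  by exists (u, i); split=> //; rewrite mem_enum.
pose phi v : R := (local_degree v)%:R * log_plus (v x).
have WP v : v \in W -> @places R F v.
  by move=> /memW[u [i [+ ->]]]; rewrite mem_abs_indices => /andP[hu _]; apply: w_places.
have vanish v : @places R F v -> v \notin W -> (local_degree v)%:R * ln (Num.max 1 (v x)) = 0 :> R.
  move=> /places_w[u [i [hu ->]]] nW.
  have u0 : (B < u)%N.
    rewrite ltnNge; apply/negP => uB; move/negP: nW; apply; apply/memW.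
    by exists u, i; rewrite mem_abs_indices hu.
  have u_prime : prime u by case/orP: hu u0 => // /eqP ->.
  by rewrite max_l ?ln1 ?mulr0 //; apply: hB.
rewrite (fsbigE W _ (undup_uniq _) WP vanish).
have degE v : v \in W -> (local_degree v)%:R =
    \sum_(u <- abs_indices B) \sum_i (v == w u i)%:R :> R.
  move=> /memW[u [i [hu Dv]]].
  have hu' : (u == 0%N) || prime u by move: hu; rewrite mem_abs_indices => /andP[].
  rewrite (local_degreeE (abs_family_abs hu') hg (v := v)); first last.
  - by move=> q; rewrite Dv w_rat.
  - by rewrite Dv; apply: w_abs.
  have us_uniq : uniq (abs_indices B) by rewrite filter_uniq ?iota_uniq.
  rewrite (bigD1_seq u) //= [X in _ + X]big1_seq ?addr0; last first.
    move=> u' /andP[u'u hu1]; apply: big1 => i' _; rewrite Dv.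
    case: eqP => // e; move: u'u; rewrite (@abs_family_neq u' u) ?eqxx //.
      by move: hu1; rewrite mem_abs_indices => /andP[].
    by move=> q; rewrite -(w_rat u' i') -e w_rat.
  rewrite -natr_sum -sum1_card big_mkcond; congr (_%:R); apply: eq_bigr => i' _.
  rewrite inE; case: asboolP => [h|h]; case: eqP => // e.
    by case: e; apply/funext => y; rewrite /w h.
  by case: h => y; rewrite e.
transitivity (\sum_(v <- W) \sum_(u <- abs_indices B) \sum_i
    (v == w u i)%:R * log_plus (v x)).
  rewrite big_mkcond [LHS]big_seq [RHS]big_seq; apply: eq_bigr => v vW.
  rewrite ifT; last by rewrite inE; apply: WP.
  rewrite degE // mulr_suml; apply: eq_bigr => u _; rewrite mulr_suml //.
rewrite exchange_big /= big_seq [RHS]big_seq; apply: eq_bigr => u hu.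
rewrite exchange_big /=; apply: eq_bigr => i _.
have wW : w u i \in W by apply/memW; exists u, i.
rewrite (bigD1_seq (w u i)) ?undup_uniq //= eqxx mul1r big1 ?addr0 //.
by move=> v /negPf ->; rewrite mul0r.
Qed.

(** The mean over the embeddings, taken in whichever field [xget] selects, is the mean over the
    conjugates, which depends on [a] alone. *)
Lemma weil_heightE (a : algC) (B : nat) :
  (forall p z, prime p -> (B < p)%N -> z \in conjugates a -> nu p z <= 1) ->
  weil_height R a = (size (conjugates a))%:R^-1 *
    \sum_(u <- abs_indices B) \sum_(z <- conjugates a) log_plus (nu u z).
Proof.
move=> hB; rewrite /weil_height; case: xgetP => [h _ [F [j [x [Da ->]]]]|].
  have [theta [f [g hg]]] := number_field_embeddings j.
  rewrite (height_inE (B := B) hg); last first.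
    move=> p i p_prime Bp; apply: hB => //.
    by rewrite mem_conjugates Da -(minCpoly_aut (g i)) root_minCpoly.
  have n0 : (\dim {:F})%:R != 0 :> R.
    by rewrite pnatr_eq0 -lt0n adim_gt0.
  have s0 : (size (conjugates a))%:R != 0 :> R.
    by rewrite pnatr_eq0 -lt0n size_conjugates_gt0.
  rewrite !mulr_sumr; apply: eq_bigr => u _.
  have := sum_over_embeddings hg x (fun z => log_plus (nu u z)); rewrite Da => e.
  have -> : \sum_i log_plus (nu u (g i a)) =
      (\dim {:F})%:R * (\sum_(z <- conjugates a) log_plus (nu u z)) / (size (conjugates a))%:R.
    by rewrite -e mulrAC divff // mul1r.
  by rewrite mulrA mulKf // mulrC.
move=> h; have [Qs [QsC [s1 Ds1 _]]] := num_field_exists [:: a].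
case: s1 Ds1 => // x [] // [Dx].
by have [] := h (height_in R x); exists Qs, QsC, x.
Qed.

End HeightFormula.

Lemma log_plus_ge0 (R : realType) (x : R) : 0 <= log_plus x.
Proof. by rewrite ln_ge0 // le_max lexx. Qed.

Lemma log_plus_ge (R : realType) (x : R) : 0 < x -> ln x <= log_plus x.
Proof. by move=> x0; rewrite ler_ln ?posrE // ?lt_max ?ltr01 // le_max lexx orbT. Qed.

Lemma log_plus_le (R : realType) (x y : R) : x <= y -> log_plus x <= log_plus y.
Proof. by move=> xy; rewrite ler_ln ?posrE ?lt_max ?ltr01 // ge_max !le_max lexx xy orbT. Qed.

(** * Product formula over Q and Northcott's finiteness theorem *)

Section RationalHeight.
Variables (R : realType) (nu : nat -> algC -> R).
Hypothesis nuP : abs_family nu.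

Lemma abs_indices_valid B u : u \in abs_indices B -> (u == 0%N) || prime u.
Proof. by rewrite mem_abs_indices => /andP[]. Qed.

Lemma sum_abs_indices B (h : nat -> R) :
  \sum_(u <- abs_indices B) h u = h 0%N + \sum_(1 <= u < B.+1 | prime u) h u.
Proof.
rewrite /abs_indices /= big_cons; congr (_ + _).
rewrite big_filter /index_iota subSS subn0 [LHS]big_seq_cond [RHS]big_seq_cond.
by apply: eq_bigl => u; rewrite mem_iota; case: u.
Qed.

(** Multiplicativity reduces this to a prime [q], where the archimedean [ln q] cancels the [q]-adic
    [- ln q]. The bound [c <= B] keeps the primes involved among the indices. *)
Lemma product_formula_nat (c B : nat) : (0 < c)%N -> (c <= B)%N ->
  \sum_(u <- abs_indices B) ln (nu u c%:R) = 0.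
Proof.
have valid u : u \in abs_indices B -> absolute_value (nu u).
  by move=> /abs_indices_valid/(abs_family_abs nuP).
have [_ nu0 nup] := nuP.
elim: c {-2}c (leqnn c) => [|N IH] c cN c0 cB; first by move: c0; rewrite ltnNge cN.
have [c1|c1] := leqP c 1.
  have -> : c = 1%N by apply/eqP; rewrite eqn_leq c1.
  by rewrite big_seq big1 // => u hu; rewrite (av1 (valid u hu)) ln1.
have q_prime := pdiv_prime c1; set q := pdiv c in q_prime.
have Dc : c = (q * (c %/ q))%N by rewrite mulnC divnK // pdiv_dvd.
have d0 : (0 < c %/ q)%N by rewrite divn_gt0 ?prime_gt0 // pdiv_leq.
have dc : (c %/ q < c)%N by rewrite ltn_Pdiv // prime_gt1.
transitivity (\sum_(u <- abs_indices B) ln (nu u q%:R)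
   + \sum_(u <- abs_indices B) ln (nu u (c %/ q)%:R)).
  rewrite -big_split /= big_seq [RHS]big_seq; apply: eq_bigr => u hu.
  have hv := valid u hu.
  by rewrite {1}Dc natrM (avM hv) lnM // posrE (av_gt0 hv) pnatr_eq0 -lt0n // prime_gt0.
rewrite [X in _ + X]IH ?addr0 //; last first.
- by apply: leq_trans cB; apply: ltnW.
- by rewrite -ltnS; apply: leq_trans dc _.
have qB : (q <= B)%N by apply: leq_trans cB; rewrite pdiv_leq.
rewrite sum_abs_indices -big_filter (bigD1_seq q) ?filter_uniq ?iota_uniq //=; last first.
  by rewrite mem_filter q_prime mem_index_iota prime_gt0.
rewrite (nu_prime q_prime (nup _ q_prime)) lnV ?posrE ?ltr0n ?prime_gt0 //.
rewrite -(ratr_nat algC) nu0 normr_nat !ratr_nat addrA subrr add0r.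
rewrite big1_seq // => u /andP[uq]; rewrite mem_filter => /andP[u_prime _].
by rewrite (nu_other_prime (nup _ u_prime)) ?ln1 // eq_sym.
Qed.

Lemma abs_ratE u (q : rat) : (u == 0%N) || prime u ->
  nu u (ratr q) = nu u `|numq q|%:R / nu u `|denq q|%:R.
Proof.
move=> hu; have hv := abs_family_abs nuP hu.
have -> : ratr q = (-1) ^+ (numq q < 0)%R * (`|numq q|%:R / `|denq q|%:R) :> algC.
  rewrite mulrA /ratr [numq q in LHS]intEsign rmorphM /= rmorph_sign; congr (_ * _ / _).
  by rewrite -{1}(gtz0_abs (denq_gt0 q)).
rewrite !(avM hv) (avV hv) (avX hv) (avN hv) (av1 hv) expr1n mul1r //.
Qed.

Lemma product_formula (q : rat) (B : nat) : q != 0 ->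
  (`|numq q| <= B)%N -> (`|denq q| <= B)%N ->
  \sum_(u <- abs_indices B) ln (nu u (ratr q)) = 0.
Proof.
move=> q0 nB dB.
have n0 : (0 < `|numq q|)%N by rewrite absz_gt0 numq_eq0.
have d0 : (0 < `|denq q|)%N by rewrite absz_gt0 denq_neq0.
transitivity (\sum_(u <- abs_indices B) ln (nu u `|numq q|%:R)
   - \sum_(u <- abs_indices B) ln (nu u `|denq q|%:R)); last first.
  by rewrite !product_formula_nat // subrr.
rewrite -sumrB big_seq [RHS]big_seq; apply: eq_bigr => u hu.
have hv := abs_family_abs nuP (abs_indices_valid hu).
rewrite abs_ratE ?(abs_indices_valid hu) // ln_div ?posrE ?(av_gt0 hv) //.
  by rewrite pnatr_eq0 -lt0n.
by rewrite pnatr_eq0 -lt0n.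
Qed.

(** The numerator is a unit at the primes dividing the denominator, so by the product formula the
    finite places contribute at least the logarithm of the denominator. The archimedean place
    supplies what is missing for the numerator. *)
Lemma rational_height_ge (q : rat) (B : nat) : q != 0 ->
  (`|numq q| <= B)%N -> (`|denq q| <= B)%N ->
  ln `|numq q|%:R <= \sum_(u <- abs_indices B) log_plus (nu u (ratr q)) /\
  ln `|denq q|%:R <= \sum_(u <- abs_indices B) log_plus (nu u (ratr q)).
Proof.
move=> q0 nB dB.
have n0 : (0 < `|numq q|)%N by rewrite absz_gt0 numq_eq0.
have d0 : (0 < `|denq q|)%N by rewrite absz_gt0 denq_neq0.
have [_ nu0 nup] := nuP.
have := product_formula_nat d0 dB.
rewrite !sum_abs_indices; set S := \sum_(1 <= u < B.+1 | prime u) ln _.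
set T := \sum_(1 <= u < B.+1 | prime u) log_plus _ => e.
have ST : - S <= T.
  rewrite -sumrN; apply: ler_sum => u u_prime.
  rewrite abs_ratE ?u_prime ?orbT //.
  have hu : absolute_value (nu u) by have [] := nup _ u_prime.
  have [ud|und] := boolP (u %| `|denq q|)%N.
    have un : coprime u `|numq q|.
      have := coprime_num_den q; rewrite coprime_sym => h.
      exact: coprime_dvdl ud h.
    have -> : nu u `|numq q|%:R = 1.
      rewrite -(ratr_nat algC); have [_ _ ->] := nup _ u_prime.
      rewrite /padic_abs pnatr_eq0 -leqn0 leqNgt n0 /=.
      rewrite -[`|numq q|%:R : rat]/((`|numq q|%:Z)%:~R) numq_int denq_int absz1 logn1 expr0 div1r.
      by rewrite absz_nat (logn_coprime un) expr0 invr1.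
    rewrite div1r -lnV ?posrE ?(av_gt0 hu) ?pnatr_eq0 -?lt0n //.
    by apply: log_plus_ge; rewrite invr_gt0 (av_gt0 hu) pnatr_eq0 -lt0n.
  have -> : nu u `|denq q|%:R = 1.
    rewrite -(ratr_nat algC); have [_ _ ->] := nup _ u_prime.
    rewrite /padic_abs pnatr_eq0 -leqn0 leqNgt d0 /=.
    rewrite -[`|denq q|%:R : rat]/((`|denq q|%:Z)%:~R) numq_int denq_int absz1 logn1 expr0 div1r.
    by rewrite absz_nat logn_coprime ?expr0 ?invr1 // prime_coprime.
  by rewrite ln1 oppr0 log_plus_ge0.
have natE c : nu 0%N c%:R = c%:R by rewrite -(ratr_nat algC) nu0 normr_nat ratr_nat.
have eS : - S = ln `|denq q|%:R.
  by move/eqP: e; rewrite addrC addr_eq0 natE => /eqP ->; rewrite opprK.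
split; last first.
  by rewrite -eS; apply: le_trans ST _; rewrite lerDr log_plus_ge0.
apply: le_trans (_ : log_plus (nu 0%N (ratr q)) + ln `|denq q|%:R <= _); last first.
  by rewrite lerD2l -eS.
rewrite abs_ratE // !natE -lerBlDr.
apply: le_trans (log_plus_ge _); last by rewrite divr_gt0 ?ltr0n.
by rewrite ln_div ?posrE ?ltr0n.
Qed.

(** The constant [C] treats the archimedean case ([C = 2]) and the ultrametric one ([C = 1]) at
    once. *)
Lemma coef_prod_XsubC_le (C : R) (w : algC -> R) (zs : seq algC) k :
  absolute_value w -> 1 <= C -> (forall x y, w (x - y) <= C * Num.max (w x) (w y)) ->
  w (\prod_(z <- zs) ('X - z%:P))`_k <= C ^+ size zs * \prod_(z <- zs) Num.max 1 (w z).
Proof.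
move=> hw C1 hC; have C0 : 0 <= C := le_trans ler01 C1.
elim: zs k => [|z zs IH] k.
  rewrite !big_nil expr0 mulr1 coef1; case: k => [|k]; first by rewrite (av1 hw).
  by rewrite /= (av0 hw).
rewrite !big_cons mulrC mulrBr coefB coefMX coefMC exprS -mulrA.
set M := C ^+ size zs * \prod_(z <- zs) _ in IH.
have M0 : 0 <= M by apply: le_trans (IH 0%N); apply: av_ge0.
have m1 : 1 <= Num.max 1 (w z) by rewrite le_max lexx.
apply: le_trans (hC _ _) _; rewrite ler_wpM2l // mulrCA -/M ge_max; apply/andP; split.
  case: k => [|k] /=; first by rewrite (av0 hw) mulr_ge0 // (le_trans ler01).
  by rewrite (le_trans (IH k)) // ler_peMl.
rewrite (avM hw) mulrC ler_pM ?av_ge0 ?IH //.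
by rewrite le_max lexx orbT.
Qed.

Definition diff_constant (u : nat) : R := if u == 0%N then 2 else 1.

Lemma abs_sub_le u x y : (u == 0%N) || prime u ->
  nu u (x - y) <= diff_constant u * Num.max (nu u x) (nu u y).
Proof.
have [nu0_abs _ nup] := nuP.
rewrite /diff_constant; have [->|u0] /= := eqVneq u 0%N => hu.
  apply: le_trans (avB_le nu0_abs x y) _; rewrite mulrDl mul1r lerD //.
    by rewrite le_max lexx.
  by rewrite le_max lexx orbT.
rewrite mul1r; exact: ultraB (nup _ hu) x y.
Qed.

Lemma log_plus_coef_prod_XsubC u (zs : seq algC) k : (u == 0%N) || prime u ->
  log_plus (nu u (\prod_(z <- zs) ('X - z%:P))`_k) <=
  (size zs)%:R * ln (diff_constant u) + \sum_(z <- zs) log_plus (nu u z).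
Proof.
move=> hu; have C1 : 1 <= diff_constant u by rewrite /diff_constant; case: ifP => _; lra.
have h := coef_prod_XsubC_le zs k (abs_family_abs nuP hu) C1 (fun x y => abs_sub_le x y hu).
have C0 : 0 < diff_constant u := lt_le_trans ltr01 C1.
have P1 : 1 <= \prod_(z <- zs) Num.max 1 (nu u z).
  by elim/big_ind: _ => // [x y|z _]; [exact: mulr_ege1|rewrite le_max lexx].
have P0 := lt_le_trans ltr01 P1.
apply: le_trans (log_plus_le h) _.
rewrite /log_plus max_r; last by rewrite mulr_ege1 // exprn_ege1.
rewrite lnM ?posrE ?exprn_gt0 // lnXn // mulr_natl lerD2l.
rewrite {P1 P0 h}; elim: zs => [|z zs IH]; first by rewrite !big_nil ln1.
rewrite !big_cons lnM ?posrE ?lt_max ?ltr01 ?lerD2l //.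
by elim/big_ind: _ => // [x y|z' _]; [exact: mulr_gt0|rewrite lt_max ltr01].
Qed.

Lemma finite_bounded_polys (n M : nat) : exists polys : seq {poly rat},
  forall P : {poly rat}, (size P <= n)%N ->
    (forall k, (`|numq P`_k| <= M)%N /\ (`|denq P`_k| <= M)%N) -> P \in polys.
Proof.
pose q_of (sm : bool * nat) (d : nat) : rat := (-1) ^+ sm.1 * sm.2%:R / d%:R.
pose L := [seq q_of sm d | sm <- [seq (s, m) | s <- [:: true; false], m <- iota 0 M.+1],
                           d <- iota 0 M.+1].
have inL q : (`|numq q| <= M)%N -> (`|denq q| <= M)%N -> q \in L.
  move=> qn qd; have -> : q = q_of (numq q < 0, `|numq q|%N) `|denq q|%N.
    rewrite /q_of -{1}[q]divq_num_den {1}[numq q]intEsign -{1}(gtz0_abs (denq_gt0 q)).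
    by rewrite rmorphM /= rmorph_sign.
  apply: allpairs_f; last by rewrite mem_iota add0n ltnS.
  apply: (allpairs_f (fun s m => (s, m))); last by rewrite mem_iota add0n ltnS.
  by case: (_ < 0).
pose to_poly (t : {ffun 'I_n.+1 -> seq_sub L}) := \poly_(k < n) ssval (t (inord k)).
exists [seq to_poly t | t <- enum {: {ffun 'I_n.+1 -> seq_sub L}}].
move=> P Pn hP; apply/mapP.
have PL k : P`_k \in L by have [h1 h2] := hP k; apply: inL.
exists [ffun k : 'I_n.+1 => SeqSub (PL k)]; first by rewrite mem_enum.
apply/polyP => k; rewrite coef_poly; case: ltnP => [kn|nk].
  by rewrite ffunE /= inordK // ltnW.
by rewrite nth_default // (leq_trans Pn).
Qed.

(** An element of [F] is a root of its characteristic polynomial, which has fixed degree and whose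
    coefficients have numerators and denominators bounded in terms of the height. *)
Lemma northcott_finiteness (F : fieldExtType rat) (j : {rmorphism F -> algC}) (X : R) :
  finite_set [set a | range j a /\ weil_height R a < X].
Proof.
have [theta [f [g hg]]] := number_field_embeddings j.
set n := \dim {:F} in g hg.
have n0 : (0 < n)%N by rewrite /n adim_gt0.
have sz_enum : size (index_enum 'I_n) = n by rewrite [index_enum _]unlock -enumT size_enum_ord.
(* The [ln 2] is the logarithm of the archimedean [diff_constant], paid once for each of the [n]
   roots. *)
pose K := expR (n%:R * (X + ln 2)) : R.
pose M := (Num.truncn K).+1.
have [polys hpolys] := finite_bounded_polys n.+1 M.
pose roots := flatten [seq sval (closed_field_poly_normal (QtoC P)) | P <- polys].
apply: (@sub_finite_set _ _ [set` roots]); last exact: finite_seq.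
move=> _ [[x _ <-] hx] /=.
have [P DP] := charpoly_rational hg x.
have P_mon : P \is monic by rewrite -(map_monic (ratr : {rmorphism rat -> algC})) DP monic_prod_XsubC.
suff PM : P \in polys.
  apply/flattenP; exists (sval (closed_field_poly_normal (QtoC P))).
    by apply/mapP; exists P.
  case: closed_field_poly_normal => rs /= Drs.
  have : root (QtoC P) (j x).
    have [k hk] := charpoly_minpoly_power hg x.
    have k0 : (0 < k)%N.
      rewrite lt0n; apply/eqP => k0; have := congr1 (fun p : {poly algC} => size p) hk.
      rewrite k0 expr0 size_poly1 size_prod_XsubC sz_enum.
      by move=> [] n0e; move: n0; rewrite n0e.
    by rewrite DP hk -(prednK k0) exprS rootM root_minCpoly.
  rewrite Drs rootZ ?root_prod_XsubC // lead_coef_eq0 map_poly_eq0 monic_neq0 //.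
apply: hpolys.
  rewrite -(size_map_poly (ratr : {rmorphism rat -> algC})) DP size_prod_XsubC.
  by rewrite sz_enum.
move=> k; have [->|Pk0] := eqVneq P`_k 0; first by [].
have [B0 hB0] := padic_integral_almost R (j x).
pose B := maxn B0 (maxn `|numq P`_k| `|denq P`_k|)%N.
have hB p z : prime p -> (B < p)%N -> z \in conjugates (j x) -> nu p z <= 1.
  move=> p_prime; rewrite gtn_max => /andP[pB _]; have [_ _ nup] := nuP.
  exact: hB0 p_prime pB (nup _ p_prime) z.
have [|||h1 h2] := @rational_height_ge P`_k B => //.
- by rewrite !leq_max leqnn orbT.
- by rewrite !leq_max leqnn !orbT.
set T := \sum_(u <- _) _ in h1 h2.
have TX : T <= n%:R * (X + ln 2).
  rewrite /T.
  apply: le_trans (_ : \sum_(u <- abs_indices B) (n%:R * ln (diff_constant u) +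
     \sum_i log_plus (nu u (g i (j x)))) <= _).
    rewrite big_seq [leRHS]big_seq; apply: ler_sum => u /abs_indices_valid hu.
    have := log_plus_coef_prod_XsubC [seq g i (j x) | i <- index_enum 'I_n] k hu.
    by rewrite size_map [size _]sz_enum !big_map -DP coef_map.
  rewrite big_split /= mulrDr addrC lerD //.
    apply: le_trans (_ : n%:R * weil_height R (j x) <= _); last by rewrite ler_wpM2l // ltW.
    rewrite (weil_heightE nuP hB) mulrCA mulr_sumr mulr_sumr big_seq [leRHS]big_seq.
    apply: ler_sum => u _.
    rewrite -(sum_over_embeddings hg) mulrA mulVf ?mul1r // pnatr_eq0 -lt0n.
    exact: size_conjugates_gt0.
  rewrite sum_abs_indices big1 ?addr0 // => u u_prime.
  by rewrite /diff_constant gtn_eqF ?prime_gt0 // ln1 mulr0.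
have bound (m : nat) : (0 < m)%N -> ln m%:R <= T -> (m <= M)%N.
  move=> m0 mT; rewrite -(ler_nat R); apply: le_trans (ltW (truncnS_gt _)).
  by rewrite -(lnK (_ : m%:R \is Num.pos)) ?posrE ?ltr0n // ler_expR (le_trans mT).
split; apply: bound => //; rewrite absz_gt0 ?numq_eq0 ?denq_neq0 //.
Qed.

End RationalHeight.

(** * Unramified extensions *)

Section SubfieldType.
Variable S : set algC.
Hypothesis hS : subfield_set S.

(* The proof is recorded in the term for the sake of instance inference. *)
Definition subfield_pred : {pred algC} := let _ := hS in fun x => `[< S x >].

Fact subfield_pred_closed : divring_closed subfield_pred.
Proof.
have [h1 hB hV] := hS.
split=> [|x y /asboolP Sx /asboolP Sy|x y /asboolP Sx /asboolP Sy]; apply/asboolP => //.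
  exact: hB.
exact: hV.
Qed.
HB.instance Definition _ := GRing.isDivringClosed.Build algC subfield_pred subfield_pred_closed.

Definition subfield_sort := {x : algC | x \in subfield_pred}.
HB.instance Definition _ := SubChoice.on subfield_sort.
HB.instance Definition _ := [SubChoice_isSubIntegralDomain of subfield_sort by <:].
HB.instance Definition _ := [SubIntegralDomain_isSubField of subfield_sort by <:].

End SubfieldType.

Lemma subfield_type (S : set algC) : subfield_set S ->
  exists (A : fieldType) (a : {rmorphism A -> algC}), range a = S.
Proof.
move=> hS; exists (subfield_sort hS), (val : {rmorphism subfield_sort hS -> algC}).
apply/seteqP; split=> [_ [x _ <-]|x Sx]; first by have /asboolP := valP x.
have Sx' : x \in subfield_pred hS by apply/asboolP.
by exists (exist (fun x => x \in subfield_pred hS) x Sx').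
Qed.

Lemma lift_poly (A K : fieldType) (a : {rmorphism A -> K}) (P : {poly K}) :
  (forall k, range a P`_k) -> exists Q : {poly A}, map_poly a Q = P.
Proof.
move=> h; have h' k : exists x, a x = P`_k by have [x _ e] := h k; exists x.
have [c hc] := choice h'.
exists (\poly_(k < size P) c k); apply/polyP => k.
have [kP|Pk] := ltnP k (size P); first by rewrite coef_map coef_poly kP /= hc.
by rewrite !nth_default // size_map_poly (leq_trans (size_poly _ _)).
Qed.

Section UltrametricField.
Variables (R : realType) (K : fieldType) (w : K -> R).
Hypothesis wP : absolute_value w.
Hypothesis wU : forall x y, w (x + y) <= Num.max (w x) (w y).

Lemma ultrametric_sum_lt I (r : seq I) (Q : pred I) (F : I -> K) (M : R) :
  0 < M -> (forall i, Q i -> w (F i) < M) -> w (\sum_(i <- r | Q i) F i) < M.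
Proof.
move=> M0 h; elim/big_ind: _ => //; first by rewrite (av0 wP).
by move=> x y hx hy; apply: le_lt_trans (wU x y) _; rewrite gt_max hx hy.
Qed.

Lemma ultrametricB_le x y M : w x <= M -> w y <= M -> w (x - y) <= M.
Proof.
move=> hx hy; apply: le_trans (wU x (- y)) _; by rewrite (avN wP) ge_max hx hy.
Qed.

(* Newton interpolation: dividing by [X - z] loses nothing when the differences
    of the nodes are units. *)
Lemma interpolation_bound (zs : seq K) (Q : {poly K}) (M : R) k :
  uniq zs -> (forall z, z \in zs -> w z <= 1) ->
  (forall y z, y \in zs -> z \in zs -> y != z -> w (y - z) = 1) ->
  (size Q <= size zs)%N -> (forall z, z \in zs -> w Q.[z] <= M) -> 0 <= M ->
  w Q`_k <= M.
Proof.
elim: zs Q k => [|z zs IH] Q k.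
  by move=> _ _ _ /= Q0 _ M0; rewrite nth_default ?(av0 wP) // (leq_trans Q0).
move=> /= /andP[znz zs_uniq] int dist Qs QM M0.
have [Q1 DQ] : exists Q1, Q - Q.[z]%:P = Q1 * ('X - z%:P).
  by apply/factor_theorem; rewrite /root !hornerE subrr.
have zz : z \in z :: zs by rewrite mem_head.
have sub y : y \in zs -> y \in z :: zs by rewrite inE orbC => ->.
have Q1s : (size Q1 <= size zs)%N.
  have [->|Q10] := eqVneq Q1 0; first by rewrite size_poly0.
  have := congr1 (fun p : {poly K} => size p) DQ.
  rewrite size_Mmonic ?monicXsubC // size_XsubC addn2 /= => e.
  rewrite -ltnS -e; apply: leq_trans (size_polyD _ _) _.
  by rewrite geq_max size_polyN Qs (leq_trans (size_polyC_leq1 _)).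
have Q1M l : w Q1`_l <= M.
  apply: IH => // [y yz|y y' yz yz'|y yz]; [exact: int (sub _ yz)|exact: dist (sub _ yz) (sub _ yz')|].
  have yneq : y != z by apply: contraNneq znz => <-.
  have := congr1 (fun p => w p.[y]) DQ; rewrite !hornerE (avM wP) (dist y z (sub _ yz) zz yneq) mulr1 => <-.
  by apply: ultrametricB_le; apply: QM => //; apply: sub.
have -> : Q = Q1 * ('X - z%:P) + Q.[z]%:P by rewrite -DQ subrK.
rewrite coefD coefC mulrBr coefB coefMX coefMC.
have b1 : w ((if k == 0%N then 0 else Q1`_k.-1) - Q1`_k * z) <= M.
  apply: ultrametricB_le; first by case: ifP; rewrite ?(av0 wP).
  by rewrite (avM wP) (le_trans _ (Q1M k)) // ler_piMr ?av_ge0 ?int.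
apply: le_trans (wU _ _) _; rewrite ge_max b1 /=.
by case: ifP => _; rewrite ?(av0 wP) // QM.
Qed.

End UltrametricField.

Lemma completion_ultrametric (R : realType) (F E : fieldType) (v : F -> R) (w : E -> R)
    (j : {rmorphism F -> E}) : is_completion v w j ->
  (forall x y, v (x + y) <= Num.max (v x) (v y)) ->
  forall x y, w (x + y) <= Num.max (w x) (w y).
Proof.
move=> [wP _ wv dense] vU x y; apply/ler_addgt0Pr => e e0.
have e4 : 0 < e / 4 by rewrite divr_gt0.
have app z : exists a, w (z - j a) < e / 4.
  have : abs_closure w (range j) z by rewrite dense.
  by move=> /(_ _ e4)[_ [a _ <-] h]; exists a.
have [a ha] := app x; have [b hb] := app y.
have close z c : w (z - j c) < e / 4 -> v c <= w z + e / 4.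
  move=> h; rewrite -wv; have -> : j c = z - (z - j c) by rewrite subKr.
  by apply: le_trans (avB_le wP _ _) _; rewrite lerD2l ltW.
have -> : x + y = j (a + b) + ((x - j a) + (y - j b)) by rewrite rmorphD; ring.
apply: le_trans (avD wP _ _) _.
have h1 : w (x - j a + (y - j b)) <= e / 4 + e / 4.
  by apply: le_trans (avD wP _ _) _; rewrite lerD // ltW.
have h2 : w (j (a + b)) <= Num.max (w x) (w y) + e / 4.
  rewrite wv; apply: le_trans (vU a b) _; rewrite ge_max; apply/andP; split.
    by apply: le_trans (close _ _ ha) _; rewrite lerD2r le_max lexx.
  by apply: le_trans (close _ _ hb) _; rewrite lerD2r le_max lexx orbT.
apply: le_trans (lerD h2 h1) _; rewrite -addrA lerD2l; lra.
Qed.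

(** By the ultrametric inequality an [a] closer to [x] than [w x] has the same absolute value as
    [x]. *)
Lemma completion_values (R : realType) (F E : fieldType) (v : F -> R) (w : E -> R)
    (j : {rmorphism F -> E}) : is_completion v w j ->
  (forall x y, v (x + y) <= Num.max (v x) (v y)) ->
  forall x, x != 0 -> exists2 a, a != 0 & w x = v a.
Proof.
move=> EP vU x x0; have wU := completion_ultrametric EP vU.
have [wP _ wv dense] := EP.
have : abs_closure w (range j) x by rewrite dense.
have wx0 : 0 < w x by rewrite (av_gt0 wP).
move=> /(_ _ wx0)[_ [a _ <-] h]; exists a.
  by apply: contraTneq h => ->; rewrite rmorph0 subr0 ltxx.
rewrite -wv; apply/eqP; rewrite eq_le; apply/andP; split.
  have := wU (x - j a) (j a); rewrite subrK le_max => /orP[|//].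
  by rewrite leNgt h.
have -> : j a = x - (x - j a) by rewrite subKr.
by apply: ultrametricB_le => //; exact: ltW.
Qed.

Lemma deriv_prod_XsubC (K : fieldType) (zs : seq K) z : z \in zs ->
  (\prod_(y <- zs) ('X - y%:P))^`().[z] = \prod_(y <- rem z zs) (z - y).
Proof.
move=> zzs; rewrite (perm_big _ (perm_to_rem zzs)) big_cons derivM derivXsubC mul1r.
rewrite !hornerE subrr mul0r addr0 horner_prod; apply: eq_bigr => y _.
by rewrite !hornerE.
Qed.

Section UnramifiedExtension.
Variables (R : realType) (p : nat) (nu : algC -> R).
Hypothesis nuP : extends_padic p nu.

(** For a subfield this says that [S] has the value group of Q, that is, ramification index 1 for
    [nu]. *)
Definition p_power_values (S : set algC) : Prop :=
  forall c, S c -> c != 0 -> exists k : int, nu c = p%:R ^ k.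

(** The derivative at [y] is the product of the differences with the other roots; all are at most 1
    and the product is 1. *)
Lemma unit_differences (zs : seq algC) : uniq zs -> (forall z, z \in zs -> nu z <= 1) ->
  (forall z, z \in zs -> nu (\prod_(y <- zs) ('X - y%:P))^`().[z] = 1) ->
  forall y z, y \in zs -> z \in zs -> y != z -> nu (y - z) = 1.
Proof.
have [nu_abs nuU _] := nuP; move=> zs_uniq int der y z yzs zzs yz.
have le1 x : x \in zs -> nu (y - x) <= 1.
  by move=> xzs; apply: (ultrametricB_le nu_abs nuU) => //; apply: int.
have := der y yzs; rewrite deriv_prod_XsubC // (av_prod nu_abs).
have zr : z \in rem y zs by rewrite mem_rem_uniq // inE eq_sym yz zzs.
rewrite (perm_big _ (perm_to_rem zr)) big_cons.
set T := \prod_(x <- _) _ => e.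
have T1 : T <= 1.
  rewrite /T big_seq; apply: prodr_ile1 => x /mem_rem/mem_rem xzs.
  by rewrite av_ge0 //= le1.
apply/eqP; rewrite eq_le le1 //= -[leLHS]e /= ler_piMr // av_ge0 //.
Qed.

(* Over the completion of [S] the minimal polynomial of [r] is a product of some
    [X - z], and all the conjugates of [h(r)] have the same absolute value; by
    interpolation this is the largest absolute value of the coefficients of [h]
    reduced modulo the minimal polynomial. *)
Lemma unramified_extension (S : set algC) (zs : seq algC) (r : algC) (h : {poly algC}) :
  subfield_set S -> p_power_values S -> uniq zs ->
  (forall k, S (\prod_(y <- zs) ('X - y%:P))`_k) ->
  (forall z, z \in zs -> nu z <= 1) ->
  (forall z, z \in zs -> nu (\prod_(y <- zs) ('X - y%:P))^`().[z] = 1) ->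
  r \in zs -> (forall k, S h`_k) -> h.[r] != 0 -> exists k : int, nu h.[r] = p%:R ^ k.
Proof.
have [nu_abs nuU _] := nuP.
move=> hS Sval zs_uniq Sf int der rzs Sh hr0.
have dist := unit_differences zs_uniq int der.
have [A0 [a Ra]] := subfield_type hS.
pose vA x := nu (a x).
have vAP : absolute_value vA by apply: absolute_value_comp.
have vAU x y : vA (x + y) <= Num.max (vA x) (vA y) by rewrite /vA rmorphD nuU.
have [A [wA [al aP]]] := completion_exists vAP.
have [wAP wAc wAa _] := aP.
have [C [w [kap CP]]] := completion_exists nu_abs.
have [wP wc wk _] := CP.
have wU := completion_ultrametric CP nuU.
have [phi [phia phiw]] : exists Phi : {rmorphism A -> C},
    (forall x, Phi (al x) = kap (a x)) /\ (forall y, w (Phi y) = wA y).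
  by apply: (@completion_extension _ _ _ _ vA wA w al (kap \o a)%FUN) => // x; rewrite /= wk.
have lift (P : {poly algC}) : (forall k, S P`_k) -> exists Q : {poly A}, map_poly phi Q = map_poly kap P.
  move=> SP; have [|Q DQ] := @lift_poly _ _ a P; first by rewrite Ra.
  exists (map_poly al Q); rewrite -DQ -!map_poly_comp; apply: eq_map_poly => x.
  by rewrite /= phia.
have [fA DfA] := lift _ Sf; have [hA DhA] := lift _ Sh.
have DfC : map_poly phi fA = \prod_(z <- map kap zs) ('X - z%:P).
  by rewrite DfA rmorph_prod big_map; apply: eq_bigr => z _; rewrite /= map_polyXsubC.
have fr : root (map_poly phi fA) (kap r) by rewrite DfC root_prod_XsubC map_f.
have fA0 : fA != 0.
  by rewrite -(map_poly_eq0 phi) DfC monic_neq0 // monic_prod_XsubC.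
have [gA gAP] := minpoly_exists fA0 fr.
have [gA_mon gA_root gA_dvd] := gAP.
have := gA_dvd _ fr; rewrite -(dvdp_map phi) DfC => /dvdp_prod_XsubC[m].
set I := mask m _ => gAI.
have {}gAI : map_poly phi gA = \prod_(z <- I) ('X - z%:P).
  by apply/eqP; rewrite -eqp_monic // ?map_monic // monic_prod_XsubC.
have Izs z : z \in I -> exists2 y, y \in zs & z = kap y.
  by move=> /mem_mask/mapP[y yzs ->]; exists y.
have I_uniq : uniq I by rewrite mask_uniq // map_inj_uniq //; exact: fmorph_inj.
pose q := hA %% gA.
have qE z : root (map_poly phi gA) z -> (map_poly phi hA).[z] = (map_poly phi q).[z].
  move=> gz; rewrite {1}(divp_eq hA gA) rmorphD rmorphM /= hornerD hornerM (eqP gz).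
  by rewrite mulr0 add0r.
have hrE : kap h.[r] = (map_poly phi q).[kap r] by rewrite -qE // DhA horner_map.
have nu0 : 0 < nu h.[r] by rewrite (av_gt0 nu_abs).
have sq : (size q < size gA)%N by rewrite ltn_modp monic_neq0.
have sI : size gA = (size I).+1 by rewrite -(size_map_poly phi) gAI size_prod_XsubC.
have coef_le k : w (map_poly phi q)`_k <= nu h.[r].
  apply: (interpolation_bound wP wU k I_uniq); rewrite ?(ltW nu0) //.
  - by move=> z /Izs[y yzs ->]; rewrite wk int.
  - move=> z1 z2 /Izs[y1 y1zs ->] /Izs[y2 y2zs ->] ne; rewrite -rmorphB wk dist //.
    by apply: contraNneq ne => ->.
  - by rewrite size_map_poly -ltnS -sI.
  - move=> z zI; rewrite -wk hrE.
    apply: (conjugate_abs_le q wAP wAc wP wP phiw phiw gAP).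
    by rewrite gAI root_prod_XsubC.
(* Conversely, since [r] is integral, the ultrametric inequality prevents all the coefficients from
   being smaller than the value at [r]. *)
have [k qk] : exists k : nat, nu h.[r] <= w (map_poly phi q)`_k.
  apply: contrapT => hk.
  suff : w (map_poly phi q).[kap r] < nu h.[r] by rewrite -hrE wk ltxx.
  rewrite horner_coef; apply: (ultrametric_sum_lt wP wU) => // i _.
  rewrite (avM wP) (avX wP) wk.
  apply: le_lt_trans (_ : w (map_poly phi q)`_i < _).
    by rewrite ler_piMr ?av_ge0 // exprn_ile1 ?av_ge0 // int.
  by rewrite ltNge; apply/negP => hi; apply: hk; exists i.
have wqk : wA q`_k = nu h.[r].
  by rewrite -phiw -coef_map; apply/eqP; rewrite eq_le coef_le qk.
have qk0 : q`_k != 0 by rewrite -(av_gt0 wAP) wqk.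
(* The coefficient lies in the completion of [S], which has no other values than [S] itself. *)
have [b b0 wb] := completion_values aP vAU qk0.
have Sb : S (a b) by rewrite -Ra; exists b.
have [|l hl] := Sval _ Sb; first by rewrite fmorph_eq0.
by exists l; rewrite -wqk wb.
Qed.

End UnramifiedExtension.

Section Adjoin.
Variable S : set algC.
Hypothesis hS : subfield_set S.

Lemma subfield1 : S 1. Proof. by case: hS. Qed.
Lemma subfieldB x y : S x -> S y -> S (x - y). Proof. by case: hS => _ h _; apply: h. Qed.
Lemma subfield0 : S 0. Proof. by rewrite -(subrr 1); apply: subfieldB; apply: subfield1. Qed.
Lemma subfieldN x : S x -> S (- x).
Proof. by move=> Sx; rewrite -sub0r; apply: subfieldB Sx; apply: subfield0. Qed.
Lemma subfieldD x y : S x -> S y -> S (x + y).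
Proof. by move=> Sx Sy; rewrite -(opprK y); apply: subfieldB => //; apply: subfieldN. Qed.
Lemma subfield_div x y : S x -> S y -> S (x / y). Proof. by case: hS => _ _; apply. Qed.
Lemma subfieldV x : S x -> S x^-1.
Proof. by move=> Sx; rewrite -[x^-1]mul1r; apply: subfield_div Sx; apply: subfield1. Qed.
Lemma subfieldM x y : S x -> S y -> S (x * y).
Proof. by move=> Sx Sy; rewrite -(invrK y); apply: subfield_div => //; apply: subfieldV. Qed.
Lemma subfieldX x n : S x -> S (x ^+ n).
Proof. by move=> Sx; elim: n => [|n IH]; rewrite ?expr0 ?exprS; [apply: subfield1|apply: subfieldM]. Qed.
Lemma subfield_nat n : S n%:R.
Proof. by elim: n => [|n IH]; [apply: subfield0|rewrite -natr1; apply: subfieldD IH _; apply: subfield1]. Qed.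
Lemma subfield_rat q : S (ratr q).
Proof.
have int (z : int) : S z%:~R.
  by case: z => n; rewrite ?NegzE ?mulrNz; [|apply: subfieldN]; apply: subfield_nat.
by rewrite /ratr; apply: subfield_div; apply: int.
Qed.
Lemma subfield_sum I (r : seq I) (Q : pred I) (F : I -> algC) :
  (forall i, Q i -> S (F i)) -> S (\sum_(i <- r | Q i) F i).
Proof. by move=> h; elim/big_ind: _ => //; [exact: subfield0|exact: subfieldD]. Qed.

Definition over_subfield (h : {poly algC}) : Prop := forall k, S h`_k.

Lemma over_subfieldB h1 h2 : over_subfield h1 -> over_subfield h2 -> over_subfield (h1 - h2).
Proof. by move=> s1 s2 k; rewrite coefB; apply: subfieldB. Qed.
Lemma over_subfieldM h1 h2 : over_subfield h1 -> over_subfield h2 -> over_subfield (h1 * h2).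
Proof. by move=> s1 s2 k; rewrite coefM; apply: subfield_sum => *; apply: subfieldM. Qed.
Lemma over_subfieldC c : S c -> over_subfield c%:P.
Proof. by move=> Sc k; rewrite coefC; case: ifP => // _; apply: subfield0. Qed.
Lemma over_subfieldX : over_subfield 'X.
Proof. by move=> k; rewrite coefX; apply: subfield_nat. Qed.

Definition adjoin (r : algC) : set algC := [set y | exists2 h, over_subfield h & y = h.[r]].

Lemma sub_adjoin r : S `<=` adjoin r.
Proof. by move=> c Sc; exists c%:P; [exact: over_subfieldC|rewrite hornerC]. Qed.

Lemma mem_adjoin r : adjoin r r.
Proof. by exists 'X; [exact: over_subfieldX|rewrite hornerX]. Qed.

(** Polynomial expressions are closed under inverses because algC is algebraic: writing the minimal
    polynomial of [y] as [q1 X + c], minimality gives [c != 0], and the inverse of [y] is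
    [- q1(y) / c]. *)
Lemma adjoin_subfield r : subfield_set (adjoin r).
Proof.
have B x y : adjoin r x -> adjoin r y -> adjoin r (x - y).
  move=> [h1 s1 ->] [h2 s2 ->]; exists (h1 - h2); first exact: over_subfieldB.
  by rewrite hornerD hornerN.
have M x y : adjoin r x -> adjoin r y -> adjoin r (x * y).
  move=> [h1 s1 ->] [h2 s2 ->]; exists (h1 * h2); first exact: over_subfieldM.
  by rewrite hornerM.
have Q c : adjoin r (ratr c) by apply: sub_adjoin; apply: subfield_rat.
have Z : adjoin r 0 by rewrite -(rmorph0 (ratr : {rmorphism rat -> algC})); apply: (Q).
have D x y : adjoin r x -> adjoin r y -> adjoin r (x + y).
  by move=> hx hy; rewrite -(opprK y); apply: (B) => //; rewrite -sub0r; apply: B.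
split=> //; first by apply: sub_adjoin; apply: subfield1.
move=> x y hx hy; apply: (M) => //.
have [->|y0] := eqVneq y 0; first by rewrite invr0.
have [q [_ q_mon] q_min] := minCpolyP y.
have qy : root (QtoC q) y by rewrite q_min.
have [[q1 c] Dq] : exists q1c, q = q1c.1 * 'X + q1c.2%:P.
  by elim/poly_ind: q {q_mon q_min qy} => [|q1 c _]; [exists (0, 0); rewrite /= mul0r add0r|exists (q1, c)].
rewrite /= in Dq.
have e : (QtoC q1).[y] * y = - ratr c.
  move: qy; rewrite Dq /root rmorphD rmorphM /= map_polyX map_polyC !hornerE /= => /eqP e.
  by apply/eqP; rewrite -addr_eq0 e.
have c0 : c != 0.
  apply/eqP => c0; move: e; rewrite c0 rmorph0 oppr0 => /eqP.
  rewrite mulf_eq0 (negPf y0) orbF => q1y.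
  have : root (QtoC q1) y by [].
  rewrite q_min Dq c0 addr0 => dv.
  have q10 : q1 != 0.
    by apply/eqP => q10; move: q_mon; rewrite Dq c0 q10 mul0r addr0 monicE lead_coef0 eq_sym oner_eq0.
  have := dvdp_leq q10 dv; rewrite size_mulX // ltnn //.
have -> : y^-1 = ratr (- c^-1) * (QtoC q1).[y].
  apply: (mulIf y0); rewrite mulVf // -mulrA e rmorphN fmorphV mulrNN mulVf //.
  by rewrite fmorph_eq0.
apply: (M) => //; rewrite horner_coef; elim/big_ind: _ => // k _.
rewrite coef_map; apply: (M); first exact: Q.
elim: (k : nat) => [|k' IH].
  by rewrite expr0 -(rmorph1 (ratr : {rmorphism rat -> algC})); apply: (Q).
by rewrite exprS; apply: (M).
Qed.

(* Polynomials over [S] can be reduced modulo [X^d - c]. *)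
Lemma reduce_mod_radical (h : {poly algC}) (c : algC) d : (0 < d)%N -> S c -> over_subfield h ->
  exists q e : {poly algC}, [/\ over_subfield e, (size e <= d)%N & h = q * ('X^d - c%:P) + e].
Proof.
move=> d0 Sc Sh; have [A [a Ra]] := subfield_type hS.
have [|hA DhA] := @lift_poly _ _ a h; first by rewrite Ra.
have [cA DcA] : exists cA, a cA = c by move: Sc; rewrite -Ra => -[cA _ <-]; exists cA.
pose m := 'X^d - cA%:P.
have m_mon : m \is monic by rewrite monicXnsubC.
exists (map_poly a (hA %/ m)), (map_poly a (hA %% m)); split.
- by move=> k; rewrite coef_map -Ra; eexists.
- rewrite size_map_poly -ltnS -(size_XnsubC cA d0) ltn_modp.
  by rewrite monic_neq0.
rewrite -DhA {1}(divp_eq hA m) rmorphD rmorphM /=; congr (_ * _ + _).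
by rewrite rmorphB /= map_polyXn map_polyC /= DcA.
Qed.

End Adjoin.

Lemma range_subfield (F : fieldType) (j : {rmorphism F -> algC}) : subfield_set (range j).
Proof.
split=> [|_ _ [x _ <-] [y _ <-]|_ _ [x _ <-] [y _ <-]].
- by exists 1; rewrite ?rmorph1.
- by exists (x - y); rewrite ?rmorphB.
- by exists (x / y); rewrite ?fmorph_div.
Qed.

Lemma rat_p_power_values (R : realType) (p : nat) (nu : algC -> R) :
  prime p -> extends_padic p nu -> p_power_values p nu (range (ratr : rat -> algC)).
Proof.
move=> p_prime [_ _ ext] _ [q _ <-]; rewrite fmorph_eq0 => q0.
exists ((logn p `|denq q|)%:Z - (logn p `|numq q|)%:Z).
by rewrite ext /padic_abs (negPf q0) expfzDr ?pnatr_eq0 -?lt0n ?prime_gt0 // -invr_expz -!exprnP.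
Qed.

(* At all but finitely many primes a primitive element is integral, with conjugates
    that are distinct modulo the prime. *)
Lemma number_field_unramified (R : realType) (F : fieldExtType rat) (j : {rmorphism F -> algC}) :
  exists B : nat, forall p (nu : algC -> R), prime p -> (B < p)%N -> extends_padic p nu ->
    p_power_values p nu (range j).
Proof.
have [theta [f [g hg]]] := number_field_embeddings j.
have [f_root Df g_inj gen] := hg.
pose zs := [seq g i (j theta) | i <- index_enum 'I_(\dim {:F})].
have zs_uniq : uniq zs by rewrite map_inj_uniq ?index_enum_uniq.
have Dzs : \prod_(z <- zs) ('X - z%:P) = QtoC f by rewrite Df big_map.
have [B1 hB1] := padic_integral_almost R (j theta).
have der0 z : z \in zs -> (\prod_(y <- zs) ('X - y%:P))^`().[z] != 0.
  move=> zzs; rewrite deriv_prod_XsubC // prodf_seq_neq0; apply/allP => y.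
  by rewrite /= mem_rem_uniq // inE subr_eq0 => /andP[]; rewrite eq_sym.
have [|b hb] := @choice _ _ (fun a B => a != 0 -> forall (p : nat) (nu : algC -> R), prime p ->
    (B < p)%N -> extends_padic p nu -> nu a = 1).
  move=> a; have [->|a0] := eqVneq a 0; first by exists 0%N.
  by have [B hB] := padic_unit_almost R a0; exists B.
pose d z := (\prod_(y <- zs) ('X - y%:P))^`().[z].
exists (B1 + \sum_(z <- zs) b (d z))%N => p nu p_prime Bp nuP.
have rzs : j theta \in zs.
  by rewrite -root_prod_XsubC Dzs -(map_in_alg_algC j) /root horner_map (eqP f_root) rmorph0.
move=> _ [x _ <-]; have [P ->] := gen x.
rewrite -horner_map map_in_alg_algC => h0.
apply: (unramified_extension nuP (S := range (ratr : rat -> algC)) (zs := zs)) => //.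
- exact: (range_subfield (ratr : {rmorphism rat -> algC})).
- exact: rat_p_power_values.
- by move=> k; rewrite Dzs coef_map; eexists.
- move=> z /mapP[i _ ->]; apply: (hB1 p nu p_prime _ nuP).
    by apply: leq_ltn_trans Bp; apply: leq_addr.
  by rewrite mem_conjugates -(minCpoly_aut (g i)) root_minCpoly.
- move=> z zzs; apply: (hb _ (der0 z zzs) p nu p_prime _ nuP).
  apply: leq_ltn_trans Bp; apply: leq_trans (leq_addl _ _).
  by rewrite [leqRHS](bigD1_seq z) //= leq_addr.
- by move=> k; rewrite coef_map; eexists.
Qed.

Lemma prod_radical_conjugates (r zeta : algC) d : (0 < d)%N -> r != 0 -> d.-primitive_root zeta ->
  uniq [seq r * zeta ^+ l | l <- iota 0 d] /\
  \prod_(z <- [seq r * zeta ^+ l | l <- iota 0 d]) ('X - z%:P) = 'X^d - (r ^+ d)%:P.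
Proof.
move=> d0 r0 zP; set zs := [seq _ | l <- _].
have zs_uniq : uniq zs.
  rewrite map_inj_in_uniq ?iota_uniq // => l m; rewrite !mem_iota !add0n => ld md /(mulfI r0)/eqP.
  by rewrite (eq_prim_root_expr zP) !modn_small // => /eqP.
split=> //.
have -> : 'X^d - (r ^+ d)%:P = lead_coef ('X^d - (r ^+ d)%:P) *: \prod_(z <- zs) ('X - z%:P).
  apply: all_roots_prod_XsubC.
  - by rewrite size_XnsubC // size_map size_iota.
  - apply/allP => _ /mapP[l _ ->]; rewrite /root !hornerE exprMn -exprM mulnC exprM.
    by rewrite (prim_expr_order zP) expr1n mulr1 subrr.
  - by rewrite uniq_rootsE.
by rewrite (monicP (monicXnsubC _ d0)) scale1r.
Qed.

(** At a root [z] of [X^d - q], both [z] and the derivative [d z^(d-1)] are units at [p], because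
    [p] differs from [q] and from [d]; so [unramified_extension] applies. *)
Lemma radical_unramified (R : realType) (p d q : nat) (nu : algC -> R) (S : set algC) (r : algC) :
  prime p -> prime d -> prime q -> q != p -> d != p -> extends_padic p nu ->
  subfield_set S -> p_power_values p nu S -> r ^+ d = q%:R ->
  p_power_values p nu (adjoin S r).
Proof.
move=> p_prime d_prime q_prime qp dp nuP hS Sval rd _ [h Sh ->] hr0.
have [nu_abs _ _] := nuP.
have d0 := prime_gt0 d_prime.
have r0 : r != 0.
  by apply/eqP => r0; move/eqP: rd; rewrite r0 expr0n gtn_eqF // eq_sym pnatr_eq0 gtn_eqF ?prime_gt0.
have [zeta zP] := C_prim_root_exists d0.
have [zs_uniq Dzs] := prod_radical_conjugates d0 r0 zP.
set zs := [seq _ | l <- _] in zs_uniq Dzs.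
have nu1 z : nu z ^+ d = 1 -> nu z = 1.
  by move=> /eqP; rewrite pexpr_eq1 ?av_ge0 // => /eqP.
have zsd z : z \in zs -> z ^+ d = q%:R.
  move=> /mapP[l _ ->]; rewrite exprMn rd -exprM mulnC exprM (prim_expr_order zP).
  by rewrite expr1n mulr1.
have zs1 z : z \in zs -> nu z = 1.
  by move=> /zsd e; apply: nu1; rewrite -(avX nu_abs) e (nu_other_prime nuP).
have rzs : r \in zs.
  by apply/mapP; exists 0%N; rewrite ?mem_iota // expr0 mulr1.
apply: (unramified_extension nuP hS Sval zs_uniq _ _ _ rzs Sh hr0).
- move=> k; rewrite Dzs rd coefB coefXn coefC; apply: subfieldB => //; first exact: subfield_nat.
  by case: ifP => _; [exact: subfield_nat|exact: subfield0].
- by move=> z /zs1 ->.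
- move=> z zzs; rewrite Dzs derivB derivXn derivC subr0 hornerMn hornerXn -mulr_natl.
  rewrite (avM nu_abs) (avX nu_abs) (zs1 z zzs) expr1n mulr1.
  by rewrite (nu_other_prime nuP).
Qed.

(** * The lower bound for the height in a radical extension *)

(** The derivative of [X^d - 1] at a root is a unit at [p], since [d] differs from [p]. *)
Lemma root_unity_difference (R : realType) (p d : nat) (nu : algC -> R) (zeta : algC) j l :
  prime p -> prime d -> d != p -> extends_padic p nu -> d.-primitive_root zeta ->
  j != l %[mod d] -> nu (zeta ^+ j - zeta ^+ l) = 1.
Proof.
move=> p_prime d_prime dp nuP zP jl; have [nu_abs _ _] := nuP.
have d0 := prime_gt0 d_prime.
have [zs_uniq Dzs] := prod_radical_conjugates d0 (oner_neq0 _) zP.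
set zs := [seq _ | l <- _] in zs_uniq Dzs.
have memzs k : zeta ^+ k \in zs.
  apply/mapP; exists (k %% d)%N; first by rewrite mem_iota add0n ltn_pmod.
  by rewrite mul1r prim_expr_mod.
have zs1 z : z \in zs -> nu z = 1.
  move=> /mapP[k _ ->]; rewrite mul1r; apply/eqP; rewrite -(@pexpr_eq1 _ _ d) ?av_ge0 //.
  by rewrite -(avX nu_abs) -exprM mulnC exprM (prim_expr_order zP) expr1n (av1 nu_abs).
apply: (unit_differences nuP zs_uniq) => //; first by move=> z /zs1 ->.
  move=> z zzs; rewrite Dzs derivB derivXn derivC subr0 hornerMn hornerXn -mulr_natl.
  by rewrite (avM nu_abs) (avX nu_abs) (zs1 z zzs) expr1n mulr1 (nu_other_prime nuP).
by rewrite (eq_prim_root_expr zP).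
Qed.

(** * Local analysis at [p] of the conjugates of an element of [S(p^(1/d))] *)

Section LocalRadical.
Variables (R : realType) (p d : nat) (nu : algC -> R) (S : set algC) (b : algC).
Hypotheses (p_prime : prime p) (d_prime : prime d) (dp : d != p).
Hypothesis nuP : extends_padic p nu.
Hypothesis Sval : p_power_values p nu S.
Hypothesis bd : b ^+ d = p%:R.

Let nu_abs : absolute_value nu. Proof. by case: nuP. Qed.
Let nuU x y : nu (x + y) <= Num.max (nu x) (nu y). Proof. by case: nuP. Qed.
Local Notation beta := (nu b).

Lemma radical_abs_exp : beta ^+ d = p%:R^-1.
Proof. by rewrite -(avX nu_abs) bd nu_prime. Qed.

Lemma radical_abs_gt0 : 0 < beta.
Proof.
rewrite (av_gt0 nu_abs); apply/eqP => b0; move/eqP: bd.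
by rewrite b0 expr0n gtn_eqF ?prime_gt0 // eq_sym pnatr_eq0 gtn_eqF ?prime_gt0.
Qed.

Lemma radical_abs_lt1 : beta < 1.
Proof.
rewrite ltNge; apply/negP => h; have := exprn_ege1 d h; rewrite radical_abs_exp leNgt => /negP; apply.
by rewrite invf_lt1 ?ltr0n ?prime_gt0 // ltr1n prime_gt1.
Qed.

Lemma radical_term_abs c k : S c -> c != 0 ->
  exists m : int, nu (c * b ^+ k) = beta ^ (k%:Z - d%:Z * m).
Proof.
move=> Sc c0; have [m hm] := Sval Sc c0; exists m.
have b0 := lt0r_neq0 radical_abs_gt0.
rewrite (avM nu_abs) (avX nu_abs) hm expfzDr // -exprnP mulrC; congr (_ * _).
by rewrite -mulrN -exprz_exp -exprnP radical_abs_exp exprz_inv opprK.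
Qed.

Lemma radical_term_abs_inj c1 c2 k1 k2 : S c1 -> S c2 -> c1 != 0 -> c2 != 0 ->
  (k1 < d)%N -> (k2 < d)%N -> nu (c1 * b ^+ k1) = nu (c2 * b ^+ k2) -> k1 = k2.
Proof.
move=> Sc1 Sc2 c10 c20 k1d k2d.
have [m1 ->] := radical_term_abs k1 Sc1 c10; have [m2 ->] := radical_term_abs k2 Sc2 c20.
move/(ieexprIz radical_abs_gt0) => e.
have {}e : k1%:Z - d%:Z * m1 = k2%:Z - d%:Z * m2.
  by apply: e; rewrite lt_eqF // radical_abs_lt1.
have : (k1%:Z = k2%:Z %[mod d])%Z.
  apply/eqP; rewrite eqz_mod_dvd; apply/dvdzP; exists (m1 - m2).
  have -> : k1%:Z - k2%:Z = d%:Z * (m1 - m2) by rewrite mulrBr; lia.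
  by rewrite mulrC.
rewrite !modz_nat => -[]; by rewrite !modn_small.
Qed.

(* The nonzero terms have distinct absolute values, since they are distinct
    modulo the value group of [S]. *)
Lemma radical_sum_abs_ge (c eps : nat -> algC) (P : pred nat) k :
  (forall i, S (c i)) -> (forall i, P i -> (i < d)%N -> nu (eps i) = 1) ->
  (k < d)%N -> P k ->
  nu (c k * b ^+ k) <= nu (\sum_(i < d | P i) c i * eps i * b ^+ i).
Proof.
move=> Sc eps1 kd Pk.
pose T (i : 'I_d) := c i * eps i * b ^+ i.
have TE (i : 'I_d) : P i -> nu (T i) = nu (c i * b ^+ i).
  by move=> Pi; rewrite /T mulrAC (avM nu_abs) eps1 // mulr1.
have [i0 Pi0 imax] : exists2 i0 : 'I_d, P i0 & forall i : 'I_d, P i -> nu (T i) <= nu (T i0).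
  case: (@Order.TotalTheory.arg_maxP _ R 'I_d (Ordinal kd) (fun i => P i) (fun i => nu (T i)) Pk).
  by move=> i0 Pi0 h; exists i0.
have := imax (Ordinal kd) Pk; rewrite TE //= => kmax.
have [ci0|ci0] := eqVneq (c i0) 0.
  apply: le_trans kmax _; rewrite /T ci0 !mul0r (av0 nu_abs); exact: av_ge0.
have Ti0 : 0 < nu (T i0).
  rewrite TE // (av_gt0 nu_abs) mulf_neq0 // expf_neq0 // -(av_eq0 nu_abs).
  by rewrite gt_eqF // radical_abs_gt0.
rewrite (bigD1 i0) //= -/(T i0) addrC (ultra_add_eq nuP) //.
apply: (ultrametric_sum_lt nu_abs nuU) => // i /andP[Pi ii0].
rewrite lt_neqAle imax // andbT; apply: contra ii0 => /eqP e.
have [ci|ci] := eqVneq (c i) 0.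
  by move: Ti0; rewrite -e /T ci !mul0r (av0 nu_abs) ltxx.
apply/eqP/ord_inj; apply: (@radical_term_abs_inj (c i) (c i0)) => //.
by rewrite -!TE.
Qed.

Variable zeta : algC.
Hypothesis zP : d.-primitive_root zeta.

Lemma radical_conjugate_expand (h : {poly algC}) j : (size h <= d)%N ->
  h.[zeta ^+ j * b] = \sum_(k < d) h`_k * zeta ^+ (j * k) * b ^+ k.
Proof.
move=> hd; rewrite (horner_coef_wide _ hd); apply: eq_bigr => k _.
by rewrite exprMn -exprM mulrA.
Qed.

Lemma radical_conjugate_sub (h : {poly algC}) j l : (size h <= d)%N ->
  h.[zeta ^+ j * b] - h.[zeta ^+ l * b] =
  \sum_(k < d | (0 < k)%N) h`_k * (zeta ^+ (j * k) - zeta ^+ (l * k)) * b ^+ k.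
Proof.
move=> hd; rewrite !radical_conjugate_expand // -sumrB [RHS]big_mkcond; apply: eq_bigr => k _.
rewrite -mulrBl -mulrBr; case: ifP => // /negbT; rewrite -eqn0Ngt => /eqP ->.
by rewrite !muln0 subrr mulr0 mul0r.
Qed.

Let zeta_abs k : nu (zeta ^+ k) = 1.
Proof.
apply/eqP; rewrite -(@pexpr_eq1 _ _ d) ?av_ge0 // ?prime_gt0 //.
by rewrite -(avX nu_abs) -exprM mulnC exprM (prim_expr_order zP) expr1n (av1 nu_abs).
Qed.

(** The constant terms cancel in the difference. A term with [0 < k < d] has absolute value
    [beta ^ m] with [m] nonzero, as [d] does not divide [k]. If [m > 0] it is at most [beta]. If
    [m < 0] its size [x] satisfies [beta x >= 1], hence [x <= beta x^2], and [x] is at most the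
    value at both conjugates since no term exceeds the sum. *)
Lemma radical_conjugate_sub_le (h : {poly algC}) j l :
  (forall k, S h`_k) -> (size h <= d)%N ->
  nu (h.[zeta ^+ j * b] - h.[zeta ^+ l * b]) <=
  beta * (Num.max 1 (nu h.[zeta ^+ j * b]) * Num.max 1 (nu h.[zeta ^+ l * b])).
Proof.
move=> Sh hd; have b0 := radical_abs_gt0; have b1 := radical_abs_lt1.
have term_le k i : (k < d)%N -> nu (h`_k * b ^+ k) <= nu h.[zeta ^+ i * b].
  move=> kd; rewrite radical_conjugate_expand //.
  apply: (@radical_sum_abs_ge (fun k => h`_k) (fun k => zeta ^+ (i * k)) xpredT) => //.
set M := beta * (_ * _).
have m1 i : 1 <= Num.max 1 (nu h.[zeta ^+ i * b]) by rewrite le_max lexx.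
have m0 i := le_trans ler01 (m1 i).
have bM : beta <= M by rewrite /M ler_peMr ?(ltW b0) // mulr_ege1.
rewrite radical_conjugate_sub //.
apply: (ultra_sum_le nuP); first exact: le_trans (ltW b0) bM.
move=> k k0; rewrite mulrAC (avM nu_abs).
apply: le_trans (_ : nu (h`_k * b ^+ k) <= _).
  rewrite ler_piMr ?av_ge0 //; apply: (ultrametricB_le nu_abs nuU); by rewrite zeta_abs.
have [hk|hk] := eqVneq h`_k 0.
  by rewrite hk mul0r (av0 nu_abs) (le_trans (ltW b0)).
have [m e] := radical_term_abs k (Sh k) hk.
have b_neq0 := lt0r_neq0 b0.
have e0 : k%:Z - d%:Z * m != 0.
  apply/eqP => e0.
  have : (d %| k)%N.
    have := dvdz_mulr m (dvdzz d%:Z).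
    by have -> : d%:Z * m = k%:Z by apply/eqP; rewrite eq_sym -subr_eq0 e0.
  by move=> /dvdn_leq -/(_ k0); rewrite leqNgt ltn_ord.
case E : (k%:Z - d%:Z * m) e0 => [[|s]|s] // _; rewrite E in e.
  apply: le_trans bM; rewrite e -exprnP exprS ler_piMr ?(ltW b0) //.
  by rewrite exprn_ile1 ?(ltW b0) ?(ltW b1).
have x0 : 0 < nu (h`_k * b ^+ k) by rewrite e exprz_gt0.
set x := nu _ in e x0 *.
have bx : 1 <= beta * x.
  rewrite e NegzE -invr_expz -exprnP exprS invfM mulrA divff // mul1r.
  by rewrite invf_ge1 ?exprn_gt0 // exprn_ile1 ?(ltW b0) ?(ltW b1).
apply: le_trans (_ : beta * (x * x) <= _).
  by rewrite mulrA ler_peMl // ltW.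
rewrite /M ler_wpM2l ?(ltW b0) // ler_pM ?(ltW x0) //.
  by rewrite le_max term_le ?orbT.
by rewrite le_max term_le ?orbT.
Qed.

(** As [k] is prime to [d], the factor [zeta^(jk) - zeta^(lk)] is a unit, so the [k]-th term of the
    difference survives and bounds it from below. *)
Lemma radical_conjugate_neq (h : {poly algC}) j l k :
  (forall k, S h`_k) -> (size h <= d)%N -> (0 < k < d)%N -> h`_k != 0 ->
  j != l %[mod d] -> h.[zeta ^+ j * b] != h.[zeta ^+ l * b].
Proof.
move=> Sh hd /andP[k0 kd] hk jl; rewrite -subr_eq0 -(av_gt0 nu_abs).
rewrite radical_conjugate_sub //.
have := @radical_sum_abs_ge (fun k => h`_k)
  (fun k => zeta ^+ (j * k) - zeta ^+ (l * k)) (fun k => 0 < k)%N k Sh _ kd k0.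
have b0 := radical_abs_gt0.
move=> le; apply: lt_le_trans (le _).
  by rewrite (av_gt0 nu_abs) mulf_neq0 // expf_neq0 // -(av_gt0 nu_abs).
move=> i i0 id; apply: (root_unity_difference p_prime d_prime dp nuP zP).
have cd : coprime i d by rewrite coprime_sym prime_coprime // gtnNdvd.
wlog le_jl : j l jl {le} / (j <= l)%N.
  move=> H; have [le_jl|/ltnW le_lj] := leqP j l; first exact: H.
  by rewrite eq_sym; apply: H => //; rewrite eq_sym.
by rewrite eq_sym eqn_mod_dvd ?leq_mul2r ?le_jl ?orbT // -mulnBl Gauss_dvdl 1?coprime_sym // -eqn_mod_dvd // eq_sym.
Qed.

Hypothesis hS : subfield_set S.

(** This amounts to the irreducibility of [X^d - p] over [S]: a remainder of degree less than [d]
    that vanishes at [b] is 0, because its nonzero terms have distinct absolute values. *)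
Lemma radical_conjugate_root (h : {poly algC}) (q : {poly rat}) j :
  (forall k, S h`_k) -> root (QtoC q) h.[b] -> root (QtoC q) h.[zeta ^+ j * b].
Proof.
move=> Sh; have d0 := prime_gt0 d_prime.
have SG : over_subfield S (QtoC q \Po h).
  rewrite comp_polyE => k; rewrite coef_sum; apply: (subfield_sum hS) => i _.
  rewrite coefZ; apply: (subfieldM hS); first by rewrite coef_map; apply: subfield_rat.
  move: k; elim: (i : nat) => [|m IH].
    by rewrite expr0; apply: (over_subfieldC hS); apply: subfield1.
  by rewrite exprS; apply: (over_subfieldM hS).
have [Q [e [Se sze DG]]] := reduce_mod_radical hS d0 (subfield_nat hS p) SG.
rewrite /root -!horner_comp DG !hornerE exprMn bd.
rewrite -exprM mulnC exprM (prim_expr_order zP) expr1n mul1r subrr !mulr0 !add0r.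
move=> eb; suff -> : e = 0 by rewrite horner0.
apply/polyP => k; rewrite coef0; have [kd|dk] := ltnP k d; last first.
  by rewrite nth_default // (leq_trans sze).
have := @radical_sum_abs_ge (fun k => e`_k) (fun=> 1) xpredT k Se _ kd isT.
have -> : \sum_(i < d | xpredT (i : nat)) e`_i * 1 * b ^+ i = e.[b].
  by rewrite (horner_coef_wide _ sze); apply: eq_bigr => i _; rewrite mulr1.
rewrite (eqP eb) (av0 nu_abs) => le.
have : nu (e`_k * b ^+ k) <= 0 by apply: le => i _ _; rewrite (av1 nu_abs).
rewrite le_eqVlt ltNge av_ge0 // orbF (av_eq0 nu_abs) mulf_eq0 expf_eq0.
have -> : (b == 0) = false.
  by apply/negbTE; rewrite -(av_gt0 nu_abs) radical_abs_gt0.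
by rewrite andbF orbF => /eqP.
Qed.

End LocalRadical.

Lemma sum_over_pairs (R : pzRingType) d (y : 'I_d -> R) :
  \sum_(j < d) \sum_(l < d | (j < l)%N) (y j + y l) = \sum_(j < d) y j *+ d.-1.
Proof.
under eq_bigr do rewrite big_split /=.
rewrite big_split /= [X in _ + X](exchange_big_dep xpredT) //= -big_split /=.
apply: eq_bigr => j _.
have -> : \sum_(l < d | (j < l)%N) y j + \sum_(i < d | (i < j)%N) y j =
    \sum_(l < d | l != j) y j.
  rewrite [RHS](bigID (fun l : 'I_d => (j < l)%N)) /=; congr (_ + _); apply: eq_bigl => l.
    by rewrite -val_eqE /=; case: ltngtP.
  by rewrite -val_eqE /=; case: ltngtP.
by rewrite (eq_bigl (mem (predC1 j))) // sumr_const cardC1 card_ord.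
Qed.

Lemma ln_prod (R : realType) (I : finType) (P : pred I) (F : I -> R) :
  (forall i, P i -> 0 < F i) -> ln (\prod_(i | P i) F i) = \sum_(i | P i) ln (F i).
Proof.
move=> F0; suff [] : 0 < \prod_(i | P i) F i /\ ln (\prod_(i | P i) F i) = \sum_(i | P i) ln (F i).
  by [].
apply: (big_ind2 (fun (x y : R) => 0 < x /\ ln x = y)) => [|x1 y1 x2 y2 [x10 <-] [x20 <-]|i Pi].
- by rewrite ln1.
- by rewrite mulr_gt0 // lnM ?posrE.
- by rewrite F0.
Qed.

(** * Local bounds for the product of the differences of the conjugates *)

Section VandermondeBounds.
Variables (R : realType) (K : fieldType) (w : K -> R).
Hypothesis wP : absolute_value w.

(** The Leibniz expansion has [d!] terms, each of them a product with exponents at most [d - 1]. *)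
Lemma vandermonde_abs_le d (a : 'I_d -> K) :
  w (\prod_(j < d) \prod_(l < d | (j < l)%N) (a l - a j)) <=
  d`!%:R * \prod_(j < d) Num.max 1 (w (a j)) ^+ d.-1.
Proof.
pose row : 'rV[K]_d := \row_j a j.
have -> : \prod_(j < d) \prod_(l < d | (j < l)%N) (a l - a j) = \det (Vandermonde d row).
  rewrite det_Vandermonde; apply: eq_bigr => j _; apply: eq_bigr => l _.
  by rewrite !mxE.
have m1 j : 1 <= Num.max 1 (w (a j)) by rewrite le_max lexx.
rewrite /determinant; apply: le_trans (av_sum wP _ _ _) _.
rewrite -(card_Sn d) -sum1_card natr_sum mulr_suml.
have -> : \sum_(s in 'S_d) (1%:R * \prod_(j < d) Num.max 1 (w (a j)) ^+ d.-1 : R) =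
   \sum_(s : 'S_d) \prod_(j < d) Num.max 1 (w (a j)) ^+ d.-1.
  by apply: eq_big => s; rewrite ?inE // mul1r.
apply: ler_sum => s _.
rewrite (avM wP) (avX wP) (avN wP) (av1 wP) expr1n mul1r (av_prod wP).
rewrite [leRHS](reindex_inj (@perm_inj _ s)) /=.
apply: ler_prod => j _; rewrite av_ge0 //= !mxE (avX wP).
apply: le_trans (_ : Num.max 1 (w (a (s j))) ^+ j <= _).
  apply: lerXn2r; rewrite ?nnegrE ?(av_ge0 wP) //; last by rewrite le_max lexx orbT.
  by rewrite le_max ler01.
apply: ler_weXn2l; first exact: m1.
by rewrite -ltnS prednK ?ltn_ord // (leq_ltn_trans (leq0n j)) ?ltn_ord.
Qed.

Lemma ln_vandermonde_le d (a : 'I_d -> K) : injective a ->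
  ln (w (\prod_(j < d) \prod_(l < d | (j < l)%N) (a l - a j))) <=
  ln d`!%:R + d.-1%:R * \sum_(j < d) log_plus (w (a j)).
Proof.
move=> a_inj.
have V0 : \prod_(j < d) \prod_(l < d | (j < l)%N) (a l - a j) != 0.
  apply/prodf_neq0 => j _; apply/prodf_neq0 => l jl; rewrite subr_eq0.
  by apply: contraTneq jl => /a_inj ->; rewrite ltnn.
have m0 j : 0 < Num.max 1 (w (a j)) by rewrite lt_max ltr01.
have fact0 : 0 < d`!%:R :> R by rewrite ltr0n fact_gt0.
apply: le_trans (_ : ln (d`!%:R * \prod_(j < d) Num.max 1 (w (a j)) ^+ d.-1) <= _).
  rewrite ler_ln ?posrE ?(av_gt0 wP) ?vandermonde_abs_le //.
  by rewrite mulr_gt0 // prodr_gt0 // => j _; rewrite exprn_gt0.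
rewrite lnM ?posrE // ?prodr_gt0 // => [|j _]; last by rewrite exprn_gt0.
rewrite lerD2l mulr_sumr.
rewrite ln_prod => [|j _]; last by rewrite exprn_gt0.
by apply: ler_sum => j _; rewrite lnXn // mulr_natl.
Qed.

(* [beta] is 1 at the primes where the differences are only integral. *)
Lemma ln_vandermonde_ultra_le d (a : 'I_d -> K) (beta : R) : injective a -> 0 < beta ->
  (forall j l, w (a l - a j) <= beta * (Num.max 1 (w (a l)) * Num.max 1 (w (a j)))) ->
  ln (w (\prod_(j < d) \prod_(l < d | (j < l)%N) (a l - a j))) <=
  (d * d.-1)%:R / 2 * ln beta + d.-1%:R * \sum_(j < d) log_plus (w (a j)).
Proof.
move=> a_inj b0 hb.
have d0 (j l : 'I_d) : (j < l)%N -> 0 < w (a l - a j).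
  move=> jl; rewrite (av_gt0 wP) subr_eq0.
  by apply: contraTneq jl => /a_inj ->; rewrite ltnn.
have m0 j : 0 < Num.max 1 (w (a j)) by rewrite lt_max ltr01.
have inner (j : 'I_d) : 0 < \prod_(l < d | (j < l)%N) w (a l - a j).
  by apply: prodr_gt0 => l; apply: d0.
rewrite (av_prod wP); under eq_bigr do rewrite (av_prod wP).
rewrite ln_prod => [|j _]; last exact: inner.
under eq_bigr => j _ do rewrite (ln_prod (d0 j)).
pose y j := log_plus (w (a j)) + ln beta / 2.
apply: le_trans (_ : \sum_(j < d) \sum_(l < d | (j < l)%N) (y j + y l) <= _).
  apply: ler_sum => j _; apply: ler_sum => l jl.
  have := hb j l; rewrite -ler_ln ?posrE ?d0 ?mulr_gt0 // !lnM ?posrE ?mulr_gt0 // => h.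
  apply: le_trans h _; rewrite /y /log_plus; lra.
rewrite sum_over_pairs /y.
under eq_bigr do rewrite mulrnDl.
rewrite big_split /= sumr_const card_ord addrC -mulrnA lerD //.
  by rewrite -mulr_natr (mulnC d.-1) le_eqVlt; apply/orP; left; apply/eqP; ring.
by rewrite mulr_sumr; apply: ler_sum => j _; rewrite mulr_natl.
Qed.

End VandermondeBounds.

Section HeightLowerBound.
Variables (R : realType) (nu : nat -> algC -> R).
Hypothesis nuP : abs_family nu.

Lemma embedding_height (F : fieldExtType rat) (j : {rmorphism F -> algC}) n theta f
    (g : 'I_n -> {rmorphism algC -> algC}) (x : F) (B : nat) :
  embedding_system j theta f g ->
  (forall p z, prime p -> (B < p)%N -> z \in conjugates (j x) -> nu p z <= 1) ->
  n%:R * weil_height R (j x) = \sum_(u <- abs_indices B) \sum_i log_plus (nu u (g i (j x))).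
Proof.
move=> hg hB; rewrite (weil_heightE nuP hB) mulrCA !mulr_sumr; apply: eq_bigr => u _.
rewrite -(sum_over_embeddings hg) mulrA mulVf ?mul1r // pnatr_eq0 -lt0n.
exact: size_conjugates_gt0.
Qed.

Lemma extends_padic_aut p (s : {rmorphism algC -> algC}) (mu : algC -> R) :
  extends_padic p mu -> extends_padic p (fun x => mu (s x)).
Proof.
move=> [h1 h2 h3]; split=> [|x y|q]; first exact: absolute_value_comp.
  by rewrite rmorphD h2.
by rewrite fmorph_rat h3.
Qed.

(* Product formula for the norm of the Vandermonde determinant of the conjugates
    of [a] over [S]. *)
Theorem height_lower_bound (S : set algC) (p d : nat) (b a : algC) :
  prime p -> prime d -> d != p -> subfield_set S ->
  (forall mu : algC -> R, extends_padic p mu -> p_power_values p mu S) ->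
  b ^+ d = p%:R -> adjoin S b a -> ~ S a ->
  ln p%:R / (2 * d%:R) - ln d`!%:R / (d * d.-1)%:R <= weil_height R a.
Proof.
move=> p_prime d_prime dp hS Sval bd [h0 Sh0 Dh0] nSa.
have d0 := prime_gt0 d_prime; have d1 := prime_gt1 d_prime.
have [q [h [Sh hd Dh]]] := reduce_mod_radical hS d0 (subfield_nat hS p) Sh0.
have {q h0 Sh0 Dh0 Dh} Da : a = h.[b].
  by rewrite Dh0 Dh !hornerE bd subrr mulr0 add0r.
have [k /andP[k0 kd] hk] : exists2 k, (0 < k < d)%N & h`_k != 0.
  apply: contrapT => hk; apply: nSa; rewrite Da.
  suff -> : h = (h`_0)%:P by rewrite hornerC.
  apply/polyP => k; rewrite coefC; case: eqP => [-> //|/eqP k0].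
  have [kd|dk] := ltnP k d; last by rewrite nth_default // (leq_trans hd).
  by apply/eqP; apply: contraT => hk'; case: hk; exists k; rewrite // lt0n k0.
have [zeta zP] := C_prim_root_exists d0.
have mod_inj (j l : 'I_d) : j != l -> (j : nat) != l %[mod d].
  by rewrite !modn_small.
have [_ _ nup] := nuP.
pose aj (j : 'I_d) := h.[zeta ^+ j * b].
(* All the [aj j] are conjugates of [a], so each of them contributes the height of [a] to the final
   sum. *)
have aj_min j : minCpoly (aj j) = minCpoly a.
  have [q [Dq _] _] := minCpolyP a.
  have : root (minCpoly a) (aj j).
    rewrite Dq; apply: (radical_conjugate_root p_prime d_prime dp (nup _ p_prime) (Sval _ (nup _ p_prime)) bd zP hS j Sh).
    by rewrite -Dq -Da root_minCpoly.
  by move=> /conjugate_automorphism[s <-]; rewrite minCpoly_aut.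
have [N [iota [xs Dxs _]]] := num_field_exists [seq aj j | j <- enum 'I_d].
have sz_xs : size xs = d by rewrite -(size_map iota) Dxs size_map size_enum_ord.
pose x (j : 'I_d) := xs`_j.
have Dx j : iota (x j) = aj j.
  rewrite -(nth_map _ 0) ?sz_xs // Dxs (nth_map j) ?size_enum_ord //.
  by rewrite nth_ord_enum.
have x_inj : injective x.
  move=> j l /(congr1 iota); rewrite !Dx => e; apply/eqP; apply: contraT => /mod_inj jl.
  have := radical_conjugate_neq p_prime d_prime dp (nup _ p_prime) (Sval _ (nup _ p_prime)) bd zP Sh hd _ hk jl.
  by rewrite k0 kd => /(_ isT)/eqP.
have [theta [f [g hg]]] := number_field_embeddings iota.
set n := \dim {:N} in g hg.
have n0 : (0 < n)%N by rewrite /n adim_gt0.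
pose delta : N := \prod_(j < d) \prod_(l < d | (j < l)%N) (x l - x j).
have delta0 : delta != 0.
  apply/prodf_neq0 => j _; apply/prodf_neq0 => l jl; rewrite subr_eq0.
  by apply: contraTneq jl => /x_inj ->; rewrite ltnn.
have [P DP] := charpoly_rational hg delta.
pose D := P.[0].
have DE : ratr D = \prod_(i < n) (- g i (iota delta)) :> algC.
  rewrite /D -horner_map DP rmorph0 horner_prod; apply: eq_bigr => i _.
  by rewrite !hornerE.
have D0 : D != 0.
  rewrite -(fmorph_eq0 (ratr : {rmorphism rat -> algC})) /= DE.
  by apply/prodf_neq0 => i _; rewrite oppr_eq0 !fmorph_eq0.
have [B0 hB0] := padic_integral_almost R a.
pose B := maxn (maxn B0 p) (maxn `|numq D| `|denq D|)%N.
have hB j r z : prime r -> (B < r)%N -> z \in conjugates (iota (x j)) -> nu r z <= 1.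
  move=> r_prime; rewrite !gtn_max -!andbA => /andP[rB _].
  rewrite mem_conjugates Dx aj_min -mem_conjugates.
  exact: hB0 r_prime rB (nup _ r_prime) z.
have hj j : n%:R * weil_height R a =
    \sum_(u <- abs_indices B) \sum_i log_plus (nu u (g i (iota (x j)))).
  rewrite -(embedding_height hg (hB j)); congr (_ * _).
  rewrite (weil_heightE nuP (hB j)) (weil_heightE nuP (a := a) (B := B)); last first.
    by move=> r z r_prime rB; rewrite mem_conjugates -(aj_min j) -Dx -mem_conjugates; apply: hB.
  by rewrite /conjugates Dx aj_min.
have := product_formula nuP D0 (_ : (`|numq D| <= B)%N) (_ : (`|denq D| <= B)%N).
rewrite !leq_max !leqnn !orbT => /(_ isT isT) pf.
(* What a place adds besides the heights: the [d!] at the archimedean one, and at [p] the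
   [d (d - 1) / 2] pairs, each with [ln beta = - ln p / d]. *)
pose e u : R := if u == 0%N then ln d`!%:R else if u == p then - (d.-1%:R / 2 * ln p%:R) else 0.
have term u i : u \in abs_indices B -> ln (nu u (g i (iota delta))) <=
    e u + d.-1%:R * \sum_(j < d) log_plus (nu u (g i (iota (x j)))).
  move=> /abs_indices_valid hu; have nu_abs := abs_family_abs nuP hu.
  pose c j := g i (iota (x j)).
  have c_inj : injective c by move=> j l /fmorph_inj/fmorph_inj/x_inj.
  have -> : g i (iota delta) = \prod_(j < d) \prod_(l < d | (j < l)%N) (c l - c j).
    rewrite !rmorph_prod; apply: eq_bigr => j _; rewrite !rmorph_prod; apply: eq_bigr => l _.
    by rewrite !rmorphB.
  rewrite /e; case: eqP => [u0|/eqP u0]; first exact: ln_vandermonde_le.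
  have u_prime : prime u by rewrite (negPf u0) in hu.
  case: eqP => [up|_]; last first.
    apply: le_trans (ln_vandermonde_ultra_le nu_abs c_inj ltr01 _) _; last by rewrite ln1 mulr0.
    by move=> j l; rewrite mul1r; apply: ultra_sub_le (nup _ u_prime) _ _.
  (* The elements [b] and [zeta] need not lie in [N]. Moving the absolute value by [g i] instead of
     the elements leaves [b], [zeta] and [S] in place; hence the hypothesis [Sval] on every
     extension [mu]. *)
  subst u; pose mu y := nu p (g i y).
  have muP : extends_padic p mu by apply: extends_padic_aut; apply: nup.
  have [mu_abs _ _] := muP.
  have b0 := radical_abs_gt0 p_prime d_prime muP bd.
  apply: le_trans (ln_vandermonde_ultra_le nu_abs c_inj b0 _) _.
    move=> j l.
    have := radical_conjugate_sub_le p_prime d_prime dp muP (Sval _ muP) bd zP l j Sh hd.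
    by rewrite -/(aj l) -/(aj j) -!Dx /mu rmorphB.
  rewrite lerD2r.
  have -> : ln (mu b) = - (ln p%:R / d%:R).
    have := congr1 (@ln R) (radical_abs_exp p_prime muP bd).
    rewrite lnXn // lnV ?posrE ?ltr0n ?prime_gt0 // => e1.
    apply: (mulIf (_ : d%:R != 0)); first by rewrite pnatr_eq0 -lt0n.
    by rewrite mulNr divfK ?pnatr_eq0 -?lt0n // mulr_natr.
  rewrite natrM mulrN lerN2 le_eqVlt; apply/orP; left; apply/eqP.
  by field; rewrite pnatr_eq0 -lt0n.
have main : 0 <= n%:R * (ln d`!%:R - d.-1%:R / 2 * ln p%:R + d.-1%:R * (d%:R * weil_height R a)).
  rewrite -{1}pf.
  apply: le_trans (_ : \sum_(u <- abs_indices B) \sum_(i < n)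
     (e u + d.-1%:R * \sum_(j < d) log_plus (nu u (g i (iota (x j))))) <= _).
    rewrite big_seq [leRHS]big_seq; apply: ler_sum => u hu.
    have nu_abs := abs_family_abs nuP (abs_indices_valid hu).
    apply: le_trans (_ : \sum_(i < n) ln (nu u (g i (iota delta))) <= _); last first.
      by apply: ler_sum => i _; apply: term.
    rewrite DE (av_prod nu_abs).
    rewrite ln_prod => [|i _]; last by rewrite (av_gt0 nu_abs) oppr_eq0 !fmorph_eq0.
    by under eq_bigr do rewrite (avN nu_abs).
  under eq_bigr do rewrite big_split /= sumr_const card_ord -mulr_sumr.
  rewrite big_split /= -mulr_sumr.
  have -> : \sum_(u <- abs_indices B) e u *+ n = n%:R * (ln d`!%:R - d.-1%:R / 2 * ln p%:R).
    under eq_bigr do rewrite -mulr_natl.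
    rewrite -mulr_sumr; congr (_ * _).
    rewrite sum_abs_indices -big_filter (bigD1_seq p) ?filter_uniq ?iota_uniq //=; last first.
      rewrite mem_filter p_prime mem_index_iota prime_gt0 //= ltnS.
      by rewrite !leq_max leqnn !orbT.
    rewrite /e !eqxx gtn_eqF ?prime_gt0 // big1_seq ?addr0 // => u /andP[up].
    by rewrite mem_filter => /andP[u_prime _]; rewrite gtn_eqF ?prime_gt0 // (negPf up).
  rewrite [in leRHS]mulrDr lerD2l.
  under eq_bigr do rewrite exchange_big /=.
  rewrite exchange_big /=.
  under eq_bigr do rewrite -hj.
  rewrite sumr_const card_ord -mulr_natl; lra.
move: main; rewrite pmulr_rge0 ?ltr0n // => main.
have d1R : 0 < d.-1%:R :> R by rewrite ltr0n -subn1 subn_gt0.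
have dR : 0 < d%:R :> R by rewrite ltr0n.
rewrite natrM lerBlDr -subr_ge0.
have -> : weil_height R a + ln d`!%:R / (d%:R * d.-1%:R) - ln p%:R / (2 * d%:R) =
  (ln d`!%:R - d.-1%:R / 2 * ln p%:R + d.-1%:R * (d%:R * weil_height R a)) / (d%:R * d.-1%:R).
  by field; rewrite !gt_eqF.
by rewrite divr_ge0 // mulr_ge0 // ltW.
Qed.

End HeightLowerBound.

(** * The Northcott numbers of the radical tower *)

(** With [y = ln x], squaring [exp (y / 2) >= 1 + y / 2] gives [x - 1 >= y + y^2 / 4], and
    [y > 4 / eps] makes [eps y^2 / 4] exceed [y]. *)
Lemma ln_lt_linear (R : realType) (eps x : R) : 0 < eps -> expR (4 / eps) < x -> ln x < eps * (x - 1).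
Proof.
move=> e0 hx; have x0 : 0 < x by apply: lt_trans hx; exact: expR_gt0.
set y := ln x; have y0 : 4 / eps < y by rewrite /y -ltr_expR lnK ?posrE.
have y1 : 0 < y by apply: lt_trans y0; rewrite divr_gt0.
have Dx : x = expR (y / 2) ^+ 2 by rewrite -expRM_natl mulrC divfK // lnK ?posrE.
have h : (1 + y / 2) ^+ 2 <= x.
  rewrite Dx lerXn2r ?nnegrE ?expR_ge0 ?expR_ge1Dx //; lra.
have k : 4 < y * eps by rewrite -ltr_pdivrMr.
apply: lt_le_trans (_ : eps * ((1 + y / 2) ^+ 2 - 1) <= _); last by rewrite ler_pM2l // lerD2r.
have -> : eps * ((1 + y / 2) ^+ 2 - 1) = y * eps + y * (y * eps) / 4 by field.
have : y * 4 < y * (y * eps) by rewrite ltr_pM2l.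
have : 0 < y * eps by rewrite mulr_gt0.
lra.
Qed.

Lemma ln_fact_le (R : realType) d : (0 < d)%N -> ln d`!%:R <= d%:R * ln d%:R :> R.
Proof.
move=> d0; rewrite mulr_natl -lnXn ?ltr0n // ler_ln ?posrE ?exprn_gt0 ?ltr0n ?fact_gt0 //.
rewrite -natrX ler_nat {d0}; elim: d => [|d IH] //.
rewrite factS expnS leq_mul2l /= (leq_trans IH) //.
by case: d {IH} => // d; rewrite leq_exp2r.
Qed.

Section RadicalHeight.
Variables (R : realType) (nu : nat -> algC -> R).
Hypothesis nuP : abs_family nu.

(** Every conjugate of [r] is again a [d]-th root of [p], integral at all primes and of archimedean
    absolute value [p^(1/d)]. *)
Lemma radical_height (r : algC) (p d : nat) : prime p -> (0 < d)%N -> r ^+ d = p%:R ->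
  weil_height R r = ln p%:R / d%:R.
Proof.
move=> p_prime d0 rd; have [nu0_abs nu0 nup] := nuP.
have conj z : z \in conjugates r -> z ^+ d = p%:R.
  rewrite mem_conjugates => /conjugate_automorphism[s <-].
  by rewrite -rmorphXn rd rmorph_nat.
have le1 u z : prime u -> z \in conjugates r -> nu u z <= 1.
  move=> u_prime /conj zd; have [u_abs _ _] := nup _ u_prime.
  rewrite -(@expr_le1 _ d) ?av_ge0 // -(avX u_abs) zd.
  exact: padic_abs_nat_le1 u_prime (nup _ u_prime) p.
rewrite (weil_heightE nuP (B := p)) => [|u z u_prime _]; last exact: le1.
rewrite sum_abs_indices [X in _ + X]big1 ?addr0 => [|u u_prime]; last first.
  by rewrite big_seq big1 // => z zr; rewrite /log_plus max_l ?ln1 // le1.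
rewrite big_seq (eq_bigr (fun=> ln p%:R / d%:R)) => [|z zr]; last first.
  have z1 : nu 0%N z ^+ d = p%:R.
    by rewrite -(avX nu0_abs) conj // -(ratr_nat algC) nu0 normr_nat ratr_nat.
  have z_ge1 : 1 <= nu 0%N z.
    by rewrite -(@expr_ge1 _ d) ?av_ge0 // z1 ler1n prime_gt0.
  rewrite /log_plus max_r // -z1 lnXn ?(lt_le_trans ltr01) //.
  by rewrite -[ln _ *+ d]mulr_natr mulfK // pnatr_eq0 -lt0n.
rewrite -big_seq big_const_seq count_predT iter_addr addr0.
rewrite -(mulr_natl (ln p%:R / d%:R)) mulKf //.
by rewrite pnatr_eq0 -lt0n size_conjugates_gt0.
Qed.

End RadicalHeight.

Fixpoint radical_tower (S : set algC) (r : nat -> algC) (i : nat) : set algC :=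
  if i is i'.+1 then adjoin (radical_tower S r i') (r i') else S.

Section Tower.
Variables (K : fieldExtType rat) (j : {rmorphism K -> algC}) (r : nat -> algC).
Local Notation T := (radical_tower (range j) r).

Lemma tower_subfield i : subfield_set (T i).
Proof. by elim: i => [|i IH]; [exact: range_subfield|exact: adjoin_subfield]. Qed.

Lemma tower_mono i k : (i <= k)%N -> T i `<=` T k.
Proof.
move=> /subnK <-; elim: (k - i)%N => [|m IH] //.
by rewrite addSn; apply: subset_trans IH _; apply: sub_adjoin; apply: tower_subfield.
Qed.

Lemma generated_sub_tower : generated_field (range j `|` range r) `<=` \bigcup_i T i.
Proof.
apply: smallest_sub; last first.
  move=> x [jx|[i _ <-]]; first by exists 0%N.
  by exists i.+1 => //; apply: mem_adjoin; apply: tower_subfield.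
have common x y : (\bigcup_i T i) x -> (\bigcup_i T i) y -> exists i, T i x /\ T i y.
  move=> [i _ Tx] [k _ Ty]; exists (maxn i k).
  by split; [apply: tower_mono Tx; apply: leq_maxl|apply: tower_mono Ty; apply: leq_maxr].
split=> [|x y hx hy|x y hx hy].
- by exists 0%N => //; apply: subfield1; apply: tower_subfield.
- have [i [Tx Ty]] := common _ _ hx hy; exists i => //.
  by apply: subfieldB => //; apply: tower_subfield.
- have [i [Tx Ty]] := common _ _ hx hy; exists i => //.
  by apply: subfield_div => //; apply: tower_subfield.
Qed.

Lemma tower_number_field i : exists (F : fieldExtType rat) (iota : {rmorphism F -> algC}),
  T i `<=` range iota.
Proof.
have [theta [f [g [_ _ _ gen]]]] := number_field_embeddings j.
have [F [iota [s1 Ds1 _]]] := num_field_exists (j theta :: [seq r k | k <- iota 0 i]).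
exists F, iota; have iF := range_subfield iota.
have mem a : a \in j theta :: [seq r k | k <- mathcomp.boot.seq.iota 0 i] -> range iota a.
  by rewrite -Ds1 => /mapP[x _ ->]; exists x.
have mem_r k : (k < i)%N -> range iota (r k).
  by move=> ki; apply: mem; rewrite inE map_f ?orbT // mem_iota.
have adj S a : S `<=` range iota -> range iota a -> adjoin S a `<=` range iota.
  move=> SF Fa _ [h Sh ->]; rewrite horner_coef; apply: (subfield_sum iF) => k _.
  by apply: (subfieldM iF); [apply: SF|apply: (subfieldX iF)].
have : forall k, (k <= i)%N -> T k `<=` range iota.
  elim=> [_ _ [x _ <-]|k IH ki] /=.
    have [P ->] := gen x; rewrite -horner_map map_in_alg_algC horner_coef.
    apply: (subfield_sum iF) => l _; rewrite coef_map; apply: (subfieldM iF).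
      exact: subfield_rat.
    by apply: (subfieldX iF); apply: mem; rewrite mem_head.
  by apply: adj; [apply: IH; apply: ltnW|apply: mem_r].
by apply.
Qed.

End Tower.

Section NorthcottOfRadicals.
Variables (R : realType) (t : R) (nu : nat -> algC -> R).
Hypothesis t0 : 0 <= t.
Hypothesis nuP : abs_family nu.
Variables (K : fieldExtType rat) (j : {rmorphism K -> algC}).
Variables (p d : nat -> nat) (r : nat -> algC).
Hypothesis p_prime : forall i, prime (p i).
Hypothesis d_prime : forall i, prime (d i).
Hypothesis p_incr : {homo p : m n / (m < n)%N}.
Hypothesis rd : forall i, r i ^+ d i = (p i)%:R.
Hypothesis lim : forall e : R, 0 < e -> exists N, forall i, (N <= i)%N ->
  `|ln (p i)%:R / (d i)%:R - 2 * t| < e.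

Local Notation T := (radical_tower (range j) r).
Local Notation L := (generated_field (range j `|` range r)).

Lemma prime_seq_inj : injective p.
Proof.
move=> m n e; apply/eqP; case: ltngtP => // /p_incr; by rewrite e ltnn.
Qed.

Lemma prime_seq_ge i : (i <= p i)%N.
Proof. by elim: i => [//|i IH]; apply: leq_ltn_trans IH (p_incr (ltnSn i)). Qed.

Lemma prime_seq_gt (x : R) : exists N, forall i, (N <= i)%N -> x < (p i)%:R.
Proof.
exists (Num.truncn x).+1 => i Ni; apply: lt_le_trans (truncnS_gt x) _.
by rewrite ler_nat (leq_trans Ni) // prime_seq_ge.
Qed.

(** From some step on [ln (p i) < (2 t + 1) d i], while [ln (p i)] tends to infinity. *)
Lemma degree_seq_gt (x : R) : exists N, forall i, (N <= i)%N -> x < (d i)%:R.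
Proof.
have [N1 h1] := lim ltr01; have [N2 h2] := prime_seq_gt (expR (`|x| * (2 * t + 1))).
exists (maxn N1 N2) => i; rewrite geq_max => /andP[/h1 a1 /h2 a2].
have d0 : 0 < (d i)%:R :> R by rewrite ltr0n prime_gt0.
have p0 : 0 < (p i)%:R :> R by rewrite ltr0n prime_gt0.
apply: le_lt_trans (ler_norm x) _.
have k : `|x| * (2 * t + 1) < ln (p i)%:R by rewrite -ltr_expR lnK ?posrE.
have := ler_norm (ln (p i)%:R / (d i)%:R - 2 * t) => a3.
have a4 : ln (p i)%:R / (d i)%:R < 2 * t + 1 by lra.
rewrite ltr_pdivrMr // in a4.
have t1 : 0 < 2 * t + 1 by rewrite ltr_wpDl // mulr_ge0.
by have := lt_trans k a4; rewrite (mulrC (2 * t + 1)) ltr_pM2r.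
Qed.

(* Ramification at [p i] in the first [i] steps would force [p i] to be one of the
    exponents; as [ln (p l) / d l] stays away from 0, this stops happening. *)
Lemma prime_neq_degree : 0 < t -> exists N, forall i, (N <= i)%N ->
  forall l, (l <= i)%N -> d l != p i.
Proof.
move=> tp; have [N1 h1] := lim tp; have [N2 h2] := prime_seq_gt (expR (4 / t)).
pose M := maxn N1 N2; have [N3 h3] := prime_seq_gt (\sum_(l < M) (d l)%:R).
exists N3 => i Ni l li; have [lM|Ml] := ltnP l M.
  apply: contraTneq (h3 i Ni) => <-; rewrite -leNgt (bigD1 (Ordinal lM)) //= lerDl.
  by apply: sumr_ge0.
move: Ml; rewrite geq_max => /andP[/h1 a1 /h2 a2].
apply/eqP => e.
have d0 : 0 < (d l)%:R :> R by rewrite ltr0n prime_gt0.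
(* If [d l = p i] with [l <= i], then [d l >= p l], and [ln (p l) / d l] would be at most
   [ln (p l) / p l], which is less than [t]. *)
have pd : (p l)%:R <= (d l)%:R :> R.
  rewrite ler_nat e; move: li; rewrite leq_eqVlt => /orP[/eqP -> //|/p_incr]; exact: ltnW.
have := ln_lt_linear tp a2 => a3.
have a4 : - (ln (p l)%:R / (d l)%:R - 2 * t) < t by apply: le_lt_trans a1; rewrite -normrN ler_norm.
have a5 : t < ln (p l)%:R / (d l)%:R by lra.
rewrite ltr_pdivlMr // in a5.
have : t * (p l)%:R <= t * (d l)%:R by rewrite ler_pM2l.
lra.
Qed.

(** For fixed [i] the property is carried up the tower: the radicands [p l] with [l < i] differ from
    [p i], and so do the exponents once [i] is large. *)
Lemma tower_unramified : 0 < t -> exists N, forall i, (N <= i)%N ->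
  forall mu : algC -> R, extends_padic (p i) mu -> p_power_values (p i) mu (T i).
Proof.
move=> tp; have [B hB] := number_field_unramified R j.
have [N1 h1] := prime_neq_degree tp.
exists (maxn N1 B.+1) => i; rewrite geq_max => /andP[Ni Bi] mu muP.
have : forall l, (l <= i)%N -> p_power_values (p i) mu (T l).
  elim=> [_|l IH li].
    by apply: hB muP => //; apply: leq_trans Bi (prime_seq_ge i).
  apply: (radical_unramified (p_prime i) (d_prime l) (p_prime l)) (rd l) => //.
  - by apply/eqP => /prime_seq_inj e; rewrite e ltnn in li.
  - by apply: h1 => //; apply: ltnW.
  - exact: tower_subfield.
  - by apply: IH; apply: ltnW.
by apply.
Qed.

Lemma tower_height_gt (X : R) : X < t -> 0 < t -> exists N, forall i, (N <= i)%N ->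
  forall a, T i.+1 a -> ~ T i a -> X < weil_height R a.
Proof.
move=> Xt tp; have e0 : 0 < (t - X) / 2 by lra.
have [N1 h1] := tower_unramified tp; have [N2 h2] := prime_neq_degree tp.
have [N3 h3] := lim e0; have [N4 h4] := degree_seq_gt (expR (4 / ((t - X) / 2))).
exists (maxn (maxn N1 N2) (maxn N3 N4)) => i; rewrite !geq_max -andbA.
move=> /and4P[/h1 a1 /h2 a2 /h3 a3 /h4 a4] a Ta nTa.
have := height_lower_bound nuP (p_prime i) (d_prime i) (a2 i (leqnn i))
  (tower_subfield j r i) a1 (rd i) Ta nTa.
apply: lt_le_trans.
have d1 := prime_gt1 (d_prime i); have d0 := prime_gt0 (d_prime i).
have d0R : 0 < (d i)%:R :> R by rewrite ltr0n.
have d1R : 0 < (d i).-1%:R :> R by rewrite ltr0n -subn1 subn_gt0.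
have Dd : (d i)%:R = (d i).-1%:R + 1 :> R by rewrite natr1 prednK.
have lnd := ln_lt_linear e0 a4.
(* Since [d! <= d^d], this term is at most [ln d / (d - 1)]; the [x - 1] in [ln_lt_linear] is meant
   for it. *)
have fd : ln (d i)`!%:R / (d i * (d i).-1)%:R < (t - X) / 2.
  rewrite ltr_pdivrMr ?natrM ?mulr_gt0 //.
  apply: le_lt_trans (ln_fact_le R d0) _; rewrite mulrCA ltr_pM2l //.
  by rewrite {2}Dd addrK in lnd.
have b3 : - (ln (p i)%:R / (d i)%:R - 2 * t) < (t - X) / 2.
  by apply: le_lt_trans a3; rewrite -normrN ler_norm.
have b4 : ln (p i)%:R / (2 * (d i)%:R) = (ln (p i)%:R / (d i)%:R) / 2 :> R.
  by rewrite invfM mulrA mulrAC.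
rewrite b4; lra.
Qed.

(** Equal radicals would give [p i ^ d k = p k ^ d i]. This provides infinitely many integers of
    height near [2 t]. *)
Lemma radical_injective : injective r.
Proof.
move=> i k e; apply: prime_seq_inj; apply/eqP; apply: contraT => ik.
have : r i ^+ (d i * d k) = r k ^+ (d k * d i) by rewrite e mulnC.
rewrite !exprM !rd -!natrX => /eqP; rewrite eqr_nat => /eqP e1.
have : (p i %| p k ^ d i)%N by rewrite -e1 dvdn_exp // prime_gt0.
rewrite Euclid_dvdX // => /andP[]; rewrite dvdn_prime2 //.
by rewrite (negPf ik).
Qed.

Theorem northcott_bounds_of_lim : northcott_bounds t L.
Proof.
split.
- apply/ereal_infP => _ [X [X0 Xinf] <-]; rewrite lee_fin leNgt; apply/negP => Xt.
  (* For [t = 0] there is nothing to prove, as [X >= 0]; the lemmas on the tower need [t > 0]. *)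
  have tp : 0 < t := le_lt_trans X0 Xt.
  have [N hN] := tower_height_gt Xt tp.
  have [F [inj TF]] := tower_number_field j r N.
  apply: Xinf; apply: sub_finite_set (northcott_finiteness nuP inj X).
  move=> a [La aX]; split=> //; apply: TF.
  have [i0 _ Ti0] := generated_sub_tower La.
  have ex : exists i, `[< T i a >] by exists i0; apply/asboolP.
  case: (ex_minnP ex) => i /asboolP Ti imin.
  (* Here [i] is the first step at which [a] appears. After step [N], a new element has height
     greater than [X]. *)
  apply: (tower_mono (i := i)) => //; rewrite leqNgt; apply/negP.
  case: i Ti imin => // i Ti imin Ni.
  have nTi : ~ T i a by move=> Ti'; have := imin i (asboolT Ti'); rewrite ltnn.
  by have := lt_trans aX (hN i Ni a Ti nTi); rewrite ltxx.
- apply: ereal_inf_le_tmp => _ [X [X0 Xinf] <-]; exists X => //; split=> //.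
  by apply: sub_infinite_set Xinf => a [[La _] aX]; split.
- apply/lee_addgt0Pr => e e0; apply: ereal_inf_lbound.
  exists (2 * t + e); last by rewrite EFinD.
  split; first by rewrite addr_ge0 ?mulr_ge0 // ltW.
  have [N hN] := lim e0.
  move=> fin; have : finite_set [set: nat].
    have -> : [set: nat] = (fun i => r (i + N)%N) @^-1`
        [set a | integers_of L a /\ weil_height R a < 2 * t + e].
      apply/seteqP; split=> // i _ /=; split; [split|].
      - by apply: sub_gen_smallest; right; exists (i + N)%N.
      - have mon : ('X^(d (i + N)%N) - (p (i + N)%N)%:R%:P : {poly algC}) \is monic.
          by rewrite monicXnsubC // prime_gt0.
        apply: (root_monic_Aint _ mon); first by rewrite /root !hornerE rd subrr.
        apply/polyOverP => k; rewrite coefB coefXn coefC; apply: rpredB; first exact: rpred_nat.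
        by case: ifP => _; [exact: rpred_nat|exact: rpred0].
      - rewrite (radical_height nuP (p_prime _) (prime_gt0 (d_prime _)) (rd _)).
        have := hN _ (leq_addl i N); have := ler_norm (ln (p (i + N))%:R / (d (i + N))%:R - 2 * t).
        lra.
    by apply: finite_preimage fin => i k _ _ /radical_injective/addIn.
  exact: infinite_nat.
Qed.

End NorthcottOfRadicals.

(** * Primes with prescribed radicals *)

Lemma central_binomial_ge n : (2 ^ n <= 'C(n + n, n))%N.
Proof.
elim: n => // n IH; rewrite addSn addnS expnS binS.
apply: (@leq_trans ('C(n + n, n) + 'C(n + n, n))%N); first by rewrite addnn mul2n leq_double.
apply: leq_add; first by rewrite binS leq_addl.
by case: n {IH} => // n; rewrite [leqRHS]binS leq_addr.
Qed.

Lemma sum_leq_indicator L m : (\sum_(1 <= k < m) (k <= L) <= L)%N.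
Proof.
suff : (\sum_(1 <= k < m) (k <= L) <= minn m.-1 L)%N by move=> h; apply: leq_trans h (geq_minr _ _).
elim: m => [|m IH]; first by rewrite big_geq.
case: m IH => [|m] IH; first by rewrite big_geq.
by rewrite big_nat_recr //=; move: IH => /=; lia.
Qed.

(* By Legendre's formula the exponent of [q] is at most the number of powers of
    [q] up to [2 n]. *)
Lemma logn_central_binomial q n : prime q -> (0 < n)%N ->
  (q ^ logn q 'C(n + n, n) <= n + n)%N.
Proof.
move=> q_prime n0; have q1 := prime_gt1 q_prime.
set M := (n + n)%N; have M0 : (0 < M)%N by rewrite addn_gt0 n0.
have C0 : (0 < 'C(M, n))%N by rewrite bin_gt0 leq_addr.
suff le : (logn q 'C(M, n) <= trunc_log q M)%N.
  by apply: leq_trans (trunc_logP q1 M0); rewrite leq_pexp2l // prime_gt0.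
have := bin_fact (leq_addr n n); rewrite -/M addnK => /(congr1 (logn q)).
rewrite !lognM ?fact_gt0 ?muln_gt0 ?fact_gt0 // !logn_fact // => e.
have ext : (\sum_(1 <= k < n.+1) n %/ q ^ k = \sum_(1 <= k < M.+1) n %/ q ^ k)%N.
  rewrite [RHS](@big_cat_nat _ _ _ n.+1) //= ?ltnS ?leq_addr //.
  rewrite [X in (_ = _ + X)%N]big_nat_cond [X in (_ = _ + X)%N]big1 ?addn0 // => k /andP[/andP[nk _] _].
  by rewrite divn_small // (ltn_trans nk) // ltn_expl.
rewrite ext in e.
have : (\sum_(1 <= k < M.+1) M %/ q ^ k <=
   \sum_(1 <= k < M.+1) (n %/ q ^ k + n %/ q ^ k + (k <= trunc_log q M)))%N.
  apply: leq_sum => k _; have x0 : (0 < q ^ k)%N by rewrite expn_gt0 prime_gt0.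
  have [kL|Lk] := leqP k (trunc_log q M).
    rewrite addn1 -ltnS ltn_divLR //; have := divn_eq n (q ^ k); have := ltn_pmod n x0.
    rewrite /M; set a := (n %/ _)%N; set b := (n %% _)%N; set x := (q ^ k)%N; nia.
  rewrite divn_small // ltnNge; apply/negP => /(trunc_log_max q1).
  by rewrite leqNgt Lk.
have := sum_leq_indicator (trunc_log q M) M.+1.
rewrite !big_split /= -/M; lia.
Qed.

(** At most [N] primes divide the binomial coefficient, and each prime power in its factorization is
    at most [2 n]. *)
Lemma central_binomial_le n N : (0 < n)%N ->
  (forall q, prime q -> (q <= n + n)%N -> (q <= N)%N) -> ('C(n + n, n) <= (n + n) ^ N)%N.
Proof.
move=> n0 h; have C0 : (0 < 'C(n + n, n))%N by rewrite bin_gt0 leq_addr.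
rewrite {1}(prod_prime_decomp C0) prime_decompE big_map /=.
apply: leq_trans (_ : \prod_(q <- primes 'C(n + n, n)) (n + n) <= _)%N.
  rewrite big_seq [X in (_ <= X)%N]big_seq; apply: leq_prod => q; rewrite mem_primes => /andP[q_prime _].
  exact: logn_central_binomial.
rewrite big_const_seq count_predT iter_muln_1 leq_pexp2l ?addn_gt0 ?n0 //.
rewrite -[X in (_ <= X)%N](size_iota 1); apply: uniq_leq_size; first exact: primes_uniq.
move=> q; rewrite mem_primes => /and3P[q_prime _ qC]; rewrite mem_iota prime_gt0 //= add1n ltnS.
apply: h => //.
have : (q %| (n + n)`!)%N.
  by rewrite -(bin_fact (leq_addr n n)) dvdn_mulr.
elim: (n + n)%N => [|m IH]; first by rewrite fact0 dvdn1 => /eqP q1; rewrite q1 in q_prime.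
rewrite factS Euclid_dvdM // => /orP[/dvdn_leq -> //|/IH]; exact: leqW.
Qed.

Lemma chebyshev_prime n N : (0 < n)%N -> ((n + n) ^ N < 2 ^ n)%N ->
  exists q, [/\ prime q, (N < q)%N & (q <= n + n)%N].
Proof.
move=> n0 lt; apply: contrapT => none; move: lt; rewrite ltnNge; apply/negP; rewrite negbK.
apply: leq_trans (central_binomial_ge n) _; apply: central_binomial_le => // q q_prime q2n.
by rewrite leqNgt; apply/negP => Nq; apply: none; exists q.
Qed.

Section PrimePairs.
Variable R : realType.
Implicit Types (s e M : R).

Lemma prime_gt_real M : exists2 d, prime d & M < d%:R.
Proof.
have [d Md d_prime] := prime_above (Num.truncn M); exists d => //.
by apply: lt_le_trans (truncnS_gt M) _; rewrite ler_nat.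
Qed.

Lemma expR_quadratic (x : R) : 0 <= x -> 1 + x + x ^+ 2 / 4 <= expR x.
Proof.
move=> x0; have -> : expR x = expR (x / 2) ^+ 2 by rewrite expr2 -expRD -splitr.
have -> : 1 + x + x ^+ 2 / 4 = (1 + x / 2) ^+ 2 by field.
by rewrite lerXn2r ?nnegrE ?expR_ge0 ?expR_ge1Dx // addr_ge0 // divr_ge0.
Qed.

(** For a large prime [d], Chebyshev's estimate gives a prime between [exp (s d)] and
    [exp ((s + e) d)]; the interval is wide enough because its ends have ratio [exp (e d)]. *)
Lemma prime_pair_pos s e B : 0 < s -> 0 < e ->
  exists p d, [/\ prime p, prime d, (B < p)%N & `|ln p%:R / d%:R - s| <= e].
Proof.
move=> s0 e0; set c := ln (2 : R).
have c0 : 0 < c by rewrite ln_gt0 // ltr1n.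
have ce0 : 0 < c * e ^+ 2 by rewrite mulr_gt0 ?exprn_gt0.
(* The first bound ensures [p > B], the second [exp (e d) >= 2], and the third
   [c (e d)^2 / 8 >= (s + e + c) d], which closes the comparison below. *)
have [d d_prime dM] := prime_gt_real
  (Num.max (B%:R / s) (Num.max e^-1 (8 * (s + e + c) / (c * e ^+ 2)))).
move: dM; rewrite !gt_max => /and3P[]; rewrite ltr_pdivrMr // => dB dE dC.
have {}dE : 1 < d%:R * e by rewrite -ltr_pdivrMr // div1r.
have {}dC : 8 * (s + e + c) < d%:R * (c * e ^+ 2) by rewrite -ltr_pdivrMr.
have d1 : 1 <= d%:R :> R by rewrite ler1n prime_gt0.
have d0 : 0 < d%:R :> R by apply: lt_le_trans d1.
set x := d%:R in dB dE dC d1 d0 *.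
set F := expR (s * x); set G := expR (e * x); set E := F * G.
have Es : E = expR ((s + e) * x) by rewrite mulrDl expRD.
have sx0 : 0 < s * x by rewrite mulr_gt0.
have F1 : 1 + s * x <= F := expR_ge1Dx _.
have G1 : 1 + e * x + (e * x) ^+ 2 / 4 <= G by apply: expR_quadratic; rewrite mulr_ge0 // ltW.
have F0 : 0 < F := expR_gt0 _.
have F1' : 1 <= F by apply: le_trans F1; rewrite lerDl ltW.
have G2 : 2 <= G.
  by have h := sqr_ge0 (e * x); apply: le_trans G1; lra.
have E2 : 2 <= E by rewrite -[leLHS]mul1r; apply: ler_pM => //; rewrite ?ler01 ?ler0n.
set n := Num.truncn (E / 2); set N := Num.truncn F.
have nE : n%:R <= E / 2 by rewrite truncn_le // divr_ge0 // (le_trans _ E2).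
have En : E / 2 < n.+1%:R := truncnS_gt _.
have NF : N%:R <= F by rewrite truncn_le // ltW.
have FN : F < N.+1%:R := truncnS_gt _.
have n0 : (0 < n)%N by rewrite truncn_gt0 ler_pdivlMr // mul1r.
have [|q [q_prime Nq qn]] := @chebyshev_prime n N n0.
  rewrite ltnNge; apply/negP => le.
  have {le} : n%:R * c <= N%:R * ln ((n + n)%:R : R).
    rewrite mulr_natl mulr_natl -!lnXn ?ltr0n ?addn_gt0 ?n0 //.
    by rewrite ler_ln ?posrE ?exprn_gt0 ?ltr0n ?addn_gt0 ?n0 // -!natrX ler_nat.
  have nn : (n + n)%:R <= E by rewrite natrD (le_trans (lerD nE nE)) // -splitr.
  have lnE : ln ((n + n)%:R : R) <= (s + e) * x.
    rewrite -[leRHS]expRK -Es ler_ln ?posrE ?ltr0n ?addn_gt0 ?n0 //.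
    by rewrite (lt_le_trans _ E2).
  move=> le.
  have {le lnE} le : n%:R * c <= F * ((s + e) * x).
    apply: le_trans le _; apply: le_trans (ler_wpM2l _ lnE) _; first by rewrite ler0n.
    by rewrite ler_wpM2r // mulr_ge0 ?ltW // addr_gt0.
  have {En le} le : (E / 2 - 1) * c < F * ((s + e) * x).
    by apply: lt_le_trans le; rewrite ltr_pM2r // ltrBlDr natr1.
  (* Dividing by [F >= 1] leaves only [G = exp (e d)], whose at least quadratic growth in [d] beats
     the linear right-hand side. *)
  have {le} le : (G / 2 - 1) * c < (s + e) * x.
    rewrite -(ltr_pM2l F0); apply: le_lt_trans le.
    rewrite mulrA ler_pM2r // mulrBr mulr1 /E mulrA lerB //.
  move: le; apply/negP; rewrite -leNgt.
  have h : (e * x) ^+ 2 / 8 - 1 <= G / 2 - 1.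
    have ex0 : 0 < e * x by rewrite mulr_gt0.
    lra.
  apply: le_trans (ler_wpM2r (ltW c0) h).
  have : 8 * (s + e + c) * x <= x * (c * e ^+ 2) * x by rewrite ler_pM2r // ltW.
  have cx : c <= c * x by rewrite ler_peMr // ltW.
  rewrite exprMn; nra.
have q0 : (0 : R) < q%:R by rewrite ltr0n prime_gt0.
have Fq : F < q%:R by apply: lt_le_trans FN _; rewrite ler_nat.
have qE : q%:R <= E.
  have : q%:R <= (n + n)%:R :> R by rewrite ler_nat.
  by move=> /le_trans; apply; rewrite natrD (le_trans (lerD nE nE)) // -splitr.
have lnl : s * x < ln q%:R by rewrite -[ltLHS]expRK ltr_ln ?posrE.
have lnu : ln q%:R <= (s + e) * x.
  by rewrite -[leRHS]expRK -Es ler_ln ?posrE // (lt_le_trans _ E2).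
exists q, d; split=> //.
- rewrite -(ltr_nat R); apply: lt_trans Fq; apply: lt_le_trans F1.
  by rewrite mulrC; lra.
- rewrite -/x ger0_norm ?subr_ge0 ?lerBlDl ?ler_pdivlMr ?ler_pdivrMr //; exact: ltW.
Qed.

(** For [s = 0] any prime [p > B] will do, with [d] large. *)
Lemma prime_pair s e B : 0 <= s -> 0 < e ->
  exists p d, [/\ prime p, prime d, (B < p)%N & `|ln p%:R / d%:R - s| <= e].
Proof.
rewrite le_eqVlt => /predU1P[<- e0|]; last exact: prime_pair_pos.
have [p Bp p_prime] := prime_above B.
have [d d_prime dM] := prime_gt_real (ln p%:R / e).
exists p, d; split=> //; have d0 : (0 : R) < d%:R by rewrite ltr0n prime_gt0.
rewrite subr0 ger0_norm; first by rewrite ler_pdivrMr // mulrC -ler_pdivrMr // ltW.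
by rewrite divr_ge0 // ln_ge0 // ler1n prime_gt0.
Qed.

End PrimePairs.

Lemma generated_subfield A : subfield_set (generated_field A).
Proof.
split=> [F [[F1 _ _] _]//|x y Lx Ly F FA|x y Lx Ly F FA]; have [[_ FB FD] _] := FA.
- by apply: FB; [exact: Lx|exact: Ly].
- by apply: FD; [exact: Lx|exact: Ly].
Qed.

Lemma prime_sequences (R : realType) (s : R) : 0 <= s ->
  exists p d : nat -> nat, [/\ forall i, prime (p i), forall i, prime (d i),
    {homo p : m n / (m < n)%N} &
    forall e : R, 0 < e -> exists N, forall i, (N <= i)%N ->
      `|ln (p i)%:R / (d i)%:R - s| < e].
Proof.
move=> s0.
(* The component [a.1] is the index, which sets the precision, and [a.2] is the previous prime, or 0
   at the start. *)
have step (a : nat * nat) : {b : nat * nat | [/\ prime b.1, prime b.2, (a.2 < b.1)%N &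
    `|ln b.1%:R / b.2%:R - s| <= (a.1.+1%:R)^-1]}.
  apply: cid; have e0 : 0 < (a.1.+1%:R)^-1 :> R by rewrite invr_gt0 ltr0n.
  by have [p [d h]] := prime_pair a.2 s0 e0; exists (p, d).
pose f := fix f i := sval (step (i, if i is k.+1 then (f k).1 else 0%N)).
have fP i : let b := f i in let B := if i is k.+1 then (f k).1 else 0%N in
    [/\ prime b.1, prime b.2, (B < b.1)%N & `|ln b.1%:R / b.2%:R - s| <= (i.+1%:R)^-1].
  by case: i => [|i]; exact: (svalP (step _)).
exists (fun i => (f i).1), (fun i => (f i).2); split.
- by move=> i; case: (fP i).
- by move=> i; case: (fP i).
- by apply: homo_ltn => [|i]; [exact: ltn_trans|case: (fP i.+1)].
- move=> e e0; exists (Num.truncn e^-1) => i Ni; have [_ _ _ le] := fP i.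
  apply: le_lt_trans le _; rewrite -[ltRHS]invrK ltf_pV2 ?posrE ?invr_gt0 ?ltr0n //.
  by apply: lt_le_trans (truncnS_gt _) _; rewrite ler_nat ltnS.
Qed.

Lemma real_complex_ge0 (R : realType) (x : R) : 0 <= x -> 0 <= x%:C%C.
Proof. by move=> x0; rewrite -(rmorph0 (real_complex R)) lecR. Qed.

(** Taking moduli removes the choice of the roots: the modulus of [iota (r i)] is the positive real
    root, and the logarithm is continuous at [exp s]. *)
Lemma ln_radical_lim (R : realType) (s : R) (iota : {rmorphism algC -> R[i]})
    (p d : nat -> nat) (r : nat -> algC) :
  (forall i, prime (p i)) -> (forall i, prime (d i)) ->
  (forall i, r i ^+ d i = (p i)%:R) ->
  (fun i => iota (r i) : R[i]^o) @ \oo --> ((expR s)%:C%C : R[i]^o) ->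
  (fun i => ln (p i)%:R / (d i)%:R : R) @ \oo --> s.
Proof.
move=> p_prime d_prime rd lim.
pose u i : R := expR (ln (p i)%:R / (d i)%:R).
have uE i : `|iota (r i)| = (u i)%:C%C.
  have d0 : (0 < d i)%N by exact: prime_gt0.
  have u0 : 0 <= (u i)%:C%C by exact: (real_complex_ge0 (expR_ge0 _)).
  apply/eqP; rewrite -(eqrXn2 d0) // -normrX -rmorphXn rd rmorph_nat normr_nat.
  rewrite -rmorphXn /= /u -expRM_natr mulfVK ?pnatr_eq0 -?lt0n //.
  by rewrite lnK ?posrE ?ltr0n ?prime_gt0 // rmorph_nat.
have lim_u : u @ \oo --> expR s.
  apply/cvgrPdist_lt => e e0.
  have e0' : 0 < e%:C%C :> R[i] by rewrite -(rmorph0 (real_complex R)) ltcR.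
  have /cvgrPdist_lt/(_ _ e0') := lim; apply: filterS => i /= lt.
  rewrite -ltcR; apply: le_lt_trans lt.
  have -> : `|expR s - u i|%:C%C = `| `|(expR s)%:C%C| - `|iota (r i)| |.
    rewrite uE (ger0_norm (real_complex_ge0 (expR_ge0 s))).
    by rewrite -rmorphB normc_def /= expr0n addr0 sqrtr_sqr.
  exact: ler_dist_dist.
have -> : (fun i => ln (p i)%:R / (d i)%:R : R) = @ln R \o u.
  by apply/funext => i /=; rewrite expRK.
rewrite -[s in X in _ --> X]expRK.
by apply: continuous_cvg lim_u; apply: continuous_ln; exact: expR_gt0.
Qed.

Theorem theorem3 (R : realType) (t : R) (ht : 0 <= t) :
  (exists L : set algC, subfield_set L /\ northcott_bounds t L) /\
  (forall (iota : {rmorphism algC -> R[i]})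
          (K : fieldExtType rat) (j : {rmorphism K -> algC})
          (p d : nat -> nat) (r : nat -> algC),
     (forall i, prime (p i)) -> (forall i, prime (d i)) ->
     {homo p : m n / (m < n)%N} ->
     (forall i, r i ^+ d i = (p i)%:R) ->
     (fun i => iota (r i) : R[i]^o) @ \oo --> ((expR (2 * t))%:C%C : R[i]^o) ->
     northcott_bounds t (generated_field (range j `|` range r))).
Proof.
have [nu nuP] := abs_family_exists R; split.
- have t2 : 0 <= 2 * t by rewrite mulr_ge0.
  have [p [d [p_prime d_prime p_incr lim]]] := prime_sequences t2.
  (* For the existence of [L] any number field serves as the base. *)
  have [K [j _]] := num_field_exists [::].
  pose r i : algC := (d i).-root (p i)%:R.
  have rd i : r i ^+ d i = (p i)%:R by rewrite rootCK // prime_gt0.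
  exists (generated_field (range j `|` range r)); split; first exact: generated_subfield.
  exact: (northcott_bounds_of_lim ht nuP j p_prime d_prime p_incr rd lim).
- move=> iota K j p d r p_prime d_prime p_incr rd /(ln_radical_lim p_prime d_prime rd) lim.
  apply: (northcott_bounds_of_lim ht nuP j p_prime d_prime p_incr rd) => e e0.
  have /cvgrPdist_lt/(_ _ e0)[N _ hN] := lim.
  by exists N => i Ni; rewrite distrC; apply: hN.
Qed.
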